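(* The space $M(\delta)$ has the structure of a smooth compact manifold with a $W$-action, the action being the one induced by $\sigma\cdot(\epsilon,w,x)=(\epsilon,\sigma w,\sigma x)$ for $\sigma\in W$.
   Context: $\mathfrak g$ is a real split semisimple Lie algebra of rank $l$ with split Cartan subalgebra $\mathfrak h$, simple roots $\Pi=\{\alpha_1,\dots,\alpha_l\}$, and Weyl group $W$ generated by the simple reflections $s_{\alpha_i}$. Put $\mathcal E=\{\pm1\}^l$. Twisted sign action: an action of $W$ on $\mathcal E$ for which there is an integer matrix $(a_{i,j})$ with $a_{i,i}$ even, and $a_{i,j}$ even if $i\ne j$ and $\alpha_i,\alpha_j$ are not joined in the Dynkin diagram, such that $s_{\alpha_i}$ sends $(\epsilon_j)_j$ to $(\epsilon_j\epsilon_i^{a_{j,i}})_j$. A marked Dynkin diagram is the Dynkin diagram with signs $s_{ij},s_{ji}$ attached to each edge joining $\alpha_i,\alpha_j$ (equal for single edges; $(+,+),(+,-)$ or $(-,+)$ for double edges; arbitrary for triple edges); it specifies the action with $(-1)^{a_{j,i}}=s_{ij}$ for adjacent $\alpha_i,\alpha_j$. Here $\delta$ is a marked Dynkin diagram giving rise to a twisted sign action of $W$ on $\mathcal E$, written $\epsilon\mapsto w\epsilon$. Polytope: fix $x_o$ in the open dominant chamber of $\mathfrak h$ and let $\Gamma\subset\mathfrak h$ be the convex hull of $Wx_o$. Let $\overline{C'}_e$ be the intersection of $\Gamma$ with the closed dominant chamber, $\overline{C'}_w=w(\overline{C'}_e)$, and $\overline C_w=\{w\}\times\overline{C'}_w$.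 The internal wall $C'^{\alpha_i,IN}_w$ is $w(\overline{C'}_e\cap\ker\alpha_i)$. The external wall $C'^{\alpha_i,OUT}_w$ is the facet of $\overline{C'}_w$ contained in the boundary of $\Gamma$ that meets all internal walls of $\overline{C'}_w$ except $C'^{\alpha_i,IN}_w$; explicitly it is $w\{x\in\overline{C'}_e:\omega_i(x)=\omega_i(x_o)\}$ with $\omega_i$ the $i$-th fundamental weight. Put $C_w^{\alpha_i,IN}=\{w\}\times C'^{\alpha_i,IN}_w$ and $C_w^{\alpha_i,OUT}=\{w\}\times C'^{\alpha_i,OUT}_w$. Manifold: $\tilde M(\delta)=\bigsqcup_{w\in W,\epsilon\in\mathcal E}\{\epsilon\}\times\overline C_w$, with points $(\epsilon,w,x)$, $x\in\overline{C'}_w$. $M(\delta)$ is the quotient topological space of $\tilde M(\delta)$ under the equivalence relation generated by $(\epsilon,w,x)\sim(s_{\alpha_i}\epsilon,ws_{\alpha_i},x)$ for $x\in C'^{\alpha_i,IN}_w$, and $(\epsilon,w,x)\sim(\epsilon^{(i)},w,x)$ for $x\in C'^{\alpha_i,OUT}_w$, where $\epsilon^{(i)}$ is $\epsilon$ with its $i$-th component negated. *)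

(* Defs.v *)
From HB Require Import structures.
From mathcomp Require Import all_boot all_order all_algebra.
From mathcomp Require Import all_classical all_reals all_analysis.
From Stdlib Require Import Relation_Operators.

Set Implicit Arguments.
Unset Strict Implicit.
Unset Printing Implicit Defensive.

Import Order.TTheory GRing.Theory Num.Theory.
Import numFieldNormedType.Exports.

Local Open Scope classical_set_scope.
Local Open Scope ring_scope.

Record lieAlgebra (R : realType) := LieAlgebra {
  lie_sort :> vectType R;
  bracket : lie_sort -> lie_sort -> lie_sort;
  bracket_linl : forall y, linear (bracket ^~ y);
  bracket_linr : forall x, linear (bracket x);
  bracket_alt : forall x, bracket x x = 0;
  bracket_jacobi : forall x y z,
    bracket x (bracket y z) + bracket y (bracket z x)
      + bracket z (bracket x y) = 0
}.

Section LieTheory.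
Context {R : realType} {g : lieAlgebra R}.
Implicit Types (U V : {vspace g}).

Definition bracketv U V : {vspace g} :=
  <<[seq bracket u v | u <- vbasis U, v <- vbasis V]>>%VS.

Definition lie_ideal U := forall x u : g, u \in U -> bracket x u \in U.

Definition lie_solvable U :=
  exists n, iter n (fun V => bracketv V V) U = 0%VS.

Definition lie_nilpotent U := exists n, iter n (bracketv U) U = 0%VS.

Definition lie_subalgebra U :=
  forall x y : g, x \in U -> y \in U -> bracket x y \in U.

Definition self_normalizing U :=
  forall x : g, (forall u, u \in U -> bracket x u \in U) -> x \in U.

Definition cartan_subalgebra U :=
  [/\ lie_subalgebra U, lie_nilpotent U & self_normalizing U].

Definition ad_diagonalizable (x : g) :=
  exists2 b : seq g, basis_of fullv b &
    forall v, v \in b -> exists c : R, bracket x v = c *: v.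

Definition split_cartan_subalgebra U :=
  cartan_subalgebra U /\ forall x, x \in U -> ad_diagonalizable x.

End LieTheory.

Definition lie_semisimple (R : realType) (g : lieAlgebra R) :=
  forall U : {vspace g}, lie_ideal U -> lie_solvable U -> U = 0%VS.

Section Roots.
Context {R : realType} {g : lieAlgebra R} (h : {vspace g}).
Implicit Types (a : 'Hom(subvs_of h, R^o)).

Definition root_vector a (x : g) :=
  forall t : subvs_of h, bracket (vsval t) x = (a t : R) *: x.

Definition is_root a := a != 0 /\ exists2 x : g, x != 0 & root_vector a x.

Definition simple_system l (Pi : 'I_l -> 'Hom(subvs_of h, R^o)) :=
  [/\ forall i, is_root (Pi i),
      free [seq Pi i | i <- enum 'I_l] &
      forall a, is_root a -> exists n : 'I_l -> nat,
        a = \sum_i (n i)%:R *: Pi i \/ a = - \sum_i (n i)%:R *: Pi i].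

End Roots.

Record splitSemisimple (R : realType) := SplitSemisimple {
  lie_of :> lieAlgebra R;
  cartan : {vspace lie_of};
  simple_root : 'I_(\dim cartan) -> 'Hom(subvs_of cartan, R^o);
  splitSemisimple_semisimple : lie_semisimple lie_of;
  splitSemisimple_cartan : split_cartan_subalgebra cartan;
  splitSemisimple_simple : simple_system simple_root
}.

Section RootData.
Context {R : realType} (g : splitSemisimple R).

Definition rank : nat := \dim (cartan g).

Definition cartan_coords (x : subvs_of (cartan g)) : 'rV[R]_rank :=
  \row_i coord (vbasis (cartan g)) i (vsval x).

(** [subvs_of] carries no topology in the library; a finite-dimensional real
    vector space gets the one making a linear coordinate system a
    homeomorphism onto R^n. *)
Definition cartanT : Type := initial_topology cartan_coords.
HB.instance Definition _ := Vector.copy cartanT (subvs_of (cartan g)).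
HB.instance Definition _ :=
  Topological.copy cartanT (initial_topology cartan_coords).

Definition alpha (i : 'I_rank) (x : cartanT) : R := simple_root i x.

(** The coroot of [alpha i]: the unique element of [[g_a, g_-a]] on which
    [a] takes the value 2. *)
Definition coroot (i : 'I_rank) : cartanT :=
  xget 0 [set t : cartanT | alpha i t = 2 /\
    exists e f : g, [/\ root_vector (simple_root i) e,
      root_vector (- simple_root i) f & vsval t = bracket e f]].

(** The unique linear form dual to [coroot i] in the basis of coroots. *)
Definition fund_weight (i : 'I_rank) : 'Hom(cartanT, R^o) :=
  xget 0 [set f : 'Hom(cartanT, R^o) |
    forall j, f (coroot j) = (i == j)%:R :> R].

Definition simple_refl (i : 'I_rank) : 'End(cartanT) :=
  linfun (fun x : cartanT => x - alpha i x *: coroot i).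

(** Simple reflections are involutions, so the monoid they generate is
    already the group they generate. *)
Inductive is_weyl : 'End(cartanT) -> Prop :=
| is_weyl1 : is_weyl \1%VF
| is_weyl_refl i : is_weyl (simple_refl i)
| is_weylM u v : is_weyl u -> is_weyl v -> is_weyl (u \o v)%VF.

Definition weyl : Type := set_type (is_weyl : set 'End(cartanT)).
HB.instance Definition _ := Choice.on weyl.

Definition weyl_fun (w : weyl) : 'End(cartanT) := \val w.

Lemma weyl_funP w : is_weyl (weyl_fun w).
Proof. exact: set_valP. Qed.

Definition Weyl u (wu : is_weyl u) : weyl := SigSub (mem_set wu).

Definition weyl1 : weyl := Weyl is_weyl1.
Definition weyl_s i : weyl := Weyl (is_weyl_refl i).
Definition weylM (u v : weyl) : weyl :=
  Weyl (is_weylM (weyl_funP u) (weyl_funP v)).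

(** As [weyl] is a group, a monoid action is a group action. *)
Definition is_action (X : Type) (A : weyl -> X -> X) :=
  (forall x, A weyl1 x = x) /\
  (forall u v x, A (weylM u v) x = A u (A v x)).

(** A boolean [b] encodes the sign [(-1) ^+ b]; [true] is [-1]. *)
Definition signs : Type := {ffun 'I_rank -> bool}.
HB.instance Definition _ := Choice.on signs.

Definition sgnz (b : bool) : int := (-1) ^+ b.

Definition flip (i : 'I_rank) (e : signs) : signs :=
  [ffun j => e j (+) (j == i)].

Definition joined (i j : 'I_rank) := i != j /\ alpha i (coroot j) != 0.

(** Number of edges of the Dynkin diagram between two joined vertices. *)
Definition edges (i j : 'I_rank) : R :=
  alpha i (coroot j) * alpha j (coroot i).

(** [s i j] is the sign s_ij; its values off the edges are never used. *)
Definition marking (s : 'I_rank -> 'I_rank -> bool) :=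
  forall i j, joined i j ->
    (edges i j = 1 -> s i j = s j i) /\ (edges i j = 2 -> ~~ (s i j && s j i)).

Definition twisted_sign_action (s : 'I_rank -> 'I_rank -> bool)
    (act : weyl -> signs -> signs) :=
  is_action act /\
  exists a : 'M[int]_rank,
    [/\ forall i, (2 %| a i i)%Z,
        forall i j, i != j -> ~ joined i j -> (2 %| a i j)%Z,
        forall i e j,
          sgnz (act (weyl_s i) e j) = sgnz (e j) * sgnz (e i) ^ a j i &
        forall i j, joined i j -> (-1) ^ a j i = sgnz (s i j)].

Definition convex_hull (V : lmodType R) (S : set V) : set V :=
  [set x | exists n (c : 'I_n -> R) (p : 'I_n -> V),
    [/\ forall i, 0 <= c i, \sum_i c i = 1, forall i, S (p i) &
        x = \sum_i c i *: p i]].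

Definition dominant : set cartanT := [set x | forall i, 0 <= alpha i x].
Definition open_dominant : set cartanT := [set x | forall i, 0 < alpha i x].

Section Cells.
Variable xo : cartanT.

Definition polytope : set cartanT :=
  convex_hull [set weyl_fun w xo | w in [set: weyl]].

Definition cell1 : set cartanT := polytope `&` dominant.

Definition cell (w : weyl) : set cartanT := weyl_fun w @` cell1.

Definition wall_in (i : 'I_rank) (w : weyl) : set cartanT :=
  weyl_fun w @` (cell1 `&` [set x | alpha i x = 0]).

Definition wall_out (i : 'I_rank) (w : weyl) : set cartanT :=
  weyl_fun w @` (cell1 `&` [set x | fund_weight i x = fund_weight i xo]).

(** The [sigT] topology is that of the disjoint union of the cells. *)
Definition Mtilde : Type := {p : signs * weyl & set_type (cell p.2)}.
HB.instance Definition _ := Topological.on Mtilde.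

Definition mpoint (e : signs) (w : weyl) (x : set_type (cell w)) : Mtilde :=
  existT (fun p : signs * weyl => set_type (cell p.2)) (e, w) x.

Lemma cellM (u w : weyl) (x : cartanT) :
  cell w x -> cell (weylM u w) (weyl_fun u x).
Proof.
by move=> [y c1y <-]; exists y => //; rewrite /weyl_fun/= comp_lfunE.
Qed.

Definition Mtilde_act (u : weyl) (p : Mtilde) : Mtilde :=
  let: existT (e, w) x := p in
  mpoint e (SigSub (mem_set (cellM u (set_valP x)))).

Section Quotient.
Variable act : weyl -> signs -> signs.

Inductive Mglue : Mtilde -> Mtilde -> Prop :=
| Mglue_in i e w (x : set_type (cell w)) (y : set_type (cell (weylM w (weyl_s i)))) :
    wall_in i w (\val x) -> \val x = \val y ->
    Mglue (mpoint e x) (mpoint (act (weyl_s i) e) y)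
| Mglue_out i e w (x : set_type (cell w)) :
    wall_out i w (\val x) -> Mglue (mpoint e x) (mpoint (flip i e) x).

Definition Mglue_rel (p q : Mtilde) : bool := `[< clos_refl_sym_trans _ Mglue p q >].

Lemma Mglue_rel_refl : reflexive Mglue_rel.
Proof. by move=> p; apply/asboolP/rst_refl. Qed.

Lemma Mglue_rel_sym : symmetric Mglue_rel.
Proof. by move=> p q; apply/asboolP/asboolP; exact: rst_sym. Qed.

Lemma Mglue_rel_trans : transitive Mglue_rel.
Proof.
by move=> q p r /asboolP pq /asboolP qr; apply/asboolP; exact: rst_trans pq qr.
Qed.

Definition Mglue_equiv := EquivRel _ Mglue_rel_refl Mglue_rel_sym Mglue_rel_trans.

Definition Mdelta : Type := quotient_topology {eq_quot Mglue_equiv}%qT.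
HB.instance Definition _ := Topological.on Mdelta.
HB.instance Definition _ := Quotient.on Mdelta.

Definition Mdelta_pi (p : Mtilde) : Mdelta := \pi_Mdelta%qT p.

(** The action on [Mdelta] induced by that on [Mtilde]. It is determined by
    this equation, the projection being surjective. *)
Definition induced_action (A : weyl -> Mdelta -> Mdelta) :=
  is_action A /\ forall u p, A u (Mdelta_pi p) = Mdelta_pi (Mtilde_act u p).

End Quotient.
End Cells.
End RootData.

(** A chart is a homeomorphism [cfwd] from [cdom] to its image, with
    inverse [cbwd]; values outside are irrelevant. *)
Record chart (R : realType) (X : topologicalType) (n : nat) := Chart {
  cdom : set X;
  cfwd : X -> 'rV[R]_n;
  cbwd : 'rV[R]_n -> X;
  cdom_open : open cdom;
  cfwd_open : open (cfwd @` cdom);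
  cfwdK : forall x, cdom x -> cbwd (cfwd x) = x;
  cfwd_continuous : forall x, cdom x -> {for x, continuous cfwd};
  cbwd_continuous : forall y, (cfwd @` cdom) y -> {for y, continuous cbwd}
}.

Section Smooth.
Context {R : realType}.

(** Only meaningful for [U] open: [f] is C^k on [U] when its iterated partial
    derivatives up to order [k] exist and are continuous there. *)
Fixpoint Ck (n k : nat) (U : set 'rV[R]_n) (f : 'rV[R]_n -> R^o) : Prop :=
  (forall x, U x -> {for x, continuous f}) /\
  if k is k'.+1 then
    forall i : 'I_n, (forall x, U x -> derivable f x (delta_mx 0 i)) /\
      Ck k' U (fun x => 'D_(delta_mx 0 i) f x)
  else True.

Definition smooth_on n m (U : set 'rV[R]_n) (f : 'rV[R]_n -> 'rV[R]_m) :=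
  forall (k : nat) (j : 'I_m), Ck k U (fun x => f x 0 j).

Definition smooth_atlas (X : topologicalType) (n : nat)
    (A : set (chart R X n)) :=
  (forall x, exists2 c, A c & cdom c x) /\
  (forall c d, A c -> A d ->
    smooth_on (cfwd c @` (cdom c `&` cdom d)) (cfwd d \o cbwd c)).

Definition smooth_manifold (X : topologicalType) (n : nat)
    (A : set (chart R X n)) :=
  [/\ hausdorff_space X, @second_countable X & smooth_atlas A].

Definition smooth_map (X Y : topologicalType) (n m : nat)
    (A : set (chart R X n)) (B : set (chart R Y m)) (f : X -> Y) :=
  continuous f /\
  (forall c d, A c -> B d ->
    smooth_on (cfwd c @` (cdom c `&` f @^-1` cdom d))
      (cfwd d \o f \o cbwd c)).

End Smooth.

(* Main.v *)
From HB Require Import structures.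
Require Import Defs.
From mathcomp Require Import all_boot all_order all_algebra.
From mathcomp Require Import all_classical all_reals all_analysis.
From mathcomp Require Import ring lra.
From Stdlib Require Import Relation_Operators.
Set Implicit Arguments.
Unset Strict Implicit.
Unset Printing Implicit Defensive.
Import Order.TTheory GRing.Theory Num.Theory.
Import numFieldNormedType.Exports.
Local Open Scope classical_set_scope.
Local Open Scope ring_scope.

(** Why [M] is a manifold. Let [y] be the dominant representative of the point of
    the Cartan subalgebra below a given point of [M]. The internal walls through
    [y], say those indexed by [J], glue the cells in the orbit of a chamber under
    the parabolic subgroup of [J]; these cells tile a neighbourhood of the point
    in the polytope, because the closed chambers of a finite reflection group
    tile the space and stabilisers of dominant points are parabolic
    ([dominant_representative], [dominant_stabilizer]). The external walls
    through [y], say those indexed by [K], double that neighbourhood along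
    facets of the polytope whose equations are linearly independent. Walls of the
    two kinds with the same index do not meet ([walls_disjoint]), so [J] and [K]
    are disjoint; and the parabolic subgroup of [J] changes signs in a way that
    depends on the signs indexed by [J] only ([act_diff]). Hence the two gluings
    commute, and the cells around the point form an open set, its [star],
    labelled by the parabolic subgroup and the subsets of [K].

    Coordinates on a star are the fundamental weights transported to its centre,
    except that the coordinate [k] in [K] is the square root of the distance to
    the wall [k], with a sign telling the two sides apart ([star_coord]). Using
    the distance itself would give a topological manifold whose changes of charts
    involve absolute values. With square roots the point of the Cartan subalgebra
    is a polynomial in the coordinates, and a coordinate of another chart is such
    a polynomial, a square root of a positive one, or plus or minus a coordinate
    of the first chart ([star_coord_local]). The Weyl group permutes the stars
    together with their coordinates, so it acts by changes of charts.

    The space is compact as a quotient of finitely many compact cells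
    ([cell_compact]). It is separated because two points over the same point of
    the Cartan subalgebra have disjoint stars or are glued
    ([star_meet_signs]), and rational boxes in the charts give a countable basis.

    The geometry of the Weyl group rests on the exchange property of words in the
    simple reflections ([exchange]), which needs that these are orthogonal
    reflections permuting a finite set of roots, each a combination of simple
    roots with coefficients of one sign. It yields that a dominant point lies
    above its orbit ([fund_weight_wrd_le]), and with convexity it describes the
    dominant part of the polytope by inequalities ([cell1P]).

    Semisimplicity enters through the Killing form. On the split Cartan
    subalgebra it is a sum of squares of weights, hence positive definite. The
    radical meets that subalgebra trivially, so it is a nilpotent ideal by Engel's
    theorem, and it vanishes ([killing_nondegenerate]). This produces coroots
    ([coroot_exists]), and strings of roots show that the reflections permute the
    roots ([root_refl]). *)

(** * Lie brackets and Engel's theorem *)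

Section LieBasics.
Context {R : realType} {g : lieAlgebra R}.
Implicit Types (x y z : g) (U V W D : {vspace g}).

HB.instance Definition _ x :=
  GRing.isLinear.Build R g g *:%R (bracket x) (bracket_linr x).
Definition bracketr y x : g := bracket x y.
HB.instance Definition _ y :=
  GRing.isLinear.Build R g g *:%R (bracketr y) (bracket_linl y).

Lemma bracketDl x y z : bracket (x + y) z = bracket x z + bracket y z.
Proof. exact: (raddfD (bracketr z)). Qed.
Lemma bracketDr x y z : bracket z (x + y) = bracket z x + bracket z y.
Proof. exact: raddfD. Qed.
Lemma bracketZl (c : R) x z : bracket (c *: x) z = c *: bracket x z.
Proof. exact: (linearZZ (bracketr z)). Qed.
Lemma bracketZr (c : R) x z : bracket z (c *: x) = c *: bracket z x.
Proof. exact: linearZZ. Qed.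
Lemma bracket0l z : bracket 0 z = 0.
Proof. exact: (raddf0 (bracketr z)). Qed.
Lemma bracket0r z : bracket z 0 = 0.
Proof. exact: raddf0. Qed.
Lemma bracketNr x z : bracket z (- x) = - bracket z x.
Proof. exact: raddfN. Qed.
Lemma bracket_suml I (r : seq I) P (F : I -> g) z :
  bracket (\sum_(i <- r | P i) F i) z = \sum_(i <- r | P i) bracket (F i) z.
Proof. exact: (raddf_sum (bracketr z)). Qed.
Lemma bracket_sumr I (r : seq I) P (F : I -> g) z :
  bracket z (\sum_(i <- r | P i) F i) = \sum_(i <- r | P i) bracket z (F i).
Proof. exact: raddf_sum. Qed.

Lemma bracketC x y : bracket x y = - bracket y x.
Proof.
have := bracket_alt (x + y); rewrite bracketDl !bracketDr !bracket_alt.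
by rewrite add0r addr0 => /eqP; rewrite addr_eq0 => /eqP.
Qed.

Lemma jacobi x y z :
  bracket x (bracket y z) = bracket (bracket x y) z + bracket y (bracket x z).
Proof.
have /eqP := bracket_jacobi x y z; rewrite addr_eq0 => /eqP Jxyz.
have -> : bracket x (bracket y z) =
    - bracket z (bracket x y) - bracket y (bracket z x).
  by rewrite -Jxyz addrK.
by rewrite (bracketC (bracket x y)) (bracketC x z) bracketNr.
Qed.

Lemma bracketv_subP U V W :
  reflect (forall u v, u \in U -> v \in V -> bracket u v \in W)
          (bracketv U V <= W)%VS.
Proof.
apply: (iffP span_subvP) => [UVW u v uU vV|UVW _ /allpairsP[[u v] /= [uU vV ->]]].
  rewrite (coord_vbasis uU) (coord_vbasis vV) bracket_suml memv_suml// => i _.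
  rewrite bracketZl bracket_sumr memvZ// memv_suml// => j _.
  rewrite bracketZr memvZ// UVW//; apply/allpairsP.
  by exists ((vbasis U)`_i, (vbasis V)`_j) => /=; rewrite !mem_nth ?size_tuple.
by apply: UVW; exact: vbasis_mem.
Qed.

Lemma mem_bracketv U V u v : u \in U -> v \in V -> bracket u v \in bracketv U V.
Proof. by move=> uU vV; exact: (bracketv_subP _ _ _ (subvv _)). Qed.

Lemma bracketvS U U' V V' :
  (U <= U')%VS -> (V <= V')%VS -> (bracketv U V <= bracketv U' V')%VS.
Proof.
move=> /subvP UU' /subvP VV'; apply/bracketv_subP => u v /UU' + /VV'.
exact: mem_bracketv.
Qed.


(** Spans of brackets are described by their generators; linear conditions on
    [bracketv U V] may therefore be tested on brackets. *)
Lemma bracketv_ind U V (P : g -> Prop) :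
  P 0 -> (forall a x y, P x -> P y -> P (a *: x + y)) ->
  (forall u v, u \in U -> v \in V -> P (bracket u v)) ->
  forall x, x \in bracketv U V -> P x.
Proof.
move=> P0 PZD Pb x; rewrite /bracketv; set s := (X in span X) => xs.
rewrite (coord_span (X := in_tuple s) xs).
elim/big_rec: _ => [//|i y _ Py]; apply: PZD => //.
have /allpairsP[[u v] /= [uU vV ->]] : (in_tuple s)`_i \in s by rewrite mem_nth.
by apply: Pb; exact: vbasis_mem.
Qed.

Lemma lie_ideal_bracketv U V :
  lie_ideal U -> lie_ideal V -> lie_ideal (bracketv U V).
Proof.
move=> iU iV x; apply: bracketv_ind => [|a u v xu xv|u v uU vV].
- by rewrite bracket0r mem0v.
- by rewrite bracketDr bracketZr memvD// memvZ.
- by rewrite jacobi memvD// mem_bracketv// ?iU ?iV.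
Qed.

Lemma lie_ideal_iter U k : lie_ideal U -> lie_ideal (iter k (bracketv U) U).
Proof. by move=> iU; elim: k => //= k IH; exact: lie_ideal_bracketv. Qed.

End LieBasics.

Section Engel.
Context {R : realType} {g : lieAlgebra R} (t0 : g).
Implicit Types (x y z : g) (U V W D K : {vspace g}).

Definition homog x := exists c : R, bracket t0 x = c *: x.

Definition homog_spanned U := forall u, u \in U ->
  exists2 s : seq g, (forall x, x \in s -> x \in U /\ homog x) & u = \sum_(x <- s) x.

Definition ad_nilpotent x := exists p, forall y, iter p (bracket x) y = 0.

Definition acts_nilpotently D := exists m, iter m (bracketv D) fullv = 0%VS.

Lemma homog_bracket x y : homog x -> homog y -> homog (bracket x y).
Proof.
move=> [c cx] [d dy]; exists (c + d).
by rewrite jacobi cx dy bracketZl bracketZr scalerDl.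
Qed.

Lemma homog_scale (a : R) x : homog x -> homog (a *: x).
Proof. by move=> [c cx]; exists c; rewrite bracketZr cx !scalerA mulrC. Qed.

Lemma homog_spanned_bracketv U V :
  homog_spanned U -> homog_spanned V -> homog_spanned (bracketv U V).
Proof.
move=> hU hV; apply: bracketv_ind => [|a x y [s hs ->] [r hr ->]|u v uU vV].
- by exists [::] => //; rewrite big_nil.
- exists ([seq a *: z | z <- s] ++ r) => [z|].
    rewrite mem_cat => /orP[/mapP[w ws ->]|/hr//].
    by have [wU hw] := hs _ ws; split; [exact: memvZ|exact: homog_scale].
  by rewrite big_cat big_map/= scaler_sumr.
- have [s hs ->] := hU _ uU; have [r hr ->] := hV _ vV.
  exists [seq bracket x y | x <- s, y <- r].
    move=> _ /allpairsP[[x y] /= [/hs[xU hx] /hr[yV hy] ->]].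
    by split; [exact: mem_bracketv|exact: homog_bracket].
  rewrite big_allpairs_dep bracket_suml; apply: eq_bigr => x _.
  by rewrite bracket_sumr.
Qed.

Lemma iter_bracketvS D D' V V' k : (D <= D')%VS -> (V <= V')%VS ->
  (iter k (bracketv D) V <= iter k (bracketv D') V')%VS.
Proof. by move=> DD' VV'; elim: k => //= k IH; exact: bracketvS. Qed.

(** Walking down the chain [K, [D, K], [D, [D, K]], ...], which ends at [0],
    the last term outside [D] supplies a vector normalising [D]. *)
Lemma homog_normalizer D K : homog_spanned D -> homog_spanned K ->
  acts_nilpotently D -> (D <= K)%VS -> lie_subalgebra K -> ~~ (K <= D)%VS ->
  exists x, [/\ x \in K, x \notin D, homog x &
    forall d, d \in D -> bracket d x \in D].
Proof.
move=> hD hK [m Dm] DK sK KD; pose C k := iter k (bracketv D) K.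
have exk : exists k, (C k <= D)%VS.
  exists m; apply: (@subv_trans _ _ 0%VS); last exact: sub0v.
  by rewrite -Dm; exact: iter_bracketvS (subvv _) (subvf _).
have hC k : homog_spanned (C k).
  by elim: k => [//|k]; exact: homog_spanned_bracketv.
have CK k : (C k <= K)%VS.
  elim: k => [|k IH]; first exact: subvv.
  apply/bracketv_subP => u v uD vC; apply: sK; [exact: (subvP DK)|exact: (subvP IH)].
have := ex_minnP exk; move=> [[|k] Ck mk]; first by rewrite Ck in KD.
have /subvPn[u uC uD] : ~~ (C k <= D)%VS.
  by apply/negP => /mk; rewrite ltnn.
have [s hs us] := hC k _ uC.
have [x xs xD] : exists2 x, x \in s & x \notin D.
  apply: contrapT => nx; move/negP: uD; apply; rewrite us big_seq memv_suml// => x xs.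
  by apply: contrapT => /negP xD; apply: nx; exists x.
have [xC hx] := hs _ xs.
exists x; split => //; first exact: (subvP (CK k)).
by move=> d dD; apply: (subvP Ck); exact: mem_bracketv.
Qed.

(** Normalising [D], the vector [x] preserves each term of the chain of iterated
    brackets with [D]; there [D] moves one step down, and [p] applications of
    [x] vanish. *)
Lemma acts_nilpotently_add D x : acts_nilpotently D -> ad_nilpotent x ->
  (forall d, d \in D -> bracket d x \in D) -> acts_nilpotently (D + <[x]>)%VS.
Proof.
move=> [m Dm] [p xp] Dx.
pose C k := iter k (bracketv D) fullv.
have xC k v : v \in C k -> bracket x v \in C k.
  elim: k v => [v _|k IH]; first exact: memvf.
  apply: bracketv_ind => [|a u v xu xv|u v uD vC].
  - by rewrite bracket0r mem0v.
  - by rewrite bracketDr bracketZr memvD// memvZ.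
  - rewrite jacobi memvD ?mem_bracketv ?IH//.
    by rewrite bracketC memvN Dx.
have CS k : (C k.+1 <= C k)%VS.
  elim: k => [|k IH]; first exact: subvf.
  exact: bracketvS (subvv _) IH.
have xpC k : (iter p (bracketv (D + <[x]>)) (C k) <= C k.+1)%VS.
  have step j : forall v, v \in iter j (bracketv (D + <[x]>)%VS) (C k) ->
      exists2 w, w \in C k & v - iter j (bracket x) w \in C k.+1.
    elim: j => [v vC|j IH]; first by exists v; rewrite // subrr mem0v.
    apply: bracketv_ind => [|a u v [u' u'C uu'] [v' v'C vv']|u v].
    - exists 0; rewrite ?mem0v//.
      have -> : iter j.+1 (bracket x) 0 = 0.
        by elim: j.+1 => //= ? ->; rewrite bracket0r.
      by rewrite subr0 mem0v.
    - exists (a *: u' + v'); first by rewrite memvD// memvZ.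
      have -> : iter j.+1 (bracket x) (a *: u' + v') =
          a *: iter j.+1 (bracket x) u' + iter j.+1 (bracket x) v'.
        by elim: j.+1 => //= ? ->; rewrite bracketDr bracketZr.
      by rewrite opprD addrACA -scalerBr memvD// memvZ.
    - move=> /memv_addP[d dD [_ /vlineP[c ->] ->]] /IH[w wC vw].
      exists (c *: w); first exact: memvZ.
      have vC : v \in C k.
        rewrite -(subrK (iter j (bracket x) w) v) memvD//; first exact: (subvP (CS k)).
        by elim: j {IH vw} => //= j IH; exact: xC.
      have -> : iter j.+1 (bracket x) (c *: w) = c *: bracket x (iter j (bracket x) w).
        by rewrite /=; elim: j {IH vw} => [|j /= ->] /=; rewrite bracketZr.
      rewrite bracketDl bracketZl -addrA -scalerBr memvD //; first exact: mem_bracketv.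
      have -> : bracket x v - bracket x (iter j (bracket x) w) =
        bracket x (v - iter j (bracket x) w) by rewrite bracketDr bracketNr.
      by rewrite memvZ// xC.
  by apply/subvP => v /step[w _]; rewrite xp subr0.
exists (m * p)%N; apply/eqP; rewrite -subv0 -Dm -/(C m).
elim: m {Dm} => [|m IH]; first exact: subvf.
rewrite mulSn iterD; apply: subv_trans (xpC m).
exact: iter_bracketvS (subvv _) IH.
Qed.

(** Engel's theorem in graded form: a graded subalgebra of [K] that acts
    nilpotently and is not all of [K] can be enlarged by a homogeneous vector
    normalising it. *)
Lemma engel K : homog_spanned K -> lie_subalgebra K ->
  (forall x, x \in K -> homog x -> ad_nilpotent x) -> acts_nilpotently K.
Proof.
move=> hK sK nK.
pose good D := [/\ (D <= K)%VS, homog_spanned D, lie_subalgebra D & acts_nilpotently D].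
suff [D [DK _ _ nD] KD] : exists2 D, good D & (K <= D)%VS.
  by have -> : K = D by apply/eqP; rewrite eqEsubv KD DK.
apply: contrapT => nex.
suff big d : exists2 D, good D & (d <= \dim D)%N.
  have [D [DK _ _ _]] := big (\dim K).+1.
  by rewrite ltnNge dimvS.
elim: d => [|d [D [DK hD sD nD] dD]].
  exists 0%VS => //; split; [exact: sub0v| | |].
  - move=> u; rewrite memv0 => /eqP ->; exists [::] => //; by rewrite big_nil.
  - by move=> x y; rewrite !memv0 => /eqP -> _; rewrite bracket0l.
  - exists 1%N => /=; apply/eqP; rewrite -subv0; apply/bracketv_subP => u v.
    by rewrite !memv0 => /eqP -> _; rewrite bracket0l.
have KD : ~~ (K <= D)%VS by apply/negP => KD; apply: nex; exists D.
have [x [xK xD hx Dx]] := homog_normalizer hD hK nD DK sK KD.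
exists (D + <[x]>)%VS; last first.
  apply: (leq_ltn_trans dD); rewrite ltnNge; apply/negP => le.
  have /eqP DE : D == (D + <[x]>)%VS.
    by rewrite eqEdim addvSl le.
  by move/negP: xD; apply; rewrite DE (subvP (addvSr _ _))// memv_line.
split.
- by rewrite subv_add DK -memvE.
- move=> _ /memv_addP[u uD [_ /vlineP[c ->] ->]].
  have [s hs us] := hD _ uD.
  exists (c *: x :: s); last by rewrite big_cons us addrC.
  move=> y; rewrite in_cons => /orP[/eqP ->|/hs[yD hy]].
    by split; [rewrite (subvP (addvSr _ _))// memvZ// memv_line|exact: homog_scale].
  by split => //; rewrite (subvP (addvSl _ _)).
- move=> _ _ /memv_addP[u uD [_ /vlineP[c ->] ->]] /memv_addP[v vD [_ /vlineP[d' ->] ->]].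
  apply: (subvP (addvSl _ _)).
  rewrite bracketDl !bracketDr !bracketZl !bracketZr bracket_alt !scaler0 addr0.
  by rewrite memvD ?sD// ?memvD ?sD ?memvZ ?Dx// bracketC memvN Dx.
- by apply: acts_nilpotently_add => //; exact: nK.
Qed.

(** The last nonzero term of the lower central series would be an abelian ideal. *)
Lemma semisimple_nilpotent_ideal0 K : lie_semisimple g ->
  lie_ideal K -> acts_nilpotently K -> K = 0%VS.
Proof.
move=> ssg iK [m Km]; pose C k := iter k (bracketv K) K.
have exk : exists k, C k == 0%VS.
  exists m; rewrite -subv0 -Km; exact: iter_bracketvS (subvv _) (subvf _).
have := ex_minnP exk; move=> [[|k] /eqP Ck mk]; first exact: Ck.
have C0 : C k = 0%VS.
  apply: ssg; first exact: lie_ideal_iter.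
  exists 1%N => /=; apply/eqP; rewrite -subv0 -Ck; apply: bracketvS (subvv _).
  case: {Ck mk} k => [|k]; first exact: subvv.
  by apply/bracketv_subP => u v uK vC; rewrite bracketC memvN iK.
by have := mk k; rewrite C0 eqxx => /(_ isT); rewrite ltnn.
Qed.

End Engel.

Import VectorInternalTheory.

(** * Weights, the Killing form and coroots *)

Lemma row_diag_mul (F : fieldType) m n (d : 'rV[F]_m) (A : 'M[F]_(m, n)) i :
  row i (diag_mx d *m A) = d 0 i *: row i A.
Proof. by rewrite mul_diag_mx; apply/rowP => j; rewrite !mxE. Qed.

Lemma free_row_free (F : fieldType) (vT : vectType F) n (X : n.-tuple vT) :
  free X = row_free (b2mx X).
Proof.
have lin (u : 'rV[F]_n) : v2r (\sum_i u 0 i *: X`_i) = u *m b2mx X.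
  rewrite mulmx_sum_row linear_sum; apply: eq_bigr => i _.
  by rewrite linearZ/= rowK (tnth_nth 0).
apply/freeP/idP => [fX|rfX k k0 i].
  apply: inj_row_free => u; rewrite -lin => u0; apply/rowP => i; rewrite mxE.
  by apply: fX => {i}; apply: v2r_inj; rewrite u0 linear0.
have := lin (\row_i k i); under eq_bigr do rewrite mxE.
rewrite k0 linear0 => /esym/eqP; rewrite mulmx_free_eq0// => /eqP/rowP/(_ i).
by rewrite !mxE.
Qed.

Section Adjoint.
Context {R : realType} {g : lieAlgebra R}.
Implicit Types (x y z : g).

Definition admx x : 'M[R]_(dim g) := lin1_mx (v2r \o bracket x \o r2v).

Lemma v2r_bracket x y : v2r (bracket x y) = v2r y *m admx x.
Proof. by rewrite mul_rV_lin1/= v2rK. Qed.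

Lemma admxP x (A : 'M[R]_(dim g)) :
  (forall y, v2r (bracket x y) = v2r y *m A) -> admx x = A.
Proof.
move=> xA; apply/row_matrixP => i; rewrite !rowE -[delta_mx _ _]r2vK.
by rewrite -v2r_bracket.
Qed.

Lemma admx_bracket x y : admx (bracket x y) = admx y *m admx x - admx x *m admx y.
Proof.
apply: admxP => z; rewrite mulmxBr !mulmxA -!v2r_bracket -linearB/=.
by rewrite (jacobi x y z) addrK.
Qed.

Lemma admx_is_linear : linear admx.
Proof.
move=> a x y; apply: admxP => z.
by rewrite mulmxDr -scalemxAr -!v2r_bracket bracketDl bracketZl linearD linearZ.
Qed.

HB.instance Definition _ := GRing.isLinear.Build R g 'M[R]_(dim g) *:%R admx admx_is_linear.

Definition killing x y : R := \tr (admx x *m admx y).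

Lemma killingC x y : killing x y = killing y x.
Proof. exact: mxtrace_mulC. Qed.

Lemma killingDl x y z : killing (x + y) z = killing x z + killing y z.
Proof. by rewrite /killing raddfD/= mulmxDl raddfD. Qed.

Lemma killingZl (a : R) x z : killing (a *: x) z = a * killing x z.
Proof. by rewrite /killing linearZ/= -scalemxAl linearZ. Qed.

Lemma killingDr x y z : killing z (x + y) = killing z x + killing z y.
Proof. by rewrite killingC killingDl !(killingC z). Qed.

Lemma killingZr (a : R) x z : killing z (a *: x) = a * killing z x.
Proof. by rewrite killingC killingZl killingC. Qed.

Lemma killing0l z : killing 0 z = 0.
Proof. by rewrite -(scale0r (0 : g)) killingZl mul0r. Qed.

Lemma killing_sumr I (r : seq I) P (F : I -> g) z :
  killing z (\sum_(i <- r | P i) F i) = \sum_(i <- r | P i) killing z (F i).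
Proof.
by apply: (big_morph (killing z) (fun x y => killingDr x y z)); rewrite killingC killing0l.
Qed.

Lemma killing_suml I (r : seq I) P (F : I -> g) z :
  killing (\sum_(i <- r | P i) F i) z = \sum_(i <- r | P i) killing (F i) z.
Proof. by rewrite killingC killing_sumr; apply: eq_bigr => i _; rewrite killingC. Qed.

Lemma killing_invariant x y z : killing (bracket x y) z = killing x (bracket y z).
Proof.
rewrite /killing !admx_bracket mulmxBl mulmxBr !raddfB/= !mulmxA.
by rewrite -[in LHS]mulmxA mxtrace_mulC.
Qed.

Lemma killing_eigen t x y (c d : R) : bracket t x = c *: x -> bracket t y = d *: y ->
  c + d != 0 -> killing x y = 0.
Proof.
move=> xc yd cd0; have := killing_invariant x t y.
rewrite bracketC xc yd -scaleNr killingZl killingZr => /eqP.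
by rewrite -subr_eq0 -mulrBl mulf_eq0 -opprD oppr_eq0 (negbTE cd0)/= => /eqP.
Qed.

Lemma semisimple_center0 x : lie_semisimple g -> (forall y, bracket x y = 0) -> x = 0.
Proof.
move=> ssg x0; apply/eqP; rewrite -memv0 -(ssg <[x]>%VS) ?memv_line//.
  by move=> y u /vlineP[c ->]; rewrite bracketZr bracketC x0 oppr0 scaler0 mem0v.
exists 1%N => /=; apply/eqP; rewrite -subv0; apply/bracketv_subP => u v.
by move=> /vlineP[c ->] _; rewrite bracketZl x0 scaler0 mem0v.
Qed.

Lemma ad_diagonalizable_admx x : ad_diagonalizable x -> diagonalizable (admx x).
Proof.
move=> [b bb eb]; have sb : size b == dim g.
  by rewrite -(@size_basis _ _ fullv _ (in_tuple b) bb) dimvf.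
pose T : (dim g).-tuple g := Tuple sb.
have fT : row_free (b2mx T) by rewrite -free_row_free; exact: (@basis_free _ _ fullv b).
have ei (i : 'I_(dim g)) : exists c : R, bracket x (tnth T i) = c *: tnth T i.
  by apply: eb; exact: (mem_tnth i T).
pose e i := projT1 (cid (ei i)).
exists (b2mx T); first by rewrite -row_free_unit.
apply/diagonalizable_forPex; exists (\row_i e i).
apply: simmxW => //; apply/row_matrixP => i.
rewrite row_mul !rowK -v2r_bracket (projT2 (cid (ei i))) linearZ/=.
by rewrite row_diag_mul mxE rowK.
Qed.

End Adjoint.

Section Weights.
Context {R : realType} (g : splitSemisimple R).
Local Notation h := (subvs_of (cartan g)).
Local Notation dual := 'Hom(h, R^o).
Implicit Types (t : h) (a b : dual).

Lemma iter_bracket_eigen (x v : g) (c : R) n : bracket x v = c *: v ->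
  iter n (bracket x) v = c ^+ n *: v.
Proof.
move=> xv; elim: n => [|n IH] /=; first by rewrite scale1r.
by rewrite IH bracketZr xv scalerA exprSr.
Qed.

Lemma iter_bracket_sum I (r : seq I) (F : I -> g) (x : g) n :
  iter n (bracket x) (\sum_(i <- r) F i) = \sum_(i <- r) iter n (bracket x) (F i).
Proof. by elim: n => //= n ->; rewrite bracket_sumr. Qed.

Lemma iter_bracketZ (x v : g) (c : R) n :
  iter n (bracket x) (c *: v) = c *: iter n (bracket x) v.
Proof. by elim: n => //= n ->; rewrite bracketZr. Qed.

(** An element of the Cartan subalgebra acts on it by an operator that is both
    nilpotent and diagonalizable, hence zero. *)
Lemma cartan_abelian (x y : g) : x \in cartan g -> y \in cartan g -> bracket x y = 0.
Proof.
have [[_ [n hn] _] dh] := splitSemisimple_cartan g.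
move=> xh yh; have [b bb eb] := dh x xh.
have xny : iter n (bracket x) y = 0.
  apply/eqP; rewrite -memv0 -hn; elim: (n) => //= k IH; exact: mem_bracketv.
pose T := in_tuple b; have fT : free T := @basis_free _ _ fullv b bb.
have ei i : exists c : R, bracket x T`_i = c *: T`_i.
  have [ib|ib] := ltnP i (size b); first by apply: eb; exact: mem_nth.
  by exists 0; rewrite nth_default// bracket0r scaler0.
pose e i := projT1 (cid (ei i)).
have eE i : bracket x T`_i = e i *: T`_i := projT2 (cid (ei i)).
have yE := @coord_basis _ _ fullv _ T y bb (memvf y).
have c0 i : coord T i y * e i ^+ n = 0.
  move/freeP : fT => /(_ (fun i => coord T i y * e i ^+ n)); apply; rewrite -[RHS]xny.
  rewrite [in RHS]yE iter_bracket_sum; apply: eq_bigr => j _.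
  by rewrite iter_bracketZ (iter_bracket_eigen _ (eE j)) scalerA.
rewrite yE bracket_sumr big1// => i _; rewrite bracketZr eE scalerA.
by have /eqP := c0 i; rewrite mulf_eq0 expf_eq0 => /orP[/eqP->|/andP[_ /eqP->]];
  rewrite ?mul0r ?mulr0 scale0r.
Qed.

(** Commuting diagonalizable operators have a common eigenbasis. *)
Lemma weight_basis_exists : exists wv : (dim g).-tuple g, basis_of fullv wv /\
  exists wt : 'I_(dim g) -> dual, forall t (k : 'I_(dim g)),
    bracket (vsval t) wv`_k = wt k t *: wv`_k.
Proof.
have [_ dh] := splitSemisimple_cartan g.
pose B := vbasis (cartan g).
have BT i : B`_i \in cartan g.
  have [ib|ib] := ltnP i (size B); first by apply: vbasis_mem; exact: mem_nth.
  by rewrite nth_default// mem0v.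
have /codiagonalizableP[P Pu /allP/= DP] : {in [seq admx x | x <- B] &, forall A C, comm_mx A C} /\
  {in [seq admx x | x <- B], forall A, diagonalizable A}.
  split=> [_ _ /mapP[x xB ->] /mapP[y yB ->]|_ /mapP[x xB ->]]; last first.
    by apply: ad_diagonalizable_admx; apply: dh; exact: vbasis_mem.
  apply/esym/eqP; rewrite -subr_eq0 -admx_bracket cartan_abelian ?vbasis_mem//.
  by rewrite raddf0.
pose wv := [tuple r2v (row i P) | i < dim g].
have wvE (i : 'I_(dim g)) : wv`_i = r2v (row i P) by rewrite -tnth_nth tnth_mktuple.
have PE : b2mx wv = P.
  by apply/row_matrixP => i; rewrite rowK tnth_mktuple r2vK.
have bwv : basis_of fullv wv.
  by rewrite basisEfree free_row_free PE row_free_unit Pu subvf dimvf size_tuple leqnn.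
exists wv; split => //.
have d (i : 'I_(\dim (cartan g))) : exists D : 'rV[R]_(dim g), forall k : 'I_(dim g),
    bracket B`_i wv`_k = D 0 k *: wv`_k.
  have /DP/diagonalizable_forPex[D /(simmxP Pu) PD] : admx B`_i \in [seq admx x | x <- B].
    by apply: map_f; apply: mem_nth; rewrite size_tuple.
  exists D => k; apply: v2r_inj; rewrite v2r_bracket linearZ/= wvE r2vK -row_mul PD.
  by rewrite row_diag_mul.
pose D i := projT1 (cid (d i)).
pose F (k : 'I_(dim g)) (t : h) : R^o := \sum_i coord B i (vsval t) * D i 0 k.
have Flin k : linear (F k).
  move=> a s t; rewrite /F scaler_sumr -big_split; apply: eq_bigr => i _ /=.
  by rewrite !linearP/= mulrDl scalerAl.
pose Fl k : {linear h -> R^o} := HB.pack (F k) (GRing.isLinear.Build _ _ _ _ _ (Flin k)).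
exists (fun k => linfun (Fl k)) => t k; rewrite lfunE/= /F scaler_suml.
rewrite [in LHS](coord_vbasis (subvsP t)) bracket_suml; apply: eq_bigr => i _.
by rewrite bracketZl (projT2 (cid (d i))) scalerA.
Qed.

End Weights.

Section KillingForm.
Context {R : realType} (g : splitSemisimple R).
Local Notation h := (subvs_of (cartan g)).
Local Notation dual := 'Hom(h, R^o).
Implicit Types (t : h) (a b : dual).
Local Notation rv := (@root_vector R g (cartan g)).

Lemma root_vector_bracket a b (x y : g) : rv a x -> rv b y -> rv (a + b) (bracket x y).
Proof.
by move=> ax by_ t; rewrite jacobi ax by_ bracketZl bracketZr -scalerDl add_lfunE.
Qed.

Lemma root_vectorZ a (c : R) (x : g) : rv a x -> rv a (c *: x).
Proof. by move=> ax t; rewrite bracketZr ax !scalerA mulrC. Qed.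

Lemma zero_weight_cartan (x : g) : (forall t, bracket (vsval t) x = 0) -> x \in cartan g.
Proof.
have [[_ _ nh] _] := splitSemisimple_cartan g.
move=> x0; apply: nh => u uh; rewrite bracketC memvN.
by have -> : bracket u x = 0; [rewrite -(vsprojK uh) x0|rewrite mem0v].
Qed.

Lemma root_neq0 a (xo : h) : (forall i, 0 < simple_root i xo :> R) ->
  is_root a -> a xo != 0 :> R.
Proof.
move=> xo0 [a0 [x x0 ax]].
have [_ _ /(_ a)[|n an]] := splitSemisimple_simple g; first by split => //; exists x.
have [i ni] : exists i, n i != 0%N.
  apply: contrapT => /forallNP n0; move: a0.
  have s0 : \sum_i (n i)%:R *: simple_root i = 0 :> dual.
    by apply: big1 => i _; have := n0 i => /negP; rewrite negbK => /eqP ->; rewrite scale0r.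
  by case: an => ->; rewrite s0 ?oppr0 eqxx.
have pos : 0 < (\sum_i (n i)%:R *: simple_root i : dual) xo :> R.
  rewrite sum_lfunE (bigD1 i)//= scale_lfunE ltr_wpDr//.
    by apply: sumr_ge0 => j _; rewrite scale_lfunE mulr_ge0// ltW.
  by rewrite mulr_gt0// ltr0n lt0n.
by case: an => ->; rewrite ?opp_lfunE ?oppr_eq0 gt_eqF.
Qed.

Context (wv : (dim g).-tuple g) (bwv : basis_of fullv wv).
Context (wt : 'I_(dim g) -> dual).
Context (wvE : forall t (k : 'I_(dim g)), bracket (vsval t) wv`_k = wt k t *: wv`_k).

Lemma wvP (x : g) : x = \sum_i coord wv i x *: wv`_i.
Proof. exact: coord_basis bwv (memvf x). Qed.

Lemma coord_bracket t (x : g) k :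
  coord wv k (bracket (vsval t) x) = wt k t * coord wv k x :> R.
Proof.
rewrite {1}(wvP x) bracket_sumr linear_sum (bigD1 k)//= big1 ?addr0 => [|i ik].
  by rewrite bracketZr wvE !linearZ/= coord_free ?(basis_free bwv)// eqxx mulr1 mulrC.
by rewrite bracketZr wvE !linearZ/= coord_free ?(basis_free bwv)// (negbTE ik) !mulr0.
Qed.

Lemma coord_root_vector a (x : g) k : rv a x -> coord wv k x != 0 -> wt k = a.
Proof.
move=> ax xk; apply/lfunP => t; apply: (mulIf xk).
by rewrite -coord_bracket ax linearZ.
Qed.

Lemma coord_neq0 (x : g) : x != 0 -> exists k, coord wv k x != 0.
Proof.
move=> x0; apply: contrapT => /forallNP c0; move/negP: x0; apply; apply/eqP.
rewrite (wvP x) big1// => i _; have := c0 i => /negP; rewrite negbK => /eqP ->.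
by rewrite scale0r.
Qed.

Lemma root_weight a (x : g) : x != 0 -> rv a x -> exists k, wt k = a.
Proof. by move=> /coord_neq0[k xk] ax; exists k; exact: coord_root_vector ax xk. Qed.

Lemma wv_neq0 (k : 'I_(dim g)) : wv`_k != 0.
Proof.
apply/eqP => w0; have := coord_free k k (basis_free bwv).
by rewrite w0 linear0 eqxx => /esym/eqP; rewrite oner_eq0.
Qed.

Lemma weight_is_root k : wt k != 0 -> is_root (wt k).
Proof. by move=> k0; split => //; exists wv`_k; [exact: wv_neq0|move=> t; exact: wvE]. Qed.

(** On the Cartan subalgebra the Killing form is a sum of squares of weights,
    which makes it positive definite. *)
Lemma killing_cartan t s : killing (vsval t) (vsval s) = \sum_k wt k t * wt k s :> R.
Proof.
have Pu : b2mx wv \in unitmx by rewrite -row_free_unit -free_row_free (basis_free bwv).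
have PA r : b2mx wv *m admx (vsval r) = diag_mx (\row_k wt k r) *m b2mx wv.
  apply/row_matrixP => i.
  by rewrite row_mul row_diag_mul rowK -v2r_bracket (tnth_nth 0) wvE linearZ/= mxE.
have AE r : admx (vsval r) = invmx (b2mx wv) *m diag_mx (\row_k wt k r) *m b2mx wv.
  by rewrite -mulmxA -PA mulKmx.
rewrite /killing !AE !mulmxA mulmxK// mxtrace_mulC !mulmxA mulmxV// mul1mx mulmx_diag.
by rewrite mxtrace_diag; apply: eq_bigr => k _; rewrite !mxE.
Qed.

Lemma killing_cartan_ge0 t : 0 <= killing (vsval t) (vsval t) :> R.
Proof. by rewrite killing_cartan; apply: sumr_ge0 => k _; rewrite -expr2 sqr_ge0. Qed.

Lemma killing_cartan_eq0 t : killing (vsval t) (vsval t) = 0 :> R -> t = 0.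
Proof.
rewrite killing_cartan => /eqP; rewrite psumr_eq0 => [/allP k0|k _]; last first.
  by rewrite -expr2 sqr_ge0.
apply: val_inj; apply: (semisimple_center0 (@splitSemisimple_semisimple R g)) => y.
rewrite (wvP y) bracket_sumr big1// => i _; rewrite bracketZr wvE.
have := k0 i (mem_index_enum _); rewrite mulf_eq0 orbb => /eqP ->.
by rewrite scale0r scaler0.
Qed.

Definition killing_row (x : g) : 'rV[R]_(dim g) := \row_k killing x wv`_k.

Lemma killing_row_linear : linear killing_row.
Proof. by move=> c x y; apply/rowP => k; rewrite !mxE killingDl killingZl. Qed.

HB.instance Definition _ :=
  GRing.isLinear.Build R g 'rV[R]_(dim g) *:%R killing_row killing_row_linear.

Definition killing_radical : {vspace g} := lker (linfun killing_row).

Lemma killing_radicalP (x : g) :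
  reflect (forall y, killing x y = 0) (x \in killing_radical).
Proof.
rewrite memv_ker lfunE/=; apply: (iffP eqP) => [/rowP x0 y|x0].
  rewrite (wvP y) killing_sumr big1// => k _; rewrite killingZr.
  by have := x0 k; rewrite !mxE => ->; rewrite mulr0.
by apply/rowP => k; rewrite !mxE x0.
Qed.

Lemma killing_radical_ideal : lie_ideal killing_radical.
Proof.
move=> x u /killing_radicalP u0; apply/killing_radicalP => y.
by rewrite bracketC -scaleN1r killingZl killing_invariant u0 mulr0.
Qed.

Section Radical.
Context (xo : h) (xo0 : forall i, 0 < simple_root i xo :> R).
Let t0 : g := vsval xo.

Lemma weight_xo_eq0 k : (wt k xo == 0 :> R) = (wt k == 0).
Proof.
apply/eqP/eqP => [|->]; last by rewrite zero_lfunE.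
by move=> k0; apply/eqP/negPn/negP => /weight_is_root/(root_neq0 xo0); rewrite k0 eqxx.
Qed.

(** Eigenspaces of [t0] are orthogonal unless their eigenvalues are opposite, so
    the components of a vector of the radical are in the radical. *)
Lemma killing_radical_homog_spanned : homog_spanned t0 killing_radical.
Proof.
move=> x /killing_radicalP xK.
pose mu k : R := wt k xo.
pose xr r := \sum_(k | mu k == r) coord wv k x *: wv`_k.
exists [seq xr r | r <- undup [seq mu k | k <- enum 'I_(dim g)]].
  have hr r : bracket t0 (xr r) = r *: xr r.
    rewrite bracket_sumr scaler_sumr; apply: eq_bigr => k /eqP <-.
    by rewrite bracketZr wvE !scalerA mulrC.
  move=> _ /mapP[r _ ->]; split; last by exists r.
  apply/killing_radicalP => y; rewrite (wvP y) killing_sumr big1// => k _.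
  rewrite killingZr; have [rk|rk] := eqVneq (r + mu k) 0; last first.
    by rewrite (killing_eigen (hr r) (wvE xo k) rk) mulr0.
  have <- : killing x wv`_k = killing (xr r) wv`_k; last by rewrite xK mulr0.
  rewrite [in LHS](wvP x) (bigID [pred j | mu j == r])/= killingDl.
  rewrite [X in _ + X](_ : _ = 0) ?addr0// killing_suml big1// => j jr.
  rewrite killingZl (killing_eigen (wvE xo j) (wvE xo k)) ?mulr0//.
  apply: contra jr => /eqP jk; apply/eqP.
  by apply: (addIr (mu k)); rewrite rk.
rewrite big_map [LHS]wvP (exchange_big_dep xpredT)//=; apply: eq_bigr => k _.
rewrite big_mkcond (bigD1_seq (mu k)) ?undup_uniq//=; last first.
  by rewrite mem_undup; apply: map_f; rewrite mem_enum.
by rewrite eqxx big1_seq ?addr0//= => r /andP[]; rewrite eq_sym => /negbTE ->.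
Qed.

Lemma eigenvalue_weight (x : g) (c : R) : x != 0 -> bracket t0 x = c *: x ->
  exists k, wt k xo = c :> R.
Proof.
move=> /coord_neq0[k xk] xc; exists k; apply: (mulIf xk).
by rewrite -coord_bracket -/t0 xc linearZ.
Qed.

(** Every application of [x] shifts the eigenvalue of [t0] by [c], and these
    eigenvalues are bounded. *)
Lemma homog_ad_nilpotent (x : g) (c : R) : bracket t0 x = c *: x -> c != 0 ->
  ad_nilpotent x.
Proof.
move=> xc c0.
pose M := \sum_k `|wt k xo : R|.
have lM k : `|wt k xo : R| <= M.
  by rewrite /M (bigD1 k)//= lerDl sumr_ge0.
have M0 : 0 <= M by apply: sumr_ge0.
(* Two eigenvalues differ by at most [M + M], fewer than [p] shifts by [c]. *)
pose p := (Num.truncn ((M + M) / `|c|)).+1.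
have pM : M + M < `|c| *+ p.
  rewrite -mulr_natl -ltr_pdivrMr ?normr_gt0// /p.
  exact: truncnS_gt.
exists p => y.
rewrite (wvP y) iter_bracket_sum big1// => k _; rewrite iter_bracketZ.
suff -> : iter p (bracket x) wv`_k = 0 by rewrite scaler0.
apply/eqP/negPn/negP => nz.
have pE n : bracket t0 (iter n (bracket x) wv`_k) =
    (wt k xo + c *+ n) *: iter n (bracket x) wv`_k.
  elim: n => [|n IH]; first by rewrite mulr0n addr0 wvE.
  rewrite /= jacobi xc IH bracketZl bracketZr -scalerDl mulrSr.
  by congr (_ *: _); rewrite addrCA (addrC c).
have [j jk] := eigenvalue_weight nz (pE p).
have : `|c *+ p| <= M + M.
  have -> : c *+ p = wt j xo - wt k xo by rewrite jk addrAC subrr add0r.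
  by rewrite (le_trans (ler_normB _ _))// lerD.
by rewrite normrMn leNgt pM.
Qed.

(** Cartan's criterion in the split case: the radical meets the Cartan
    subalgebra trivially, so that its graded elements are ad-nilpotent and
    Engel's theorem makes it a nilpotent ideal. *)
Lemma killing_nondegenerate : killing_radical = 0%VS.
Proof.
have ss := @splitSemisimple_semisimple R g.
apply: (semisimple_nilpotent_ideal0 ss killing_radical_ideal).
apply: (engel killing_radical_homog_spanned).
  by move=> x y _; exact: killing_radical_ideal.
move=> x xK [c xc]; have [c0|] := eqVneq c 0; last exact: homog_ad_nilpotent xc.
suff -> : x = 0 by exists 1%N => y /=; rewrite bracket0l.
have xh : x \in cartan g.
  apply: zero_weight_cartan => t; rewrite (wvP x) bracket_sumr big1// => k _.
  rewrite bracketZr wvE; have [->|xk] := eqVneq (coord wv k x) 0; first by rewrite scale0r.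
  have /eqP : wt k xo = 0 :> R.
    by apply: (mulIf xk); rewrite -coord_bracket -/t0 xc c0 scale0r linear0 mul0r.
  by rewrite weight_xo_eq0 => /eqP ->; rewrite zero_lfunE scale0r scaler0.
have /killing_radicalP/(_ x) := xK; rewrite -{1 2}(vsprojK xh).
by move=> /killing_cartan_eq0; rewrite -{2}(vsprojK xh) => ->; rewrite linear0.
Qed.

(** If [a] vanished on all of [[g_a, g_-a]], these brackets would be isotropic
    in the Cartan subalgebra, hence zero, which puts [g_a] in the radical of
    the Killing form. *)
Lemma coroot_exists a : is_root a -> exists t : h, a t = 2 :> R /\
  exists e f : g, [/\ rv a e, rv (- a) f & vsval t = bracket e f].
Proof.
move=> [a0 [e e0 ae]].
have ht f : rv (- a) f -> exists t, vsval t = bracket e f.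
  move=> af; exists (vsproj (cartan g) (bracket e f)); rewrite vsprojK//.
  apply: zero_weight_cartan => t; rewrite (root_vector_bracket ae af).
  by rewrite subrr zero_lfunE scale0r.
have [[t [f [af tef at0]]]|nex] := pselect (exists t f,
    [/\ rv (- a) f, vsval t = bracket e f & a t != 0 :> R]).
  exists ((2 / a t) *: t); split; first by rewrite linearZ/= [LHS]mulfVK.
  exists ((2 / a t) *: e), f; split => //; first exact: root_vectorZ.
  by rewrite linearZ/= tef bracketZl.
suff : e \in killing_radical.
  by rewrite killing_nondegenerate memv0 (negbTE e0).
apply/killing_radicalP => y; rewrite (wvP y) killing_sumr big1// => k _.
rewrite killingZr.
have [ka|ka] := eqVneq (wt k) (- a); last first.
  have [t tk] : exists t, a t + wt k t != 0 :> R.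
    apply: contrapT => /forallNP nt; move/eqP: ka; apply; apply/lfunP => t.
    have /negP := nt t; rewrite negbK addrC addr_eq0 => /eqP ->.
    by rewrite opp_lfunE.
  by rewrite (killing_eigen (ae t) (wvE t k) tk) mulr0.
have af : rv (- a) wv`_k by rewrite -ka => t; exact: wvE.
have [t tE] := ht _ af.
have kt s : killing (vsval s) (vsval t) = a s * killing e wv`_k :> R.
  by rewrite tE -killing_invariant ae killingZl.
have at0 : a t = 0 :> R.
  by apply/eqP/negPn/negP => at0; apply: nex; exists t, wv`_k.
have t00 : t = 0 by apply: killing_cartan_eq0; rewrite kt at0 mul0r.
have [s as0] : exists s, a s != 0 :> R.
  apply: contrapT => /forallNP ns; move/eqP: a0; apply; apply/lfunP => s.
  by have /negP := ns s; rewrite negbK => /eqP ->; rewrite zero_lfunE.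
have /eqP := kt s; rewrite t00 linear0 killingC killing0l eq_sym mulf_eq0.
by rewrite (negbTE as0) => /eqP ->; rewrite mulr0.
Qed.

(** ** Strings of roots *)

Lemma primitive_vector_string (e f : g) t (w : g) (l : R) :
  bracket e f = vsval t -> bracket (vsval t) f = -2 *: f ->
  bracket (vsval t) w = l *: w -> bracket e w = 0 -> forall n,
  bracket e (iter n.+1 (bracket f) w) = ((l - n%:R) *+ n.+1) *: iter n (bracket f) w.
Proof.
move=> ef tf tw ew.
have tn n : bracket (vsval t) (iter n (bracket f) w) =
    (l - 2 * n%:R) *: iter n (bracket f) w.
  elim: n => [|n IH]; first by rewrite mulr0 subr0.
  rewrite /= jacobi tf IH bracketZl bracketZr -scalerDl; congr (_ *: _).
  by rewrite -natr1; ring.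
elim=> [|n IH].
  by rewrite /= jacobi ef ew bracket0r addr0 tw subr0.
rewrite [iter n.+2 _ _]/= jacobi ef IH -/(iter n.+1 (bracket f) w) tn bracketZr -scalerDl.
by congr (_ *: _); rewrite -[in LHS]mulr_natr -[RHS]mulr_natr -!natr1; ring.
Qed.

Lemma root_vector_iter a b (x y : g) n : rv a x -> rv b y ->
  rv (b + a *+ n) (iter n (bracket x) y).
Proof.
move=> ax by_; elim: n => [|n IH]; first by rewrite mulr0n addr0.
by rewrite mulrSr addrA addrC; exact: root_vector_bracket ax IH.
Qed.

(** Raise [v] to a primitive vector of weight [l], with [l] necessarily the
    length of its string, then lower that vector past the mirror image of [v]. *)
Lemma root_string_ge0 a b (e f : g) t (v : g) :
  a xo != 0 :> R -> rv a e -> rv (- a) f -> bracket e f = vsval t -> a t = 2 :> R ->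
  v != 0 -> rv b v -> 0 <= (b t : R) ->
  exists2 v', v' != 0 & rv (b - (b t : R) *: a) v'.
Proof.
move=> a0 ae af ef at2 v0 bv bt0.
have last0 (x y : g) : ad_nilpotent x -> y != 0 ->
    exists2 n, iter n (bracket x) y != 0 & iter n.+1 (bracket x) y = 0.
  move=> [p xp] y0; have ex0 : exists n, iter n (bracket x) y == 0 by exists p; rewrite xp.
  have := ex_minnP ex0; move=> [[|n] xn mn]; first by rewrite /= (negbTE y0) in xn.
  by exists n; [apply/negP => /mn; rewrite ltnn|exact/eqP].
have [k w0 ew] := last0 e v (homog_ad_nilpotent (ae xo) a0) v0.
have na0 : (- a) xo != 0 :> R by rewrite opp_lfunE oppr_eq0.
set w := iter k _ v in w0; have bw : rv (b + a *+ k) w by exact: root_vector_iter.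
have [m fm0 fm] := last0 f w (homog_ad_nilpotent (af xo) na0) w0.
pose l : R := b t + 2 *+ k.
have wl : (b + a *+ k) t = l :> R.
  by rewrite add_lfunE -scaler_nat scale_lfunE at2 /l [X in _ + X]mulr_natl.
have tf : bracket (vsval t) f = - 2 *: f.
  by rewrite af opp_lfunE at2.
have tw : bracket (vsval t) w = l *: w by rewrite bw wl.
have := primitive_vector_string ef tf tw ew m; rewrite fm bracket0r => /esym/eqP.
rewrite scaler_eq0 (negbTE fm0) orbF mulrn_eq0/= subr_eq0 => /eqP lm.
have btE : b t = m%:R - 2 *+ k :> R by rewrite -lm /l addrK.
have kk : 2 *+ k = k%:R + k%:R :> R by rewrite -[LHS]mulr_natr mulrDl mul1r.
have km : (k + k <= m)%N by rewrite -(ler_nat R) natrD -subr_ge0 -kk -btE.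
exists (iter (m - k) (bracket f) w).
  apply/eqP => z; move/eqP: fm0; apply.
  have km' : (k <= m)%N := leq_trans (leq_addr _ _) km.
  rewrite -(subnKC km') iterD z; elim: (k) => //= ? ->.
  by rewrite bracket0r.
have -> : b - (b t : R) *: a = b + a *+ k + (- a) *+ (m - k).
  rewrite btE kk scalerBl scalerDl !scaler_nat mulNrn mulrnBr.
    by rewrite !opprB -!addrA.
  exact: leq_trans (leq_addr _ _) km.
exact: root_vector_iter.
Qed.

(** For negative [b t] the string is climbed with the opposite triple. *)
Lemma root_refl a b (e f : g) t : is_root a -> rv a e -> rv (- a) f ->
  vsval t = bracket e f -> a t = 2 :> R -> is_root b ->
  is_root (b - (b t : R) *: a).
Proof.
move=> ra ae af tef at2 [b0 [v v0 bv]]; have a0 := root_neq0 xo0 ra.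
split.
  apply: contra b0; rewrite subr_eq0 => /eqP bE; apply/eqP.
  have : b t = (b t : R) * 2 :> R by rewrite {1}bE scale_lfunE at2.
  move=> bt2; have bt0 : b t = 0 :> R by lra.
  by rewrite bE bt0 scale0r.
have [bt|/ltW bt] := leP 0 (b t : R).
  by have [v' v'0 bv'] := root_string_ge0 a0 ae af (esym tef) at2 v0 bv bt; exists v'.
have [|||||v' v'0 bv'] := @root_string_ge0 (- a) b f e (- t) v _ af _ _ _ v0 bv.
- by rewrite opp_lfunE oppr_eq0.
- by rewrite opprK.
- by rewrite linearN/= tef bracketC.
- by rewrite opp_lfunE linearN/= opprK.
- by rewrite linearN/= oppr_ge0.
exists v' => //; move: bv'.
by have -> : b (- t) = - (b t : R) :> R; [exact: raddfN|rewrite scaleNr scalerN opprK].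
Qed.

End Radical.
End KillingForm.

(** * Root geometry of the Cartan subalgebra *)

Section RootGeometry.
Context {R : realType} {g : splitSemisimple R}.
Local Notation n := (rank g).
Local Notation dual := 'Hom(subvs_of (cartan g), R^o).
Implicit Types (x y z : cartanT g) (i j k : 'I_n) (s : seq 'I_n) (J : {set 'I_n}).
Implicit Types (u v w : weyl g).

Lemma alphaD i x y : alpha i (x + y) = alpha i x + alpha i y.
Proof. exact: (linearD (simple_root i)). Qed.
Lemma alphaZ i (c : R) x : alpha i (c *: x) = c * alpha i x.
Proof. exact: (linearZ_LR (simple_root i)). Qed.

Lemma alphaB i x y : alpha i (x - y) = alpha i x - alpha i y.
Proof. exact: (raddfB (simple_root i)). Qed.

Definition kform x y : R :=
  killing (vsval (x : subvs_of (cartan g))) (vsval (y : subvs_of (cartan g))).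

Lemma kformC x y : kform x y = kform y x.
Proof. exact: killingC. Qed.
Lemma kformDl x y z : kform (x + y) z = kform x z + kform y z.
Proof. exact: killingDl. Qed.
Lemma kformZl (c : R) x z : kform (c *: x) z = c * kform x z.
Proof. exact: killingZl. Qed.
Lemma kformDr x y z : kform z (x + y) = kform z x + kform z y.
Proof. exact: killingDr. Qed.
Lemma kformZr (c : R) x z : kform z (c *: x) = c * kform z x.
Proof. exact: killingZr. Qed.
Lemma kform_ge0 x : 0 <= kform x x.
Proof.
have [wv [bwv [wt wvE]]] := weight_basis_exists g.
exact: (killing_cartan_ge0 bwv wvE).
Qed.
Lemma kform_eq0 x : kform x x = 0 -> x = 0.
Proof.
have [wv [bwv [wt wvE]]] := weight_basis_exists g.
exact: (killing_cartan_eq0 bwv wvE).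
Qed.

Section Regular.
Context {xo : cartanT g} (xo0 : open_dominant xo).

Lemma coroot_spec i : alpha i (coroot i) = 2 /\
    exists e f : g, [/\ root_vector (simple_root i) e,
      root_vector (- simple_root i) f &
      vsval (coroot i : subvs_of (cartan g)) = bracket e f].
Proof.
have [wv [bwv [wt wvE]]] := weight_basis_exists g.
have [ri _ _] := splitSemisimple_simple g.
have [t tP] := coroot_exists bwv wvE xo0 (ri i).
exact: (@xgetPex _ 0 [set t : cartanT g | alpha i t = 2 /\ _] (ex_intro _ t tP)).
Qed.

Lemma alpha_coroot i : alpha i (coroot i) = 2.
Proof. by have [] := coroot_spec i. Qed.

(** By invariance of the Killing form; it makes the simple reflections orthogonal. *)
Lemma kform_coroot i x :
  2 * kform x (coroot i) = alpha i x * kform (coroot i) (coroot i).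
Proof.
have [a2 [e [f [ae af ef]]]] := coroot_spec i.
have kx y : kform y (coroot i) = alpha i y * killing e f.
  by rewrite /kform ef -killing_invariant ae killingZl.
by rewrite !kx a2; ring.
Qed.

Lemma coroot_norm_gt0 i : 0 < kform (coroot i) (coroot i).
Proof.
rewrite lt_def kform_ge0 andbT; apply/negP => /eqP /kform_eq0 c0.
have := alpha_coroot i; rewrite c0 -(scale0r (0 : cartanT g)) alphaZ mul0r => /esym/eqP.
by rewrite pnatr_eq0.
Qed.

(** Roots as functions, so that they can be composed with Weyl group elements. *)
Definition rootf (b : cartanT g -> R) := exists2 a : dual, is_root a & b = a.

Lemma rootf_alpha i : rootf (alpha i).
Proof. by have [ri _ _] := splitSemisimple_simple g; exists (simple_root i). Qed.

Lemma rootf_refl b i : rootf b -> rootf (fun x => b (x - alpha i x *: coroot i)).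
Proof.
move=> [a ra ->].
have [wv [bwv [wt wvE]]] := weight_basis_exists g.
have [ri _ _] := splitSemisimple_simple g.
have [a2 [e [f [ae af ef]]]] := coroot_spec i.
have r := root_refl bwv wvE xo0 (ri i) ae af ef a2 ra.
exists (a - (a (coroot i : subvs_of (cartan g)) : R) *: simple_root i) => //.
apply/funext => x; rewrite add_lfunE opp_lfunE scale_lfunE.
transitivity (a x - a (alpha i x *: (coroot i : subvs_of (cartan g)))) => //.
  exact: raddfB.
by congr (_ - _); rewrite linearZ/=; exact: mulrC.
Qed.

Lemma rootf_finite : exists d (r : 'I_d -> cartanT g -> R),
  forall b, rootf b -> exists m : 'I_d, b = r m.
Proof.
have [wv [bwv [wt wvE]]] := weight_basis_exists g.
exists (dim g), (fun k : 'I_(dim g) => wt k) => _ [a [_ [x x0 ax]] ->].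
by have [k <-] := root_weight bwv wvE x0 ax; exists k.
Qed.

Lemma rootf_pos b : rootf b -> 0 < b xo ->
  exists m : 'I_n -> nat, forall x, b x = \sum_i (m i)%:R * alpha i x.
Proof.
move=> [a ra ->] a0; have [_ _ /(_ a ra)[m am]] := splitSemisimple_simple g.
have sE x : (\sum_i (m i)%:R *: simple_root i : dual) x = \sum_i (m i)%:R * alpha i x.
  by rewrite sum_lfunE; apply: eq_bigr => i _; rewrite scale_lfunE.
exists m => x; case: am => aE; first by rewrite aE sE.
suff : (a xo : R) <= 0 by rewrite leNgt a0.
rewrite aE opp_lfunE sE oppr_le0; apply: sumr_ge0 => i _.
by rewrite mulr_ge0// ltW.
Qed.

Lemma rootf_neg b : rootf b -> b xo < 0 ->
  exists m : 'I_n -> nat, forall x, b x = - \sum_i (m i)%:R * alpha i x.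
Proof.
move=> [a ra ->] a0; have [_ _ /(_ a ra)[m am]] := splitSemisimple_simple g.
have sE x : (\sum_i (m i)%:R *: simple_root i : dual) x = \sum_i (m i)%:R * alpha i x.
  by rewrite sum_lfunE; apply: eq_bigr => i _; rewrite scale_lfunE.
exists m => x; case: am => aE; last by rewrite aE opp_lfunE sE.
suff : 0 <= (a xo : R) by rewrite leNgt a0.
rewrite aE sE; apply: sumr_ge0 => i _.
by rewrite mulr_ge0// ltW.
Qed.

Lemma rootf_neq0 b : rootf b -> b xo != 0.
Proof. by move=> [a ra ->]; exact: root_neq0 xo0 ra. Qed.

Lemma alpha_free (c : 'I_n -> R) : (forall x, \sum_i c i * alpha i x = 0) -> forall i, c i = 0.
Proof.
have [_ fP _] := splitSemisimple_simple g.
have sz : size [seq simple_root i | i <- enum 'I_n] == n by rewrite size_map size_enum_ord.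
have TE i : (Tuple sz)`_i = (simple_root i : dual).
  by rewrite /= (nth_map i) ?size_enum_ord// nth_ord_enum.
have /freeP fT : free (Tuple sz) by [].
move=> c0; apply: fT; apply/lfunP => x; rewrite zero_lfunE sum_lfunE.
by rewrite -[RHS](c0 x); apply: eq_bigr => i _; rewrite scale_lfunE TE.
Qed.

Lemma coroot_free : free [tuple (coroot i : cartanT g) | i < n].
Proof.
apply/freeP => c c0 i.
pose N i := kform (coroot i) (coroot i).
have : c i * N i = 0.
  apply: (alpha_free (c := fun i => c i * N i)) => x {i}.
  have : 2 * kform x (\sum_(i < n) c i *: [tuple (coroot i : cartanT g) | i < n]`_i) = 0.
    by rewrite c0 -(scale0r (0 : cartanT g)) kformZr mul0r mulr0.
  rewrite (big_morph (kform x) (fun a b => kformDr a b x) (_ : _ = 0)); last first.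
    by rewrite -(scale0r (0 : cartanT g)) kformZr mul0r.
  rewrite mulr_sumr => s0; rewrite -[RHS]s0; apply: eq_bigr => i _.
  by rewrite -tnth_nth tnth_mktuple kformZr mulrCA kform_coroot mulrCA mulrC.
by move=> /eqP; rewrite mulf_eq0 (gt_eqF (coroot_norm_gt0 i)) orbF => /eqP.
Qed.

Lemma coroot_basis : basis_of fullv [tuple (coroot i : cartanT g) | i < n].
Proof. by rewrite basisEfree coroot_free subvf size_tuple dimvf leqnn. Qed.

Lemma fund_weight_coroot i j : fund_weight i (coroot j) = (i == j)%:R :> R.
Proof.
pose f : 'Hom(cartanT g, R^o) := linfun (coord [tuple (coroot i : cartanT g) | i < n] i).
have fP k : f (coroot k) = (i == k)%:R :> R.
  rewrite lfunE/= -[coroot k](tnth_mktuple (fun k : 'I_n => coroot k : cartanT g)).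
  by rewrite (tnth_nth 0) coord_free ?coroot_free// eq_sym.
exact: (@xgetPex _ 0 [set f : 'Hom(cartanT g, R^o) | forall j, f (coroot j) = (i == j)%:R :> R]
  (ex_intro _ f fP)).
Qed.

Lemma fund_weightD i x y : fund_weight i (x + y) = fund_weight i x + fund_weight i y :> R.
Proof. exact: linearD. Qed.
Lemma fund_weightZ i (c : R) x : fund_weight i (c *: x) = c * fund_weight i x :> R.
Proof. exact: linearZ_LR. Qed.
Lemma fund_weightB i x y : fund_weight i (x - y) = fund_weight i x - fund_weight i y :> R.
Proof. exact: raddfB. Qed.
Lemma fund_weight_sum I (r : seq I) (F : I -> cartanT g) i :
  fund_weight i (\sum_(j <- r) F j) = \sum_(j <- r) fund_weight i (F j) :> R.
Proof. exact: linear_sum. Qed.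

Lemma fund_weight_comb (c : 'I_n -> R) i :
  fund_weight i (\sum_j c j *: coroot j) = c i :> R.
Proof.
rewrite fund_weight_sum (bigD1 i)//= big1 => [|j ji].
  by rewrite fund_weightZ fund_weight_coroot eqxx mulr1 addr0.
by rewrite fund_weightZ fund_weight_coroot eq_sym (negbTE ji) mulr0.
Qed.

Lemma fund_weightK x : x = \sum_i (fund_weight i x : R) *: coroot i.
Proof.
have xE := coord_basis coroot_basis (memvf x).
pose c i : R := coord [tuple (coroot i : cartanT g) | i < n] i x.
have {}xE : x = \sum_i c i *: coroot i.
  by rewrite {1}xE; apply: eq_bigr => i _; rewrite -tnth_nth tnth_mktuple.
by rewrite {1}xE; apply: eq_bigr => i _; rewrite xE fund_weight_comb.
Qed.

Lemma fund_weight_inj x y : (forall i, fund_weight i x = fund_weight i y :> R) -> x = y.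
Proof.
by move=> xy; rewrite (fund_weightK x) (fund_weightK y); apply: eq_bigr => i _; rewrite xy.
Qed.

Lemma alpha_inj x y : (forall i, alpha i x = alpha i y) -> x = y.
Proof.
move=> xy; apply/eqP; rewrite -subr_eq0; apply/eqP/kform_eq0.
set z := x - y; have z0 i : kform z (coroot i) = 0.
  apply: (@mulfI _ 2) => //; rewrite kform_coroot mulr0 /z alphaD -scaleN1r alphaZ.
  by rewrite xy mulN1r subrr mul0r.
have k0 : kform z 0 = 0 by rewrite -(scale0r (0 : cartanT g)) kformZr mul0r.
rewrite [X in kform _ X]fund_weightK (big_morph (kform z) (fun a b => kformDr a b z) k0).
by apply: big1 => i _; rewrite kformZr z0 mulr0.
Qed.

(** ** Words in the simple reflections *)

Definition refl i x : cartanT g := x - alpha i x *: coroot i.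

Lemma weyl_sE i x : weyl_fun (weyl_s i) x = refl i x.
Proof.
have lin : linear (refl i : cartanT g -> cartanT g).
  move=> c y z; rewrite /refl alphaD alphaZ scalerDl -scalerA opprD addrACA.
  by rewrite -scalerN -scalerDr.
pose f : {linear cartanT g -> cartanT g} :=
  HB.pack (refl i : cartanT g -> cartanT g) (GRing.isLinear.Build _ _ _ _ _ lin).
exact: (lfunE f).
Qed.

Lemma weylME u v x : weyl_fun (weylM u v) x = weyl_fun u (weyl_fun v x).
Proof. exact: comp_lfunE. Qed.

Lemma weyl_funB u x y : weyl_fun u (x - y) = weyl_fun u x - weyl_fun u y.
Proof. exact: raddfB. Qed.

Lemma weyl_funZ u (c : R) x : weyl_fun u (c *: x) = c *: weyl_fun u x.
Proof. exact: linearZZ. Qed.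

Lemma weyl1E x : weyl_fun (weyl1 g) x = x.
Proof. exact: id_lfunE. Qed.

Lemma weyl_ext u v : (forall x, weyl_fun u x = weyl_fun v x) -> u = v.
Proof. by move=> uv; apply: val_inj; apply/lfunP. Qed.

Lemma weylMA u v w : weylM u (weylM v w) = weylM (weylM u v) w.
Proof. by apply: weyl_ext => x; rewrite !weylME. Qed.

Lemma weyl1M w : weylM (weyl1 g) w = w.
Proof. by apply: weyl_ext => x; rewrite !weylME weyl1E. Qed.

Lemma weylM1 w : weylM w (weyl1 g) = w.
Proof. by apply: weyl_ext => x; rewrite !weylME weyl1E. Qed.

Lemma alpha_refl i x : alpha i (refl i x) = - alpha i x.
Proof. by rewrite /refl alphaD -scaleNr alphaZ alpha_coroot; ring. Qed.

Lemma reflK i x : refl i (refl i x) = x.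
Proof. by rewrite {1}/refl alpha_refl scaleNr opprK /refl subrK. Qed.

Lemma refl_id i x : alpha i x = 0 -> refl i x = x.
Proof. by move=> x0; rewrite /refl x0 scale0r subr0. Qed.

Lemma weyl_ss i : weylM (weyl_s i) (weyl_s i) = weyl1 g.
Proof. by apply: weyl_ext => x; rewrite weylME !weyl_sE reflK weyl1E. Qed.

Lemma kform_refl i x y : kform (refl i x) (refl i y) = kform x y.
Proof.
apply: (@mulfI _ 2) => //; rewrite /refl -!scaleNr !kformDl !kformDr !kformZl !kformZr.
have := kform_coroot i x; have := kform_coroot i y.
rewrite (kformC (coroot i) y).
move: (kform x (coroot i)) (kform y (coroot i)) (kform (coroot i) (coroot i)) => a b c b2 a2.
have -> : a = alpha i x * c / 2 by rewrite -a2; field.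
have -> : b = alpha i y * c / 2 by rewrite -b2; field.
by field.
Qed.

Lemma fund_weight_refl i j x :
  fund_weight i (refl j x) = fund_weight i x - alpha j x *+ (i == j) :> R.
Proof.
by rewrite /refl fund_weightD -scaleNr fund_weightZ fund_weight_coroot mulNr mulr_natr.
Qed.

Fixpoint wrd s : weyl g := if s is i :: s' then weylM (weyl_s i) (wrd s') else weyl1 g.

Lemma wrd_consE i s x : weyl_fun (wrd (i :: s)) x = refl i (weyl_fun (wrd s) x).
Proof. by rewrite weylME weyl_sE. Qed.

Lemma wrd_cat s t : wrd (s ++ t) = weylM (wrd s) (wrd t).
Proof. by elim: s => [|i s IH] /=; rewrite ?weyl1M// IH weylMA. Qed.

Lemma wrd1 i : wrd [:: i] = weyl_s i.
Proof. exact: weylM1. Qed.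

Lemma wrd_rcons s i : wrd (rcons s i) = weylM (wrd s) (weyl_s i).
Proof. by rewrite -cats1 wrd_cat wrd1. Qed.

Lemma wrd_revl s : weylM (wrd (rev s)) (wrd s) = weyl1 g.
Proof.
elim: s => [|i s IH]; first by rewrite weyl1M.
by rewrite rev_cons wrd_rcons /= -weylMA (weylMA (weyl_s i)) weyl_ss weyl1M.
Qed.

Lemma wrd_revr s : weylM (wrd s) (wrd (rev s)) = weyl1 g.
Proof. by rewrite -{1}(revK s) wrd_revl. Qed.

Lemma weyl_word w : exists s, w = wrd s.
Proof.
have [s ws] : exists s, weyl_fun w = weyl_fun (wrd s).
  elim: (weyl_funP w) => [|i|u v _ [s ->] _ [t ->]].
  - by exists [::].
  - by exists [:: i]; rewrite wrd1.
  - by exists (s ++ t); rewrite wrd_cat.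
by exists s; apply: weyl_ext => x; rewrite ws.
Qed.

Lemma wrdK s x : weyl_fun (wrd (rev s)) (weyl_fun (wrd s) x) = x.
Proof. by rewrite -weylME wrd_revl weyl1E. Qed.

Lemma wrdVK s x : weyl_fun (wrd s) (weyl_fun (wrd (rev s)) x) = x.
Proof. by rewrite -weylME wrd_revr weyl1E. Qed.

Lemma kform_wrd s x y : kform (weyl_fun (wrd s) x) (weyl_fun (wrd s) y) = kform x y.
Proof.
by elim: s => [|i s IH]; rewrite ?weyl1E// !wrd_consE kform_refl.
Qed.

Lemma rootf_wrd b s : rootf b -> rootf (fun x => b (weyl_fun (wrd s) x)).
Proof.
elim: s b => [|i s IH] b rb.
  by have -> : (fun x => b (weyl_fun (wrd [::]) x)) = b by apply/funext => x; rewrite weyl1E.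
have := IH _ (rootf_refl i rb).
by under [X in rootf X -> _]eq_fun do rewrite -[_ - _]/(refl i _) -wrd_consE.
Qed.

(** The reflection changes only the coefficient of [alpha j], whereas the
    coefficients of a root have a common sign. *)
Lemma rootf_refl_neg b j : rootf b -> 0 < b xo -> b (refl j xo) < 0 ->
  exists c : R, forall x, b x = c * alpha j x.
Proof.
move=> rb b0 bj; have [m mE] := rootf_pos rb b0.
have [p pE] := rootf_neg (rootf_refl j rb) bj.
have bB x : b (x - alpha j x *: coroot j) = b x - alpha j x * b (coroot j).
  by case: rb => a _ ->; rewrite raddfB/= -[a (_ *: _)]/(a _) linearZ.
have m0 i : i != j -> (m i)%:R = 0 :> R.
  move=> ij; pose c k : R := (m k)%:R + (p k)%:R - (if k == j then b (coroot j) else 0).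
  have /(_ i) : forall k, c k = 0.
    apply: alpha_free => x.
    under eq_bigr do rewrite /c mulrBl mulrDl.
    rewrite sumrB big_split/= -mE [X in _ - X](bigD1 j)//= eqxx [X in _ - (_ + X)]big1.
      have := pE x; rewrite bB addr0 => E.
      have -> : \sum_i (p i)%:R * alpha i x = alpha j x * b (coroot j) - b x.
        by apply: oppr_inj; rewrite -E; ring.
      by ring.
    by move=> k kj; rewrite (negbTE kj) mul0r.
  rewrite /c (negbTE ij) subr0 => /eqP; rewrite paddr_eq0 ?ler0n// => /andP[/eqP -> _].
  by [].
exists (m j)%:R => x; rewrite mE (bigD1 j)//= big1 ?addr0// => i ij.
by rewrite m0// mul0r.
Qed.

(** An orthogonal reflection is determined by its hyperplane, and the hypothesis
    says that the word carries the hyperplane of [alpha j] to that of [alpha i]. *)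
Lemma wrd_conj_refl i j s (c : R) :
  (forall x, alpha i (weyl_fun (wrd s) x) = c * alpha j x) ->
  weylM (weyl_s i) (wrd s) = weylM (wrd s) (weyl_s j).
Proof.
move=> ic; set w := wrd s.
(* The factor forced by orthogonality; [alpha i] then identifies it with [c]. *)
pose l := kform (coroot j) (coroot j) / (c * kform (coroot i) (coroot i)).
have c0 : c != 0.
  apply/eqP => c0; have := ic (weyl_fun (wrd (rev s)) (coroot i)).
  by rewrite wrdVK alpha_coroot c0 mul0r => /eqP; rewrite pnatr_eq0.
have wj : weyl_fun w (coroot j) = l *: coroot i.
  apply/eqP; rewrite -subr_eq0; apply/eqP/kform_eq0.
  set d := weyl_fun w _ - _.
  suff d0 x : kform (weyl_fun w x) d = 0 by rewrite -{1}(wrdVK s d) d0.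
  apply: (@mulfI _ 2) => //; rewrite /d kformDr -scaleNr kformZr kform_wrd mulr0 mulrDr.
  rewrite kform_coroot mulrCA kform_coroot ic /l.
  by field; rewrite c0 gt_eqF ?coroot_norm_gt0.
have lc : l = c.
  have := ic (coroot j); rewrite -/w wj alphaZ !alpha_coroot => /mulIf -> //.
apply: weyl_ext => x; rewrite !weylME !weyl_sE /refl weyl_funB weyl_funZ wj ic lc.
by rewrite scalerA mulrC.
Qed.

(** Reading the word, the root [alpha i] becomes negative at some letter; there
    the prefix conjugates that letter into [i], so that multiplying by the
    reflection [i] deletes it. *)
Lemma exchange i s : alpha i (weyl_fun (wrd s) xo) < 0 -> exists s',
  [/\ (size s' < size s)%N, {subset s' <= s} & weylM (weyl_s i) (wrd s) = wrd s'].
Proof.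
elim/last_ind: s => [|s j IH].
  by rewrite weyl1E => /lt_gtF; rewrite xo0.
rewrite wrd_rcons weylME weyl_sE => ij.
have rb := rootf_wrd s (rootf_alpha i).
have := rootf_neq0 rb; rewrite neq_lt => /orP[/IH[s' [ss' s's E]]|b0].
  exists (rcons s' j); split; first by rewrite !size_rcons ltnS.
    by move=> k; rewrite !mem_rcons !in_cons => /orP[->//|/s's ->]; rewrite orbT.
  by rewrite weylMA E wrd_rcons.
have [c bc] := rootf_refl_neg rb b0 ij.
exists s; split; first by rewrite size_rcons.
  by move=> k ks; rewrite mem_rcons in_cons ks orbT.
by rewrite weylMA (wrd_conj_refl bc) -weylMA weyl_ss weylM1.
Qed.

(** The root obtained by reflecting [alpha i] in [alpha j] has coefficient [1] on
    [alpha i], so its coefficient on [alpha j] is not negative. *)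
Lemma alpha_coroot_le0 i j : i != j -> alpha i (coroot j) <= 0.
Proof.
move=> ij; have rb := rootf_refl j (rootf_alpha i).
have bE x : alpha i (x - alpha j x *: coroot j) = alpha i x - alpha i (coroot j) * alpha j x.
  by rewrite alphaD -scaleNr alphaZ mulNr mulrC.
pose c k : R := (k == i)%:R - (k == j)%:R * alpha i (coroot j).
have cE x : alpha i x - alpha i (coroot j) * alpha j x = \sum_k c k * alpha k x.
  under eq_bigr do rewrite mulrBl; rewrite sumrB (bigD1 i)//= big1 => [|k /negbTE ->].
    rewrite (bigD1 j)//= big1 => [|k /negbTE ->]; last by rewrite !mul0r.
    by rewrite !eqxx !mul1r !addr0.
  by rewrite mul0r.
have := rootf_neq0 rb; rewrite neq_lt => /orP[bn|bp].
  have [m mE] := rootf_neg rb bn.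
  have /(_ i) : forall k, c k + (m k)%:R = 0.
    apply: alpha_free => x; under eq_bigr do rewrite mulrDl.
    by rewrite big_split/= -cE -bE mE addNr.
  rewrite /c eqxx (negbTE ij) mul0r subr0 addrC natr1 => /eqP.
  by rewrite pnatr_eq0.
have [m mE] := rootf_pos rb bp.
have /(_ j) : forall k, c k - (m k)%:R = 0.
  apply: alpha_free => x; under eq_bigr do rewrite mulrBl.
  by rewrite sumrB/= -cE -bE mE subrr.
rewrite /c eqxx eq_sym (negbTE ij) mul1r sub0r => /eqP.
by rewrite -opprD oppr_eq0 addr_eq0 => /eqP ->; rewrite oppr_le0.
Qed.

End Regular.
End RootGeometry.

(** * Dominant representatives and stabilisers *)

Lemma injective_fintype_enum (X : choiceType) (T : finType) (f : X -> T) :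
  injective f -> exists r : seq X, forall x, x \in r.
Proof.
move=> fi.
have ht (t : T) : exists r : seq X, forall x, f x = t -> x \in r.
  have [[x xt]|nx] := pselect (exists x, f x = t).
    by exists [:: x] => y; rewrite -xt => /fi ->; rewrite mem_head.
  by exists [::] => x xt; exfalso; apply: nx; exists x.
exists (flatten [seq projT1 (cid (ht t)) | t <- enum T]) => x.
apply/flatten_mapP; exists (f x); first by rewrite mem_enum.
exact: (projT2 (cid (ht (f x)))).
Qed.

Lemma seq_max (T : eqType) (R : realType) (f : T -> R) (r : seq T) x0 : x0 \in r ->
  exists2 x, x \in r & forall y, y \in r -> f y <= f x.
Proof.
elim: r x0 => // a r IH x0 _; case: r IH => [_|b r IH].
  by exists a; rewrite ?mem_head// => y; rewrite inE => /eqP ->.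
have [x xr xm] := IH b (mem_head _ _).
have [fxa|fax] := leP (f x) (f a).
  exists a; rewrite ?mem_head// => y; rewrite in_cons => /orP[/eqP ->//|/xm yx].
  exact: le_trans yx fxa.
exists x; first by rewrite in_cons xr orbT.
by move=> y; rewrite in_cons => /orP[/eqP ->|/xm//]; exact: ltW.
Qed.

Section Dominance.
Context {R : realType} {g : splitSemisimple R}.
Local Notation n := (rank g).
Implicit Types (x y z : cartanT g) (i j k : 'I_n) (s : seq 'I_n) (J : {set 'I_n}).
Implicit Types (u v w : weyl g).
Context {xo : cartanT g} (xo0 : open_dominant xo).

Definition dominant_on J y := forall j, j \in J -> 0 <= alpha j y.

Lemma alpha_comb k (c : 'I_n -> R) :
  alpha k (\sum_i c i *: coroot i) = \sum_i c i * alpha k (coroot i).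
Proof.
rewrite (big_morph (alpha k) (alphaD k) (_ : _ = 0)).
  by apply: eq_bigr => i _; rewrite alphaZ.
by rewrite -(scale0r (0 : cartanT g)) alphaZ mul0r.
Qed.

Lemma alpha_wrd_span J i s : i \in J -> {subset s <= J} -> exists c : 'I_n -> R,
  (forall k, k \notin J -> c k = 0) /\
  forall x, alpha i (weyl_fun (wrd s) x) = \sum_k c k * alpha k x.
Proof.
move=> + sJ; elim: s sJ i => [|j s IH] sJ i iJ.
  exists (fun k => (k == i)%:R); split => [k kJ|x].
    by case: eqVneq => // ki; rewrite ki iJ in kJ.
  rewrite weyl1E (bigD1 i)//= big1 => [|k /negbTE ->]; last by rewrite mul0r.
  by rewrite eqxx mul1r addr0.
have jJ : j \in J by apply: sJ; rewrite mem_head.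
have s'J : {subset s <= J} by move=> k ks; apply: sJ; rewrite in_cons ks orbT.
have [c [c0 cE]] := IH s'J i iJ; have [d [d0 dE]] := IH s'J j jJ.
exists (fun k => c k - d k * alpha i (coroot j)); split => [k kJ|x].
  by rewrite c0// d0// mul0r subrr.
rewrite wrd_consE /refl alphaD -scaleNr alphaZ cE dE mulNr.
under [RHS]eq_bigr do rewrite mulrBl.
rewrite sumrB; congr (_ - _); rewrite mulr_suml.
by apply: eq_bigr => k _; rewrite mulrAC.
Qed.

(** Values on [J]-dominant points only see the coefficients on [J]. A root of the
    parabolic subsystem that is positive has these coefficients nonnegative. *)
Lemma alpha_wrd_ge0 J i s y : i \in J -> {subset s <= J} -> dominant_on J y ->
  0 < alpha i (weyl_fun (wrd s) xo) -> 0 <= alpha i (weyl_fun (wrd s) y).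
Proof.
move=> iJ sJ yJ pos; have [c [c0 cE]] := alpha_wrd_span iJ sJ.
have [m mE] := rootf_pos xo0 (rootf_wrd xo0 s (rootf_alpha i)) pos.
have cm k : c k - (m k)%:R = 0.
  move: k; apply: (alpha_free (g := g)) => x; under eq_bigr do rewrite mulrBl.
  by rewrite sumrB/= -cE -mE subrr.
rewrite mE; apply: sumr_ge0 => k _.
have [kJ|kJ] := boolP (k \in J); first by rewrite mulr_ge0// yJ.
by have := cm k; rewrite c0// sub0r => /eqP; rewrite oppr_eq0 => /eqP ->; rewrite mul0r.
Qed.

(** The orbit of a dominant point lies below that point. A letter that goes up
    is one along which the word is not reduced, so that it can be shortened by
    the exchange property. *)
Lemma fund_weight_wrd_le J s y k : {subset s <= J} -> dominant_on J y ->
  fund_weight k (weyl_fun (wrd s) y) <= fund_weight k y :> R.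
Proof.
move=> + yJ; have [N] := ubnP (size s); elim: N s => // N IH [|i s] /=.
  by rewrite weyl1E.
rewrite ltnS => sN sJ.
have iJ : i \in J by apply: sJ; rewrite mem_head.
have s'J : {subset s <= J} by move=> l ls; apply: sJ; rewrite in_cons ls orbT.
have := rootf_neq0 xo0 (rootf_wrd xo0 s (rootf_alpha i)); rewrite neq_lt => /orP[neg|pos].
  have [s' [ss' s's ->]] := exchange xo0 neg.
  by apply: IH; [exact: ltn_trans ss' sN|move=> l /s's/s'J].
rewrite weylME weyl_sE (fund_weight_refl xo0); apply: le_trans (IH s sN s'J).
by rewrite gerBl mulrn_wge0// (alpha_wrd_ge0 iJ s'J yJ pos).
Qed.

Lemma fund_weight_wrd_id J s x k : {subset s <= J} -> k \notin J ->
  fund_weight k (weyl_fun (wrd s) x) = fund_weight k x :> R.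
Proof.
move=> + kJ; elim: s => [|i s IH] sJ; first by rewrite weyl1E.
rewrite wrd_consE (fund_weight_refl xo0) IH => [|l ls]; last first.
  by apply: sJ; rewrite in_cons ls orbT.
case: eqVneq => [ki|]; last by rewrite mulr0n subr0.
by move/negP: kJ; rewrite ki sJ ?mem_head.
Qed.

Lemma alpha_wrd_ge J s y k : {subset s <= J} -> dominant_on J y -> k \notin J ->
  alpha k y <= alpha k (weyl_fun (wrd s) y).
Proof.
move=> sJ yJ kJ; rewrite -subr_le0.
set z := weyl_fun _ _.
have -> : alpha k y - alpha k z = alpha k (y - z) by rewrite alphaB.
rewrite (fund_weightK xo0 (y - z)) alpha_comb; apply: sumr_le0 => j _.
have fE : fund_weight j (y - z) = fund_weight j y - fund_weight j z :> R.
  exact: fund_weightB.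
have [jk|jk] := eqVneq j k.
  by rewrite fE jk /z (fund_weight_wrd_id y sJ kJ) subrr mul0r.
rewrite mulr_ge0_le0//; last by apply: (alpha_coroot_le0 xo0); rewrite eq_sym.
by rewrite fE subr_ge0 (fund_weight_wrd_le j sJ yJ).
Qed.

Lemma dominant_onT y : dominant y -> dominant_on (finset.setTfor 'I_n) y.
Proof. by move=> yd j _; exact: yd. Qed.

Lemma dominant_orbit s y : dominant y -> dominant (weyl_fun (wrd s) y) ->
  weyl_fun (wrd s) y = y.
Proof.
move=> yd wyd; apply: (fund_weight_inj xo0) => i; apply/eqP; rewrite eq_le.
have sT (r : seq 'I_n) : {subset r <= (finset.setTfor 'I_n)} by move=> k _; rewrite finset.in_setT.
rewrite (fund_weight_wrd_le i (sT s) (dominant_onT yd)) /=.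
by rewrite -{1}(wrdK xo0 s y) (fund_weight_wrd_le i (sT (rev s)) (dominant_onT wyd)).
Qed.

(** Letters of the word are peeled off. If the root [alpha i] of the first letter
    stays positive along the rest of the word, its value at [y] is both
    nonpositive and nonnegative, so the letter fixes [y]; otherwise the exchange
    property shortens the word. *)
Lemma dominant_stabilizer s y : dominant y -> dominant (weyl_fun (wrd s) y) ->
  exists2 s', wrd s = wrd s' & forall j, j \in s' -> alpha j y = 0.
Proof.
move=> yd /(dominant_orbit yd).
have [N] := ubnP (size s); elim: N s => // N IH [|i s] /=.
  by move=> _ _; exists [::].
rewrite ltnS => sN; rewrite weylME weyl_sE => wy.
have := rootf_neq0 xo0 (rootf_wrd xo0 s (rootf_alpha i)); rewrite neq_lt => /orP[neg|pos].
  have [s' [ss' s's E]] := exchange xo0 neg.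
  have [|s'' sE s''0] := IH s' (ltn_trans ss' sN); first by rewrite -E weylME weyl_sE.
  by exists s'' => //; rewrite E.
have wi : 0 <= alpha i (weyl_fun (wrd s) y).
  apply: (alpha_wrd_ge0 _ _ (dominant_onT yd) pos); rewrite ?finset.in_setT// => k.
  by rewrite finset.in_setT.
have ai : alpha i y = 0.
  apply/eqP; rewrite eq_le yd andbT.
  by rewrite -wy (alpha_refl xo0) oppr_le0.
have sy : weyl_fun (wrd s) y = y by rewrite -[LHS](reflK xo0 i) wy refl_id.
have [s' sE s'0] := IH s sN sy.
exists (i :: s'); first by rewrite /= sE.
by move=> j; rewrite in_cons => /orP[/eqP ->|/s'0].
Qed.

(** A Weyl group element is determined by the roots [alpha i \o w], and there
    are finitely many roots. *)
Lemma weyl_finite : exists r : seq (weyl g), forall w, w \in r.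
Proof.
have [d [r rP]] := rootf_finite (g := g).
have ai w i : exists m : 'I_d, (fun x => alpha i (weyl_fun w x)) = r m.
  by have [s ->] := weyl_word w; exact: (rP _ (rootf_wrd xo0 s (rootf_alpha i))).
pose f w : {ffun 'I_n -> 'I_d} := [ffun i => projT1 (cid (ai w i))].
apply: (@injective_fintype_enum _ _ f) => u v /ffunP uv.
apply: weyl_ext => x; apply: (alpha_inj xo0) => i.
have := uv i; rewrite !ffunE => E.
have /(congr1 (fun F => F x)) := projT2 (cid (ai u i)).
rewrite E -(projT2 (cid (ai v i))); exact.
Qed.

(** A point of the finite orbit where the sum of the fundamental weights is
    largest cannot be raised by a reflection of [J]. *)
Lemma dominant_representative J z :
  exists2 s, {subset s <= J} & dominant_on J (weyl_fun (wrd s) z).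
Proof.
have [r rP] := weyl_finite.
pose P w := `[< exists2 s, {subset s <= J} & w = wrd s >].
pose f w : R := \sum_i fund_weight i (weyl_fun w z).
have P1 : weyl1 g \in [seq w <- r | P w].
  by rewrite mem_filter rP andbT; apply/asboolP; exists [::].
have [w + wm] := seq_max f P1; rewrite mem_filter => /andP[/asboolP[s sJ wE] _].
exists s => // j jJ; rewrite leNgt; apply/negP => jn.
have sjJ : {subset j :: s <= J}.
  by move=> k; rewrite in_cons => /orP[/eqP ->|/sJ].
have PJ : P (wrd (j :: s)) by apply/asboolP; exists (j :: s).
have := wm (wrd (j :: s)); rewrite mem_filter rP andbT => /(_ PJ).
rewrite leNgt => /negP; apply.
rewrite /f wE; under [X in _ < X]eq_bigr do rewrite wrd_consE (fund_weight_refl xo0).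
rewrite sumrB ltrDl oppr_gt0 (bigD1 j)//= big1 => [|i /negbTE ->]; last by rewrite mulr0n.
by rewrite eqxx addr0.
Qed.

End Dominance.

(** ** Continuity *)

Section Continuity.
Context {R : realType}.

Lemma continuous_compT (T U V : topologicalType) (f : T -> U) (h : U -> V) :
  continuous f -> continuous h -> continuous (fun t => h (f t)).
Proof. by move=> fc hc t; exact: (continuous_comp (fc t) (hc (f t))). Qed.

Lemma continuous_sumR (T : topologicalType) (I : Type) (r : seq I) (F : I -> T -> R) :
  (forall i, continuous (F i)) -> continuous (fun t => \sum_(i <- r) F i t).
Proof.
move=> Fc; elim: r => [|i r IH].
  by under eq_fun do rewrite big_nil; move=> t; exact: cvg_cst.
under eq_fun do rewrite big_cons; move=> t.
by apply: (@continuousD _ R^o); [exact: Fc|exact: IH].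
Qed.

Lemma continuous_mulR (T : topologicalType) (f h : T -> R) :
  continuous f -> continuous h -> continuous (fun t => f t * h t).
Proof. by move=> fc hc t; apply: continuousM; [exact: fc|exact: hc]. Qed.

Lemma continuous_subR (T : topologicalType) (f h : T -> R) :
  continuous f -> continuous h -> continuous (fun t => f t - h t).
Proof. by move=> fc hc t; apply: cvgB; [exact: fc|exact: hc]. Qed.

Lemma continuous_cstR (T : topologicalType) (c : R) : continuous (fun _ : T => c).
Proof. by move=> t; exact: cvg_cst. Qed.

Lemma cvg_rV (T : Type) (F : set_system T) m (f : T -> 'rV[R]_m) (y : 'rV[R]_m) :
  Filter F -> (forall j, (fun t => f t 0 j) @ F --> y 0 j) -> f @ F --> y.
Proof.
move=> FF fc A [P yP PA].
have : \forall t \near F, forall j, P 0 j (f t 0 j).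
  by apply: filter_forall => j; apply: fc; exact: yP.
by apply: filterS => t Pt; apply: PA => i j; rewrite ord1.
Qed.

Lemma continuous_rV (T : topologicalType) m (f : T -> 'rV[R]_m) :
  (forall j, continuous (fun t => f t 0 j)) -> continuous f.
Proof. by move=> fc t; apply: cvg_rV => j; exact: fc. Qed.

Lemma closed_ge_fun (T : topologicalType) (f : T -> R) (c : R) :
  continuous f -> closed [set x | c <= f x].
Proof.
move=> fc; apply: (@preimage_closed _ _ f [set r | c <= r]); last exact: closed_ge.
by move=> x _; exact: fc.
Qed.

Lemma closed_le_fun (T : topologicalType) (f : T -> R) (c : R) :
  continuous f -> closed [set x | f x <= c].
Proof.
move=> fc; apply: (@preimage_closed _ _ f [set r | r <= c]); last exact: closed_le.
by move=> x _; exact: fc.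
Qed.

Lemma open_gt_fun (T : topologicalType) (f : T -> R) (c : R) :
  continuous f -> open [set x | c < f x].
Proof.
move=> fc; apply: (@open_comp _ _ f [set r | c < r]); last exact: open_gt.
by move=> x _; exact: fc.
Qed.

Lemma open_lt_fun (T : topologicalType) (f : T -> R) (c : R) :
  continuous f -> open [set x | f x < c].
Proof.
move=> fc; apply: (@open_comp _ _ f [set r | r < c]); last exact: open_lt.
by move=> x _; exact: fc.
Qed.

Lemma closed_forall (T : topologicalType) (I : Type) (P : I -> T -> Prop) :
  (forall i, closed [set x | P i x]) -> closed [set x | forall i, P i x].
Proof.
move=> Pc; have -> : [set x | forall i, P i x] = \bigcap_(i in [set: I]) [set x | P i x].
  by apply/seteqP; split => [x Px i _|x Px i]; exact: Px.
by apply: closed_bigI => i _.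
Qed.

Lemma open_forall (T : topologicalType) (I : finType) (P : I -> T -> Prop) :
  (forall i, open [set x | P i x]) -> open [set x | forall i, P i x].
Proof.
move=> Po; rewrite openE => x Px; apply: filter_forall => i.
by apply: open_nbhs_nbhs; split; [exact: Po|exact: Px].
Qed.

Context {g : splitSemisimple R}.
Local Notation n := (rank g).
Implicit Types (x y z : cartanT g) (i j k : 'I_n).

Lemma cartan_coords_lin (c : R) x y :
  cartan_coords (c *: x + y : cartanT g) = c *: cartan_coords x + cartan_coords y.
Proof.
have E : @vsval R g (cartan g) (c *: x + y) =
    c *: @vsval R g (cartan g) x + @vsval R g (cartan g) y by [].
by apply/rowP => i; rewrite !mxE E linearP.
Qed.

Lemma continuous_cartan_coord i : continuous (fun x => cartan_coords x 0 i : R).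
Proof.
have h1 : continuous (@cartan_coords R g : cartanT g -> 'rV[R]_n).
  exact: initial_continuous.
by move=> x; exact: (cvg_comp _ _ (h1 x) (@coord_continuous R 1 n 0 i (cartan_coords x))).
Qed.

Lemma continuous_linear_cartan (f : cartanT g -> R) :
  (forall x y, f (x + y) = f x + f y) -> (forall (c : R) x, f (c *: x) = c * f x) ->
  continuous f.
Proof.
move=> fD fZ.
pose E i : subvs_of (cartan g) := vsproj (cartan g) (vbasis (cartan g))`_i.
have xE' (x : subvs_of (cartan g)) : x = \sum_i cartan_coords x 0 i *: E i.
  apply: val_inj; rewrite [RHS]raddf_sum/= [LHS](coord_vbasis (subvsP x)).
  apply: eq_bigr => i _; rewrite mxE vsprojK// vbasis_mem// mem_nth//.
  by rewrite size_tuple.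
have xE (x : cartanT g) : x = \sum_i cartan_coords x 0 i *: (E i : cartanT g).
  exact: xE'.
have f0 : f 0 = 0 by rewrite -(scale0r (0 : cartanT g)) fZ mul0r.
have fE x : f x = \sum_i cartan_coords x 0 i * f (E i).
  by rewrite {1}(xE x) (big_morph f fD f0); apply: eq_bigr => i _; rewrite fZ.
rewrite (funext fE); apply: continuous_sumR => i; apply: continuous_mulR.
  exact: continuous_cartan_coord.
exact: continuous_cstR.
Qed.

Lemma continuous_fund_weight i : continuous (fun x => fund_weight i x : R).
Proof.
by apply: continuous_linear_cartan => *; [exact: fund_weightD|exact: fund_weightZ].
Qed.

Lemma continuous_alpha i : continuous (@alpha R g i).
Proof. by apply: continuous_linear_cartan => *; [exact: alphaD|exact: alphaZ]. Qed.

Context {xo : cartanT g} (xo0 : open_dominant xo).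

Lemma continuous_cartan (T : topologicalType) (F : T -> cartanT g) :
  (forall i, continuous (fun t => fund_weight i (F t) : R)) -> continuous F.
Proof.
move=> Fc; apply: continuous_comp_initial; apply: continuous_rV => j.
have E t : cartan_coords (F t) 0 j =
    \sum_i (fund_weight i (F t) : R) * cartan_coords (coroot i : cartanT g) 0 j.
  rewrite [in LHS](fund_weightK xo0 (F t)).
  have c0 : cartan_coords (0 : cartanT g) = 0.
    have E0 : @vsval R g (cartan g) (0 : cartanT g) = 0 by [].
    by apply/rowP => i; rewrite !mxE E0 linear0.
  have cD x y : cartan_coords (x + y : cartanT g) = cartan_coords x + cartan_coords y.
    by rewrite -{1}(scale1r x) cartan_coords_lin scale1r.
  have cZ (c : R) x : cartan_coords (c *: x : cartanT g) = c *: cartan_coords x.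
    by rewrite -{1}(addr0 (c *: x)) cartan_coords_lin c0 addr0.
  rewrite (big_morph _ cD c0) summxE; apply: eq_bigr => i _.
  by rewrite cZ mxE.
rewrite /= (funext E).
apply: continuous_sumR => i; apply: continuous_mulR; first exact: Fc.
exact: continuous_cstR.
Qed.

Lemma continuous_weyl w : continuous (weyl_fun w : cartanT g -> cartanT g).
Proof.
apply: continuous_cartan => i; apply: continuous_linear_cartan => [x y|c x].
  by rewrite linearD fund_weightD.
by rewrite linearZ fund_weightZ.
Qed.

End Continuity.

(** ** The polytope *)

Section Polytope.
Context {R : realType} {g : splitSemisimple R}.
Local Notation n := (rank g).
Implicit Types (x y z : cartanT g) (i j : 'I_n).
Context {xo : cartanT g} (xo0 : open_dominant xo).

(** Enumerating the finite Weyl group, the polytope is the image of a simplex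
    under a linear map; both its compactness and the description of its
    dominant part are read off this parametrisation. *)
Context (r : seq (weyl g)) (rP : forall w, w \in r).
Local Notation N := (size r).

Definition vertex (k : 'I_N) : cartanT g := weyl_fun (tnth (in_tuple r) k) xo.

Definition simplex : set 'rV[R]_N :=
  [set c | (forall k, 0 <= c 0 k) /\ \sum_k c 0 k = 1].

Definition simplex_point (c : 'rV[R]_N) : cartanT g := \sum_k c 0 k *: vertex k.

Lemma fund_weight_simplex_point i c : 
  fund_weight i (simplex_point c) = \sum_k c 0 k * fund_weight i (vertex k) :> R.
Proof. by rewrite fund_weight_sum; apply: eq_bigr => k _; rewrite fund_weightZ. Qed.

Lemma polytopeE : polytope xo = simplex_point @` simplex.
Proof.
apply/seteqP; split=> [x [m [c [p [c0 c1 pP ->]]]]|_ [c [c0 c1] <-]]; last first.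
  exists N, (c 0), vertex; split => //.
have /choice[e eP] : forall k : 'I_m, exists l : 'I_N, p k = vertex l.
  move=> k; have [w _ <-] := pP k.
  have /tnthP[l wl] : w \in in_tuple r by exact: rP.
  by exists l; rewrite /vertex -wl.
exists (\row_l \sum_(k | e k == l) c k).
  split=> [l|]; first by rewrite mxE; apply: sumr_ge0.
  by under eq_bigr do rewrite mxE; rewrite -[RHS]c1 [RHS](partition_big e predT).
rewrite /simplex_point (partition_big e predT)//=; apply: eq_bigr => l _.
by rewrite mxE scaler_suml; apply: eq_bigr => k /eqP <-; rewrite eP.
Qed.

Lemma continuous_simplex_point : continuous simplex_point.
Proof.
apply: (continuous_cartan xo0) => i; under eq_fun do rewrite fund_weight_simplex_point.
apply: continuous_sumR => k; apply: continuous_mulR; last exact: continuous_cstR.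
exact: coord_continuous.
Qed.

Lemma simplex_compact : compact simplex.
Proof.
apply: (@subclosed_compact _ _ [set c : 'rV[R]_N | forall k, `[0, 1]%classic (c 0 k)]).
- have -> : simplex = [set c | forall k, 0 <= c 0 k] `&`
      ([set c | 1 <= \sum_k c 0 k] `&` [set c | \sum_k c 0 k <= 1]).
    apply/seteqP; split=> [c [c0 c1]|c [/= c0 [c1 c2]]]; split => //=.
      by split; rewrite c1.
    by apply/eqP; rewrite eq_le c1 c2.
  apply: closedI; first by apply: closed_forall => k; apply: closed_ge_fun; exact: coord_continuous.
  have cs : continuous (fun c : 'rV[R]_N => \sum_k c 0 k : R).
    apply: (@continuous_sumR _ _ _ _ (fun k (c : 'rV[R]_N) => c 0 k)) => k.
    exact: coord_continuous.
  by apply: closedI; [exact: closed_ge_fun|exact: closed_le_fun].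
- by apply: (@rV_compact R N (fun=> `[0, 1]%classic)) => k; exact: segment_compact.
- move=> c [c0 c1] k /=; rewrite in_itv/= c0 -c1 (bigD1 k)//= lerDl.
  exact: sumr_ge0.
Qed.

Lemma polytope_compact : compact (polytope xo).
Proof.
rewrite polytopeE; apply: continuous_compact; last exact: simplex_compact.
by apply: continuous_subspaceT; exact: continuous_simplex_point.
Qed.

Lemma polytope_convex (t : R) x y : 0 <= t <= 1 -> polytope xo x -> polytope xo y ->
  polytope xo ((1 - t) *: x + t *: y).
Proof.
move=> t01; rewrite polytopeE => -[c [c0 c1] <-] [d [d0 d1] <-].
have /andP[t0 t1] := t01.
exists ((1 - t) *: c + t *: d).
  split=> [k|]; first by rewrite !mxE addr_ge0// mulr_ge0// subr_ge0.
  under eq_bigr do rewrite !mxE; rewrite big_split/= -!mulr_sumr c1 d1; ring.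
rewrite /simplex_point !scaler_sumr -big_split; apply: eq_bigr => k _.
by rewrite /= !mxE !scalerA -scalerDl.
Qed.

Lemma polytope_refl i x : polytope xo x -> polytope xo (refl i x).
Proof.
move=> [m [c [p [c0 c1 pP ->]]]]; exists m, c, (refl i \o p); split => // [k|].
  have [w _ wk] := pP k; exists (weylM (weyl_s i) w) => //=.
  by rewrite weylME weyl_sE wk.
rewrite -weyl_sE raddf_sum; apply: eq_bigr => k _.
by rewrite /= -weyl_sE; exact: weyl_funZ.
Qed.

(** A dominant [y] below [xo] is the lowest point above [y] of the polytope:
    if some [z >= y] in the polytope differs from [y], positivity of the form
    on [z - y] exhibits a simple coroot along which [z] can still be lowered
    inside the segment from [z] to its reflection. *)
Lemma dominant_below_polytope y : dominant y ->
  (forall i, fund_weight i y <= fund_weight i xo :> R) -> polytope xo y.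
Proof.
move=> yd yx.
pose A := simplex `&` [set c | forall i, fund_weight i y <= fund_weight i (simplex_point c) :> R].
pose h (c : 'rV[R]_N) : R := \sum_i fund_weight i (simplex_point c).
have fc i : continuous (fun c => fund_weight i (simplex_point c) : R).
  exact: continuous_compT continuous_simplex_point (@continuous_fund_weight R g i).
have cA : compact A.
  apply: (@subclosed_compact _ _ simplex); last by move=> c [].
    apply: closedI; first by apply: compact_closed simplex_compact; exact: norm_hausdorff.
    by apply: closed_forall => i; apply: closed_ge_fun.
  exact: simplex_compact.
have A0 : A !=set0.
  have : polytope xo xo.
    exists 1%N, (fun=> 1), (fun=> xo); split => //.
    - by rewrite big_ord1.
    - by move=> _; exists (weyl1 g); rewrite ?weyl1E.
    - by rewrite big_ord1 scale1r.
  by rewrite polytopeE => -[c sc cx]; exists c; split => // i; rewrite cx.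
have ch : {within A, continuous h}.
  by apply: continuous_subspaceT; apply: continuous_sumR => i; exact: fc.
have [c] := EVT_min_rV A0 cA ch; rewrite inE => -[sc cy] cmin.
set z := simplex_point c in cy.
have Pz : polytope xo z by rewrite polytopeE; exists c.
pose d := z - y.
have dE i : fund_weight i d = fund_weight i z - fund_weight i y :> R by exact: fund_weightB.
have d0 i : 0 <= fund_weight i d :> R by rewrite dE subr_ge0.
have [d00|dn0] := eqVneq d 0.
  by have -> : y = z; [apply/esym/eqP; rewrite -subr_eq0 -/d d00|].
exfalso.
have [i [di ai]] : exists i, 0 < fund_weight i d :> R /\ 0 < alpha i d.
  apply: contrapT => /forallNP ni.
  have k0 : kform d 0 = 0 by rewrite -(scale0r (0 : cartanT g)) kformZr mul0r.
  have : 2 * kform d d = 0.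
    apply/eqP; rewrite eq_le mulr_ge0 ?kform_ge0// andbT.
    rewrite [X in kform _ X](fund_weightK xo0).
    rewrite (big_morph (kform d) (fun a b => kformDr a b d) k0) mulr_sumr.
    apply: sumr_le0 => i _; rewrite kformZr mulrCA (kform_coroot xo0).
    have [di|di] := ltP 0 (fund_weight i d : R); last first.
      have -> : fund_weight i d = 0 :> R by apply/eqP; rewrite eq_le di d0.
      by rewrite mul0r.
    rewrite pmulr_rle0// pmulr_lle0 ?(coroot_norm_gt0 xo0)//.
    by rewrite leNgt; apply/negP => ai; apply: (ni i).
  move=> kd0; move/eqP: dn0; apply; apply: kform_eq0.
  by apply: (@mulfI _ 2) => //; rewrite mulr0.
have az : 0 < alpha i z.
  rewrite -(subrK y z) -/d alphaD; exact: ltr_pwDl.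
(* Lowering [z] by [a] stays above [y] and on the segment to the reflection. *)
pose a := Num.min (fund_weight i d : R) (alpha i z).
have a0 : 0 < a by rewrite lt_min di az.
pose z' := z - a *: coroot i.
have Pz' : polytope xo z'.
  have t01 : 0 <= a / alpha i z <= 1.
    by rewrite divr_ge0 ?(ltW a0) ?(ltW az)//= ler_pdivrMr// mul1r ge_min lexx orbT.
  have := polytope_convex t01 Pz (polytope_refl i Pz).
  rewrite /refl scalerBr addrA -scalerDl subrK scale1r scalerA.
  by rewrite divfK ?gt_eqF.
have zE j : fund_weight j z' = fund_weight j z - a * (j == i)%:R :> R.
  by rewrite fund_weightB fund_weightZ (fund_weight_coroot xo0).
move: (Pz'); rewrite polytopeE => -[c' sc' c'z].
have Ac' : A c'.
  split=> // j; rewrite /= c'z zE; have [->|] := eqVneq j i; last by rewrite mulr0 subr0 cy.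
  rewrite mulr1 lerBrDr -lerBrDl -dE; by rewrite ge_min lexx.
have := cmin c'; rewrite inE => /(_ Ac'); apply/negP; rewrite -ltNge.
rewrite /h c'z -/z; under eq_bigr do rewrite zE.
rewrite sumrB ltrBlDr ltrDl (bigD1 i)//= eqxx mulr1 big1 ?addr0// => j /negbTE ->.
by rewrite mulr0.
Qed.

End Polytope.

Section Cells.
Context {R : realType} {g : splitSemisimple R}.
Implicit Types (x y z : cartanT g).
Context {xo : cartanT g} (xo0 : open_dominant xo).

Lemma polytope_fund_weight_le y i : polytope xo y ->
  fund_weight i y <= fund_weight i xo :> R.
Proof.
move=> [m [c [p [c0 c1 pP ->]]]].
rewrite fund_weight_sum -[leRHS]mul1r -c1 mulr_suml; apply: ler_sum => k _.
rewrite fund_weightZ ler_wpM2l//; have [w _ <-] := pP k; have [s ->] := weyl_word w.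
apply: (fund_weight_wrd_le xo0 (J := finset.setTfor 'I_(rank g))).
  by move=> j _; rewrite finset.in_setT.
by move=> j _; apply: ltW; exact: xo0.
Qed.

(** This turns the convex hull into linear inequalities, the internal and
    external walls of the cell. *)
Lemma cell1P y : cell1 xo y <->
  dominant y /\ forall i, fund_weight i y <= fund_weight i xo :> R.
Proof.
split=> [[Py yd]|[yd yx]]; first by split => // i; exact: polytope_fund_weight_le.
have [r rP] := weyl_finite xo0.
by split => //; exact: (dominant_below_polytope xo0 rP).
Qed.

Lemma cell1_compact : compact (cell1 xo).
Proof.
have [r rP] := weyl_finite xo0.
have cP := polytope_compact xo0 rP.
have -> : cell1 xo = polytope xo `&` [set y | forall i, 0 <= alpha i y] by [].
apply: compact_closedI => //; apply: (@closed_forall _ _ (fun i y => 0 <= alpha i y)) => i.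
by apply: closed_ge_fun; exact: continuous_alpha.
Qed.

Lemma cell_compact w : compact (cell xo w).
Proof.
apply: continuous_compact; last exact: cell1_compact.
by apply: continuous_subspaceT; exact: continuous_weyl.
Qed.

End Cells.

(** * Calculus of [C^k] functions *)

Section SmoothCalculus.
Context {R : realType} {n : nat}.
Implicit Types (U V : set 'rV[R]_n) (f h : 'rV[R]_n -> R^o) (k : nat).

Lemma Ck_continuous k U f : Ck k U f -> forall x, U x -> {for x, continuous f}.
Proof. by case: k => [|k] []. Qed.

Lemma Ck_ext k U f h : open U -> (forall x, U x -> f x = h x) -> Ck k U f -> Ck k U h.
Proof.
move=> oU; elim: k f h => [|k IH] f h fh [fc fk].
all: have near_fh x : U x -> \forall y \near x, f y = h y.
1,3: by move=> Ux; apply: filterS fh _; exact: open_nbhs_nbhs.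
all: have hc x : U x -> {for x, continuous h}.
1,3: move=> Ux; rewrite /prop_for /continuous_at -fh//.
1,2: by apply: cvg_trans (fc x Ux); exact: near_eq_cvg (near_fh x Ux).
  by [].
split=> // i; have [fd fD] := fk i; split.
  by move=> x Ux; apply: near_eq_derivable (fd x Ux); exact: near_fh.
apply: IH fD => x Ux; apply: near_eq_derive; exact: near_fh.
Qed.

Lemma Ck_local k U f : (forall x, U x -> exists V, [/\ open V, V x & Ck k V f]) -> Ck k U f.
Proof.
elim: k f => [|k IH] f loc.
  split=> // x Ux; have [V [_ Vx fV]] := loc x Ux; exact: Ck_continuous fV x Vx.
split=> [x Ux|i]; first by have [V [_ Vx fV]] := loc x Ux; exact: Ck_continuous fV x Vx.
split=> [x Ux|].
  by have [V [_ Vx [_ /(_ i)[fV _]]]] := loc x Ux; exact: fV.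
apply: IH => x Ux; have [V [oV Vx [_ /(_ i)[_ fV]]]] := loc x Ux.
by exists V.
Qed.

Lemma CkW k U f : Ck k.+1 U f -> Ck k U f.
Proof.
elim: k f => [|k IH] f [fc fk]; first by split.
split=> // i; have [fd fD] := fk i; split => //; exact: IH.
Qed.

Lemma Ck_cst k U (c : R^o) : Ck k U (fun=> c).
Proof.
elim: k c => [|k IH] c; split => //; try by move=> x _; exact: cst_continuous.
move=> i; split => [x _|]; first exact: derivable_cst.
by under eq_fun do rewrite derive_cst; exact: IH.
Qed.

Lemma derivable_coord (j : 'I_n) (x v : 'rV[R]_n) :
  derivable (fun y : 'rV[R]_n => y 0 j : R^o) x v.
Proof.
have idd : derivable (@id 'rV[R]_n) x v by exact: derivable_id.
by have := (derivable_mxP _ _ _).1 idd 0 j.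
Qed.

Lemma derive_coord (j : 'I_n) (x v : 'rV[R]_n) :
  'D_v (fun y : 'rV[R]_n => y 0 j : R^o) x = v 0 j.
Proof.
have idd : derivable (@id 'rV[R]_n) x v by exact: derivable_id.
have := derive_mx idd; rewrite derive_id => /rowP /(_ j).
by rewrite mxE => ->.
Qed.

Lemma Ck_coord k U (j : 'I_n) : Ck k U (fun x => x 0 j).
Proof.
case: k => [|k]; split => //; try by move=> x _; exact: coord_continuous.
move=> i; split => [x _|]; first exact: derivable_coord.
by under eq_fun do rewrite derive_coord; exact: Ck_cst.
Qed.

Lemma Ck_add k U f h : open U -> Ck k U f -> Ck k U h -> Ck k U (fun x => f x + h x).
Proof.
move=> oU; elim: k f h => [|k IH] f h [fc fk] [hc hk]; split => //;
  try by move=> x Ux; apply: (@continuousD _ R^o); [exact: fc|exact: hc].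
move=> i; have [fd fD] := fk i; have [hd hD] := hk i; split.
  by move=> x Ux; apply: (@derivableD _ _ _ f h); [exact: fd|exact: hd].
apply: (Ck_ext oU) (IH _ _ fD hD) => x Ux.
by rewrite -deriveD//; [exact: fd|exact: hd].
Qed.

Lemma Ck_mul k U f h : open U -> Ck k U f -> Ck k U h -> Ck k U (fun x => f x * h x).
Proof.
move=> oU; elim: k f h => [|k IH] f h Cf Ch; move: (Cf) (Ch) => [fc fk] [hc hk]; split => //;
  try by move=> x Ux; apply: continuousM; [exact: fc|exact: hc].
move=> i; have [fd fD] := fk i; have [hd hD] := hk i; split.
  by move=> x Ux; apply: (@derivableM _ _ f h); [exact: fd|exact: hd].
apply: (Ck_ext oU) (Ck_add oU (IH _ _ (CkW Cf) hD) (IH _ _ (CkW Ch) fD)) => x Ux.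
by rewrite -[LHS]/(f x *: 'D_(delta_mx 0 i) h x + h x *: 'D_(delta_mx 0 i) f x)
  -deriveM//; [exact: fd|exact: hd].
Qed.

Lemma Ck_sum k U (I : Type) (r : seq I) (F : I -> 'rV[R]_n -> R^o) : open U ->
  (forall i, Ck k U (F i)) -> Ck k U (fun x => \sum_(i <- r) F i x).
Proof.
move=> oU CF; elim: r => [|i r IH].
  by under eq_fun do rewrite big_nil; exact: Ck_cst.
by under eq_fun do rewrite big_cons; exact: Ck_add.
Qed.

Lemma derive_line f (x v : 'rV[R]_n) :
  'D_v f x = 'D_1 (fun t : R => f (t *: v + x)) 0.
Proof.
rewrite /derive; set g1 := fun t => _; set g2 := fun t => _.
suff -> : g1 = g2 by [].
by rewrite funeqE /g1 /g2 => t /=; rewrite addr0 scale0r add0r [_%:A]mulr1.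
Qed.

Lemma is_derive_sqrt_comp f (x v : 'rV[R]_n) : 0 < f x -> derivable f x v ->
  is_derive x v (fun y => Num.sqrt (f y) : R^o) ((2 * Num.sqrt (f x))^-1 * 'D_v f x).
Proof.
move=> fx0 fd.
have f1 : is_derive (0 : R) 1 (fun t : R => f (t *: v + x)) ('D_v f x).
  by apply: DeriveDef; [exact: (derivable1P _ _ _).1|rewrite derive_line].
have s1 : is_derive (f ((0 : R) *: v + x)) 1 Num.sqrt (2 * Num.sqrt (f x))^-1.
  by rewrite scale0r add0r; exact: is_derive1_sqrt.
have [sd sD] := is_derive1_comp s1 f1.
by apply: DeriveDef; [exact: (derivable1P _ _ _).2|rewrite derive_line].
Qed.

Lemma is_derive_rsqrt f (x v : 'rV[R]_n) : 0 < f x -> derivable f x v ->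
  is_derive x v (fun y => (Num.sqrt (f y))^-1 : R^o)
    (- 2^-1 * 'D_v f x * ((Num.sqrt (f x))^-1 * ((Num.sqrt (f x))^-1 * (Num.sqrt (f x))^-1))).
Proof.
move=> fx0 fd; have [sd sD] := is_derive_sqrt_comp fx0 fd.
have sx0 : Num.sqrt (f x) != 0 by rewrite sqrtr_eq0 -ltNge.
apply: DeriveDef; first exact: (@derivableV R 'rV[R]_n (fun y => Num.sqrt (f y)) x v sx0 sd).
have E (a b : R) : a != 0 ->
    - a ^- 2 * ((2 * a)^-1 * b) = - 2^-1 * b * (a^-1 * (a^-1 * a^-1)).
  by move=> a0; field.
have H := @deriveV R 'rV[R]_n (fun y => Num.sqrt (f y)) x v sx0 sd.
rewrite sD in H.
apply: (etrans H).
exact: (E (Num.sqrt (f x)) ('D_v f x) sx0).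
Qed.

(** The class of inverse square roots is closed under differentiation up to
    products, which is what makes the induction go through. *)
Lemma Ck_rsqrt k U f : open U -> (forall x, U x -> 0 < f x) -> Ck k U f ->
  Ck k U (fun x => (Num.sqrt (f x))^-1).
Proof.
move=> oU f0; elim: k => [|k IH] Cf.
all: have rc x : U x -> {for x, continuous (fun x => (Num.sqrt (f x))^-1 : R^o)}.
1,3: move=> Ux; apply: (@continuous_comp _ _ _ f (fun r : R => (Num.sqrt r)^-1));
  [exact: Ck_continuous Cf x Ux|apply: cvgV; [by rewrite sqrtr_eq0 -ltNge f0|
   exact: sqrt_continuous]].
  by [].
split=> // i; have [_ /(_ i)[fd fD]] := Cf.
split=> [x Ux|]; first by have [] := is_derive_rsqrt (f0 x Ux) (fd x Ux).
have Cr := IH (CkW Cf).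
apply: (Ck_ext oU) (Ck_mul oU (Ck_mul oU (Ck_cst k U (- 2^-1)) fD)
  (Ck_mul oU Cr (Ck_mul oU Cr Cr))) => x Ux.
by have [_ ->] := is_derive_rsqrt (f0 x Ux) (fd x Ux).
Qed.

Lemma Ck_sqrt k U f : open U -> (forall x, U x -> 0 < f x) -> Ck k U f ->
  Ck k U (fun x => Num.sqrt (f x)).
Proof.
move=> oU f0 Cf; apply: (Ck_ext oU) (Ck_mul oU Cf (Ck_rsqrt oU f0 Cf)) => x Ux.
have sx0 : Num.sqrt (f x) != 0 by rewrite sqrtr_eq0 -ltNge f0.
by rewrite -{1}(sqr_sqrtr (ltW (f0 x Ux))) expr2 mulfK.
Qed.

End SmoothCalculus.

(** * Twisted sign actions *)

Section WeylInverse.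
Context {R : realType} {g : splitSemisimple R}.
Local Notation n := (rank g).
Implicit Types (x y z : cartanT g) (u v w : weyl g).
Context {xo : cartanT g} (xo0 : open_dominant xo).

Definition weylV w : weyl g := wrd (rev (projT1 (cid (weyl_word w)))).

Lemma weylVM w : weylM (weylV w) w = weyl1 g.
Proof. by rewrite /weylV; case: cid => s /= ->; exact: (wrd_revl xo0). Qed.

Lemma weylMV w : weylM w (weylV w) = weyl1 g.
Proof. by rewrite /weylV; case: cid => s /= ->; exact: (wrd_revr xo0). Qed.

Lemma weylK w x : weyl_fun (weylV w) (weyl_fun w x) = x.
Proof. by rewrite -weylME weylVM weyl1E. Qed.

Lemma weylVK w x : weyl_fun w (weyl_fun (weylV w) x) = x.
Proof. by rewrite -weylME weylMV weyl1E. Qed.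

Lemma weylM_inv u v : weylM u v = weyl1 g -> weylV u = v.
Proof. by move=> uv; rewrite -[LHS]weylM1 -uv weylMA weylVM weyl1M. Qed.

Lemma weylVMM u v : weylV (weylM u v) = weylM (weylV v) (weylV u).
Proof.
by apply: weylM_inv; rewrite -weylMA (weylMA v) weylMV weyl1M weylMV.
Qed.

Lemma weylV_s i : weylV (weyl_s i) = weyl_s i.
Proof. by apply: weylM_inv; exact: (weyl_ss xo0). Qed.

Lemma weylV_wrd s : weylV (wrd s) = wrd (rev s) :> weyl g.
Proof. by apply: weylM_inv; exact: (wrd_revr xo0). Qed.

Lemma weylVV w : weylV (weylV w) = w.
Proof. by apply: weylM_inv; exact: weylVM. Qed.

End WeylInverse.

Section SignAction.
Context {R : realType} {g : splitSemisimple R}.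
Local Notation n := (rank g).
Context {s : 'I_n -> 'I_n -> bool} {act : weyl g -> signs g -> signs g}.
Context (tw : twisted_sign_action s act).

Lemma exprz_sign (z : int) : (-1 : int) ^ z = (-1) ^+ odd `|z|%N.
Proof.
case: z => m; first exact/esym/signr_odd.
rewrite -[X in odd X]/(m.+1) signr_odd NegzE -exprz_inv invrN1.
by [].
Qed.

Lemma twisted_act_s : exists par : 'I_n -> 'I_n -> bool,
  forall i e j, act (weyl_s i) e j = e j (+) (e i && par j i).
Proof.
have [_ [a [_ _ aE _]]] := tw.
exists (fun i j => odd `|a i j|%N) => i e j.
have := aE i e j; rewrite /sgnz; case: (e i) => /=; last first.
  by rewrite expr0 exp1rz mulr1 addbF => /signr_inj.
by rewrite expr1 exprz_sign -signr_addb => /signr_inj.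
Qed.

Lemma act1 e : act (weyl1 g) e = e.
Proof. by have [[]] := tw. Qed.

Lemma actM u v e : act (weylM u v) e = act u (act v e).
Proof. by have [[]] := tw. Qed.

(** A reflection [s_i] reads the sign of index [i] only, so the difference of
    two sign vectors agreeing on [J] is invariant under the parabolic subgroup
    generated by [J]. *)
Lemma act_diff (J : {set 'I_n}) (r : seq 'I_n) (e e' : signs g) : {subset r <= J} ->
  (forall j, j \in J -> e j = e' j) -> forall k,
  act (wrd r) e k (+) act (wrd r) e' k = e k (+) e' k.
Proof.
have [p pE] := twisted_act_s.
move=> + ee; elim: r => [|i r IH] rJ k; first by rewrite !act1.
have rJ' : {subset r <= J} by move=> l lr; apply: rJ; rewrite in_cons lr orbT.
have iJ : i \in J by apply: rJ; rewrite mem_head.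
rewrite /= !actM !pE -(IH rJ' k).
have -> : act (wrd r) e i = act (wrd r) e' i.
  by apply/eqP; rewrite -negb_add (IH rJ' i) ee// addbb.
by rewrite addbACA addbb addbF.
Qed.

End SignAction.

(** * The glued space *)

Section Gluing.
Context {R : realType} {g : splitSemisimple R}.
Local Notation n := (rank g).
Implicit Types (x y z : cartanT g) (u v w : weyl g) (i j k : 'I_n).
Context {s : 'I_n -> 'I_n -> bool} {act : weyl g -> signs g -> signs g}.
Context {xo : cartanT g} (xo0 : open_dominant xo).
Context (tw : twisted_sign_action s act).
Local Notation Mt := (Mtilde xo).
Local Notation M := (Mdelta xo act).
Implicit Types (p q : Mt).

Definition sign_of p : signs g := (projT1 p).1.
Definition chamber_of p : weyl g := (projT1 p).2.
Definition point_of p : cartanT g := \val (projT2 p).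
Definition base_of p : cartanT g := weyl_fun (weylV (chamber_of p)) (point_of p).

Definition glued (e : signs g) w y (hy : cell1 xo y) : Mt :=
  @mpoint R g xo e w (SigSub (mem_set (ex_intro2 _ _ y hy erefl : cell xo w (weyl_fun w y)))).

Lemma point_glued e w y hy : point_of (@glued e w y hy) = weyl_fun w y.
Proof. by []. Qed.

Lemma base_glued e w y hy : base_of (@glued e w y hy) = y.
Proof. exact: (weylK xo0). Qed.

Lemma pointE p : point_of p = weyl_fun (chamber_of p) (base_of p).
Proof. by rewrite (weylVK xo0). Qed.

Lemma base_cell1 p : cell1 xo (base_of p).
Proof.
case: p => -[e w] x; rewrite /base_of /point_of/=.
by have [y y1 <-] := set_valP x; rewrite (weylK xo0).
Qed.

Lemma Mtilde_ext p q : sign_of p = sign_of q -> chamber_of p = chamber_of q ->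
  point_of p = point_of q -> p = q.
Proof.
case: p q => -[e w] x [[e' w'] x']; rewrite /sign_of /chamber_of /point_of /=.
by move=> -> ww; move: ww x x' => -> x x' /val_inj ->.
Qed.

(** An elementary gluing, free of the dependent type of points: in terms of the
    base point, which gluing preserves, it is visibly symmetric. *)
Definition step p q :=
  (exists i, [/\ alpha i (base_of p) = 0, sign_of q = act (weyl_s i) (sign_of p),
     chamber_of q = weylM (chamber_of p) (weyl_s i) & point_of q = point_of p]) \/
  (exists i, [/\ fund_weight i (base_of p) = fund_weight i xo, sign_of q = flip i (sign_of p),
     chamber_of q = chamber_of p & point_of q = point_of p]).

Lemma stepP p q : Mglue act p q <-> step p q.
Proof.
split=> [|[[i [ai sE cE pE]]|[i [oi sE cE pE]]]].
- case=> [i e w x y [z [z1 z0] zx] xy|i e w x [z [z1 z0] zx]].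
    by left; exists i; split => //; rewrite /base_of/point_of/= -zx (weylK xo0).
  by right; exists i; split => //; rewrite /base_of/point_of/= -zx (weylK xo0).
- case: p q ai sE cE pE => -[e w] x [[e' w'] x'].
  rewrite /sign_of /chamber_of /point_of /= => ai -> cE; move: cE x' => -> x' pE.
  apply: (@Mglue_in _ _ _ _ i e w x x') => //.
  exists (base_of (existT _ (e, w) x : Mt)); last exact/esym/(pointE (existT _ (e, w) x : Mt)).
  by split => //; exact: base_cell1.
- case: p q oi sE cE pE => -[e w] x [[e' w'] x'].
  rewrite /sign_of /chamber_of /point_of /= => oi -> cE; move: cE x' => -> x' /val_inj ->.
  apply: (@Mglue_out _ _ _ _ i e w x) => //.
  exists (base_of (existT _ (e, w) x : Mt)); last exact/esym/(pointE (existT _ (e, w) x : Mt)).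
  by split => //; exact: base_cell1.
Qed.

Lemma step_point p q : step p q -> point_of q = point_of p.
Proof. by case=> -[i []]. Qed.

Lemma step_base p q : step p q -> base_of q = base_of p.
Proof.
case=> -[i [ai _ cE pE]]; rewrite /base_of cE pE// (weylVMM xo0) weylME.
by rewrite -/(base_of p) (weylV_s xo0) weyl_sE refl_id.
Qed.

Lemma flipK i : involutive (@flip R g i).
Proof. by move=> e; apply/ffunP => j; rewrite !ffunE -addbA addbb addbF. Qed.

Lemma step_sym p q : step p q -> step q p.
Proof.
move=> pq; have bE := step_base pq; case: pq => -[i [ai sE cE pE]]; [left|right]; exists i.
  rewrite bE sE cE pE; split => //; last by rewrite -weylMA (weyl_ss xo0) weylM1.
  by rewrite -(actM tw) (weyl_ss xo0) (act1 tw).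
by rewrite bE sE cE pE flipK.
Qed.

Lemma pi_step p q : step p q -> Mdelta_pi act p = Mdelta_pi act q.
Proof.
move=> /stepP pq; apply/eqmodP/asboolP; exact: rst_step.
Qed.

(** An elementary gluing is undone by another one, so a property need only be
    preserved in one direction to pass to the equivalence relation they generate. *)
Lemma pi_ind (P : Mt -> Prop) p q : (forall a b, step a b -> P a -> P b) ->
  Mdelta_pi act p = Mdelta_pi act q -> P p -> P q.
Proof.
move=> Pstep /eqmodP/asboolP pq.
suff : P p <-> P q by case.
elim: pq => {p q} [p q /stepP pq|p|p q _ [H1 H2]|p q r _ [H1 H2] _ [H3 H4]].
- by split; apply: Pstep => //; exact: step_sym.
- by [].
- by split.
- by split=> [/H1/H3|/H4/H2].
Qed.

Lemma pi_point p q : Mdelta_pi act p = Mdelta_pi act q -> point_of p = point_of q.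
Proof.
move=> pq; apply: (pi_ind (P := fun q => point_of p = point_of q)) pq _ => //.
by move=> a b /step_point ->.
Qed.

Lemma pi_base p q : Mdelta_pi act p = Mdelta_pi act q -> base_of p = base_of q.
Proof.
move=> pq; apply: (pi_ind (P := fun q => base_of p = base_of q)) pq _ => //.
by move=> a b /step_base ->.
Qed.

End Gluing.

(** * Stars and their coordinates *)

Section Stars.
Context {R : realType} {g : splitSemisimple R}.
Local Notation n := (rank g).
Implicit Types (x y z : cartanT g) (u v w : weyl g) (i j k : 'I_n) (J K S : {set 'I_n}).
Context {s : 'I_n -> 'I_n -> bool} {act : weyl g -> signs g -> signs g}.
Context {xo : cartanT g} (xo0 : open_dominant xo).
Context (tw : twisted_sign_action s act).
Local Notation Mt := (Mtilde xo).
Local Notation M := (Mdelta xo act).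
Local Notation pi := (@Mdelta_pi R g xo act).
Implicit Types (p q : Mt) (e : signs g).

Definition parabolic J u := exists2 r : seq 'I_n, {subset r <= J} & u = wrd r.

Lemma parabolic1 J : parabolic J (weyl1 g).
Proof. by exists [::]. Qed.

Lemma parabolic_s J i : i \in J -> parabolic J (weyl_s i).
Proof. by move=> iJ; exists [:: i]; rewrite ?wrd1// => j; rewrite inE => /eqP ->. Qed.

Lemma parabolicM J u v : parabolic J u -> parabolic J v -> parabolic J (weylM u v).
Proof.
move=> [r rJ ->] [r' rJ' ->]; exists (r ++ r'); last by rewrite wrd_cat.
by move=> i; rewrite mem_cat => /orP[/rJ|/rJ'].
Qed.

Lemma parabolicV J u : parabolic J u -> parabolic J (weylV u).
Proof.
move=> [r rJ ->]; exists (rev r); last exact: (weylV_wrd xo0).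
by move=> i; rewrite mem_rev => /rJ.
Qed.

(** The signs of the centre [e0], transported from its chamber [w0] to [w]. *)
Definition transport w0 e0 w : signs g := act (weylM (weylV w) w0) e0.

Lemma transport_mul w0 e0 w u : transport w0 e0 (weylM w u) = act (weylV u) (transport w0 e0 w).
Proof. by rewrite /transport (weylVMM xo0) -weylMA (actM tw). Qed.

Lemma transport_id w0 e0 : transport w0 e0 w0 = e0.
Proof. by rewrite /transport (weylVM xo0) (act1 tw). Qed.

(** The star of a cell: [J] collects the internal and [K] the external walls
    that may be crossed, starting from the chamber [w0] with signs [e0]. *)
Definition star e0 w0 J K p := 
  [/\ forall i, i \notin J -> 0 < alpha i (base_of p),
      forall i, i \notin K -> fund_weight i (base_of p) < fund_weight i xo :> R,
      exists2 u, parabolic J u & chamber_of p = weylM w0 u &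
      forall i, i \notin K -> sign_of p i = transport w0 e0 (chamber_of p) i].

(** Reflecting in the external walls is undone by taking the signed square root
    of the distance to the wall. The square makes changes of coordinates smooth
    across the wall, where they depend on the distance itself. *)
Definition star_coord e0 w0 K p : 'rV[R]_n := \row_i
  (if i \in K then (-1) ^+ (sign_of p i (+) transport w0 e0 (chamber_of p) i) *
     Num.sqrt (fund_weight i xo - fund_weight i (weyl_fun (weylV w0) (point_of p)))
   else fund_weight i (weyl_fun (weylV w0) (point_of p))).

Definition coord_point K (t : 'rV[R]_n) : cartanT g :=
  \sum_i (if i \in K then (fund_weight i xo : R) - t 0 i ^+ 2 else t 0 i) *: coroot i.

Lemma fund_weight_coord_point K t i : fund_weight i (coord_point K t) =
  (if i \in K then (fund_weight i xo : R) - t 0 i ^+ 2 else t 0 i) :> R.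
Proof. exact: (fund_weight_comb xo0). Qed.

Section Star.
Context (e0 : signs g) (w0 : weyl g) (J K : {set 'I_n}) (JK : forall j, j \in J -> j \notin K).

Lemma star_step p q : @step R g act xo p q -> star e0 w0 J K p -> star e0 w0 J K q.
Proof.
have [par parE] := twisted_act_s tw.
move=> pq [aJ oK [u uJ cu] sK]; have bE := step_base xo0 pq.
split; rewrite ?bE//; case: pq => -[i [ai sE cE _]].
- have iJ : i \in J by apply: contraT => /aJ; rewrite ai ltxx.
  exists (weylM u (weyl_s i)); first by apply: parabolicM => //; exact: parabolic_s.
  by rewrite cE cu weylMA.
- by exists u => //; rewrite cE.
- have iJ : i \in J by apply: contraT => /aJ; rewrite ai ltxx.
  move=> k kK; rewrite cE transport_mul (weylV_s xo0) sE !parE.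
  by rewrite !sK// JK.
- move=> k kK; rewrite cE sE ffunE -sK//.
  have -> : (k == i) = false by apply/negP => /eqP ki; have := oK k kK; rewrite ki ai ltxx.
  by rewrite addbF.
Qed.

Lemma star_pi p q : pi p = pi q -> star e0 w0 J K p -> star e0 w0 J K q.
Proof. by apply: (pi_ind xo0 tw) => a b; exact: star_step. Qed.

Lemma star_point p : star e0 w0 J K p -> exists2 u, parabolic J u &
  weyl_fun (weylV w0) (point_of p) = weyl_fun u (base_of p).
Proof.
move=> [_ _ [u uJ cu] _]; exists u => //.
by rewrite (pointE xo0) cu weylME (weylK xo0).
Qed.

Lemma star_weight p k : star e0 w0 J K p -> k \notin J ->
  fund_weight k (weyl_fun (weylV w0) (point_of p)) = fund_weight k (base_of p) :> R.
Proof.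
move=> /star_point[u [r rJ ->] ->] kJ; exact: fund_weight_wrd_id rJ kJ.
Qed.

Lemma base_weight_le p k : fund_weight k (base_of p) <= fund_weight k xo :> R.
Proof. by have /(cell1P xo0)[_] := base_cell1 xo0 p. Qed.

Lemma base_dominant p : dominant (base_of p).
Proof. by have /(cell1P xo0)[] := base_cell1 xo0 p. Qed.

Lemma star_coord_step p q : star e0 w0 J K p -> @step R g act xo p q ->
  star_coord e0 w0 K q = star_coord e0 w0 K p.
Proof.
have [par parE] := twisted_act_s tw.
move=> sp pq; have [aJ oK _ sK] := sp; have xE := step_point pq.
apply/rowP => k; rewrite !mxE xE; case: ifP => // kK; case: pq => -[i [ai sE cE _]].
  have iJ : i \in J by apply: contraT => /aJ; rewrite ai ltxx.
  rewrite cE transport_mul (weylV_s xo0) sE !parE -(sK i (JK iJ)).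
  by rewrite addbACA addbb addbF.
rewrite cE sE ffunE; case: eqVneq => [ki|_]; last by rewrite addbF.
have -> : fund_weight k (weyl_fun (weylV w0) (point_of p)) = fund_weight k xo :> R.
  rewrite (star_weight sp); first by rewrite ki.
  by apply/negP => /JK; rewrite kK.
by rewrite subrr sqrtr0 !mulr0.
Qed.

Lemma star_coord_pi p q : pi p = pi q -> star e0 w0 J K p ->
  star_coord e0 w0 K q = star_coord e0 w0 K p.
Proof.
move=> pq sp.
pose P q := star e0 w0 J K q /\ star_coord e0 w0 K q = star_coord e0 w0 K p.
suff [] : P q by [].
apply: (pi_ind xo0 tw (P := P) _ pq); last by split.
move=> a b ab [sa E]; split; first exact: star_step ab sa.
exact: etrans (star_coord_step sa ab) E.
Qed.

Lemma coord_pointK p : star e0 w0 J K p ->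
  coord_point K (star_coord e0 w0 K p) = weyl_fun (weylV w0) (point_of p).
Proof.
move=> sp; apply: (fund_weight_inj xo0) => i; rewrite fund_weight_coord_point mxE.
case: ifP => iK; rewrite ?iK //.
have iJ := contraTN (@JK i) iK.
rewrite exprMn sqrr_sign mul1r sqr_sqrtr ?subKr//.
by rewrite subr_ge0 (star_weight sp iJ) base_weight_le.
Qed.

End Star.

(** ** Identification of points *)

Lemma glue_signs p q : chamber_of p = chamber_of q -> point_of p = point_of q ->
  (forall k, sign_of p k != sign_of q k ->
     fund_weight k (base_of p) = fund_weight k xo :> R) -> pi p = pi q.
Proof.
move=> cE xE sE.
pose e_ (l : seq 'I_n) : signs g := [ffun k => if k \in l then sign_of q k else sign_of p k].
pose p_ l : Mt := existT _ (e_ l, chamber_of p) (projT2 p).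
have b_ l : base_of (p_ l) = base_of p by [].
suff pl l : pi p = pi (p_ l).
  rewrite (pl (enum 'I_n)); congr pi; apply: Mtilde_ext => //.
  by apply/ffunP => k; rewrite ffunE mem_enum.
elim: l => [|i l IH].
  congr pi; apply: Mtilde_ext => //.
  by apply/ffunP => k; rewrite ffunE.
rewrite IH; have [se|se] := eqVneq (e_ l i) (sign_of q i).
  congr pi; apply: Mtilde_ext => //; apply/ffunP => k; rewrite /sign_of/= !ffunE in_cons.
  by case: eqVneq => //= ->; move: se; rewrite ffunE.
have il : i \notin l by apply: contra se; rewrite ffunE => ->.
have si : sign_of p i != sign_of q i by move: se; rewrite ffunE (negbTE il).
apply: (pi_step (act := act) xo0); right; exists i; split => //; first exact: sE.
apply/ffunP => k; rewrite /sign_of/= !ffunE in_cons.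
case: eqVneq => [->|] /=; last by rewrite addbF.
rewrite (negbTE il); move: si; rewrite /sign_of.
by case: ((projT1 p).1 i); case: ((projT1 q).1 i).
Qed.

Lemma glue_word p (r : seq 'I_n) : (forall j, j \in r -> alpha j (base_of p) = 0) ->
  exists q, [/\ pi q = pi p, chamber_of q = weylM (chamber_of p) (wrd r) &
    point_of q = point_of p].
Proof.
elim: r p => [|i r IH] p rp; first by exists p; rewrite weylM1.
have ai : alpha i (base_of p) = 0 by apply: rp; rewrite mem_head.
have hx : cell xo (weylM (chamber_of p) (weyl_s i)) (point_of p).
  exists (base_of p); first exact: base_cell1.
  by rewrite weylME weyl_sE refl_id// -(pointE xo0).
pose p' : Mt := mpoint (act (weyl_s i) (sign_of p)) (SigSub (mem_set hx)).
have st : @step R g act xo p p' by left; exists i; split.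
have [|q [q1 q2 q3]] := IH p'.
  by move=> j jr; rewrite (step_base xo0 st); apply: rp; rewrite in_cons jr orbT.
exists q; split; rewrite ?q1 ?q2 ?q3//; last by rewrite weylMA.
by rewrite (pi_step xo0 st).
Qed.

(** The base points are dominant and in one orbit, hence equal; the element
    relating the two chambers stabilises them, so it is a product of reflections
    in internal walls through the point. *)
Lemma glue_chamber p q : point_of p = point_of q -> exists q',
  [/\ pi q' = pi q, chamber_of q' = chamber_of p, point_of q' = point_of p &
   base_of q' = base_of p].
Proof.
move=> pq.
have [r rE] := weyl_word (weylM (weylV (chamber_of q)) (chamber_of p)).
have bE : weyl_fun (wrd r) (base_of p) = base_of q.
  by rewrite -rE weylME -(pointE xo0) pq.
have dw : dominant (weyl_fun (wrd r) (base_of p)) by rewrite bE; exact: base_dominant.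
have [r' rr' r'0] := dominant_stabilizer xo0 (base_dominant p) dw.
have bpq : base_of p = base_of q by rewrite -bE (dominant_orbit xo0 (base_dominant p) dw).
have [q' [q1 q2 q3]] : exists q', [/\ pi q' = pi q,
    chamber_of q' = weylM (chamber_of q) (wrd r') & point_of q' = point_of q].
  by apply: glue_word => j /r'0; rewrite bpq.
exists q'; split => //; last by rewrite (pi_base xo0 tw q1).
  by rewrite q2 -rr' -rE weylMA (weylMV xo0) weyl1M.
by rewrite q3.
Qed.

(** The coordinates determine the underlying point and, off the external walls,
    the signs; on an external wall both signs are glued. *)
Lemma star_coord_inj e0 w0 J K p q : (forall j, j \in J -> j \notin K) ->
  star e0 w0 J K p -> star e0 w0 J K q ->
  star_coord e0 w0 K p = star_coord e0 w0 K q -> pi p = pi q.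
Proof.
move=> JK sp sq pq.
have xE : point_of p = point_of q.
  rewrite -(weylVK xo0 w0 (point_of p)) -(weylVK xo0 w0 (point_of q)).
  by rewrite -(coord_pointK JK sp) -(coord_pointK JK sq) pq.
have [q' [q1 q2 q3 q4]] := glue_chamber xE.
have sq' := star_pi JK (esym q1) sq.
rewrite -q1; apply: glue_signs => // k kd.
have kK : k \in K.
  apply: contraNT kd => kK; have [_ _ _ sK] := sp; have [_ _ _ sK'] := sq'.
  by rewrite sK// sK'// q2.
have kJ : k \notin J by apply/negP => /JK; rewrite kK.
have /rowP/(_ k) : star_coord e0 w0 K p = star_coord e0 w0 K q'.
  by rewrite pq (star_coord_pi JK q1).
rewrite !mxE kK q2 q3 => /eqP; rewrite -subr_eq0 -mulrBl mulf_eq0 => /orP[|].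
  rewrite subr_eq0 => /eqP/signr_inj/addIb E; by rewrite E eqxx in kd.
rewrite sqrtr_eq0 subr_le0 (star_weight sp kJ) => le.
by apply/eqP; rewrite eq_le base_weight_le.
Qed.

(** ** Lifting coordinates *)

Section Lift.
Context (e0 : signs g) (w0 : weyl g) (J K : {set 'I_n}) (JK : forall j, j \in J -> j \notin K).

Definition lift_sign u S : signs g := [ffun i => act (weylV u) e0 i (+) (i \in S)].

Definition lift u S t (hy : cell1 xo (weyl_fun (weylV u) (coord_point K t))) : Mt :=
  glued (lift_sign u S) (weylM w0 u) hy.

Lemma base_lift u S t hy : base_of (@lift u S t hy) = weyl_fun (weylV u) (coord_point K t).
Proof. exact: (base_glued xo0). Qed.

Lemma point_lift u S t hy : point_of (@lift u S t hy) = weyl_fun w0 (coord_point K t).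
Proof. by rewrite /lift point_glued weylME (weylVK xo0). Qed.

Definition sign_region S (t : 'rV[R]_n) := forall k, k \in K ->
  if k \in S then t 0 k <= 0 else 0 <= t 0 k.

Definition open_region (t : 'rV[R]_n) := forall u, parabolic J u ->
  (forall i, i \notin J -> 0 < alpha i (weyl_fun u (coord_point K t))) /\
  (forall i, i \notin K -> fund_weight i (weyl_fun u (coord_point K t)) < fund_weight i xo :> R).

Lemma star_lift u S t hy : S \subset K -> parabolic J u -> open_region t ->
  star e0 w0 J K (@lift u S t hy).
Proof.
move=> SK uJ tV; have [tJ tK] := tV _ (parabolicV uJ).
split; rewrite ?base_lift//; first by exists u.
move=> i iK; rewrite /sign_of/= ffunE transport_mul transport_id.
by rewrite (negbTE (contra (fintype.subsetP SK i) iK)) addbF.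
Qed.

Lemma star_coord_lift u S t hy : S \subset K -> sign_region S t ->
  star_coord e0 w0 K (@lift u S t hy) = t.
Proof.
move=> SK St; apply/rowP => k; rewrite mxE point_lift (weylK xo0).
rewrite fund_weight_coord_point; case: ifP => kK; rewrite ?kK //.
rewrite /sign_of/= ffunE transport_mul transport_id addbAC addbb addFb.
rewrite subKr sqrtr_sqr; have := St k kK.
by case: ifP => _ tk; [rewrite ler0_norm// expr1 mulN1r opprK|rewrite ger0_norm// expr0 mul1r].
Qed.

Definition neg_part (t : 'rV[R]_n) : {set 'I_n} := [set k in K | t 0 k < 0].

Lemma neg_part_sub t : neg_part t \subset K.
Proof. by apply/fintype.subsetP => k; rewrite inE => /andP[]. Qed.

Lemma sign_region_neg_part t : sign_region (neg_part t) t.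
Proof. by move=> k kK; rewrite inE kK/=; case: ltP => // /ltW. Qed.

(** The image of the coordinates is cut out by strict inequalities. The orbit of a
    dominant point under the parabolic subgroup of [J] moves up along [alpha i]
    for [i] outside [J] and down along the fundamental weights, so that they hold
    on the whole orbit once they hold at the dominant point. *)
Lemma star_coord_image t :
  (exists2 p, star e0 w0 J K p & star_coord e0 w0 K p = t) <-> open_region t.
Proof.
split=> [[p sp <-] v [r rJ ->]|tV].
  rewrite (coord_pointK JK sp).
  have [u [r' r'J ->] ->] := star_point sp.
  have [aJ oK _ _] := sp.
  rewrite -weylME -wrd_cat; have rrJ : {subset r ++ r' <= J}.
    by move=> i; rewrite mem_cat => /orP[/rJ|/r'J].
  have dJ : dominant_on J (base_of p) by move=> j _; exact: base_dominant.
  split=> i iN.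
    by apply: lt_le_trans (aJ i iN) _; exact: alpha_wrd_ge rrJ dJ iN.
  by apply: le_lt_trans (oK i iN); exact: fund_weight_wrd_le rrJ dJ.
have [r rJ dJ] := dominant_representative xo0 J (coord_point K t).
have pr : parabolic J (wrd r) by exists r.
have [tJ tK] := tV _ pr.
have hy : cell1 xo (weyl_fun (weylV (weylV (wrd r))) (coord_point K t)).
  rewrite (weylVV xo0); apply/(cell1P xo0); split=> i.
    by have [/dJ//|/tJ/ltW] := boolP (i \in J).
  have [iK|/tK/ltW//] := boolP (i \in K).
  rewrite (fund_weight_wrd_id xo0 _ rJ); last by apply/negP => /JK; rewrite iK.
  by rewrite fund_weight_coord_point iK gerBl sqr_ge0.
exists (lift (neg_part t) hy).
  by apply: star_lift => //; [exact: neg_part_sub|exact: parabolicV].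
by apply: star_coord_lift; [exact: neg_part_sub|exact: sign_region_neg_part].
Qed.

(** For each [u] and [S] the lift depends continuously on the coordinates, and its
    domain is closed: these are the pieces from which the inverse is pasted. *)
Lemma star_lift_exists p : star e0 w0 J K p ->
  exists u S, [/\ S \subset K, parabolic J u, sign_region S (star_coord e0 w0 K p) &
    cell1 xo (weyl_fun (weylV u) (coord_point K (star_coord e0 w0 K p)))].
Proof.
move=> sp; have [u uJ xE] := star_point sp.
exists u, (neg_part (star_coord e0 w0 K p)); split => //.
- exact: neg_part_sub.
- exact: sign_region_neg_part.
- by rewrite (coord_pointK JK sp) xE (weylK xo0); exact: base_cell1.
Qed.

End Lift.

End Stars.

(** * Charts *)

Section Charts.
Context {R : realType} {g : splitSemisimple R}.
Local Notation n := (rank g).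
Implicit Types (x y z : cartanT g) (u v w : weyl g) (i j k : 'I_n) (J K S : {set 'I_n}).
Context {s : 'I_n -> 'I_n -> bool} {act : weyl g -> signs g -> signs g}.
Context {xo : cartanT g} (xo0 : open_dominant xo).
Context (tw : twisted_sign_action s act).
Local Notation Mt := (Mtilde xo).
Local Notation M := (Mdelta xo act).
Local Notation pi := (@Mdelta_pi R g xo act).
Local Notation open_region := (@open_region R g xo).
Local Notation coord_point := (@coord_point R g xo).
Local Notation star := (@star R g act xo).
Local Notation star_coord := (@star_coord R g act xo).
Implicit Types (p : Mt) (q : M) (e : signs g) (t : 'rV[R]_n).

Definition rep q : Mt := repr q.

Lemma repK q : pi (rep q) = q.
Proof. exact: reprK. Qed.

Lemma open_pi (A : set M) : open (pi @^-1` A) -> open A.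
Proof. by []. Qed.

Lemma continuous_pi : continuous pi.
Proof. exact: pi_continuous. Qed.

Lemma continuous_val w : continuous (fun x : set_type (cell xo w) => \val x : cartanT g).
Proof. exact: initial_continuous. Qed.

Lemma open_fibres (A : set Mt) :
  (forall e w, open [set x : set_type (cell xo w) | A (mpoint e x)]) -> open A.
Proof. by move=> oA; apply/sigT_openP => -[e w]; exact: oA. Qed.

Lemma open_imply (T : topologicalType) (b : Prop) (A : set T) :
  open A -> open [set x | b -> A x].
Proof.
move=> oA; have [hb|nb] := pselect b.
  by have -> : [set x | b -> A x] = A by apply/seteqP; split => x; [move=> /(_ hb)|move=> ? _].
have -> : [set x | b -> A x] = setT by apply/seteqP; split => // x _ /nb.
exact: openT.
Qed.

Section Chart.
Context (e0 : signs g) (w0 : weyl g) (J K : {set 'I_n}) (JK : forall j, j \in J -> j \notin K).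

Definition star_dom : set M := [set q | star e0 w0 J K (rep q)].

Definition star_map q : 'rV[R]_n := star_coord e0 w0 K (rep q).

Lemma star_dom_pi p : star_dom (pi p) <-> star e0 w0 J K p.
Proof.
have E : pi (rep (pi p)) = pi p by rewrite repK.
by split; [exact: (star_pi xo0 tw JK E)|exact: (star_pi xo0 tw JK (esym E))].
Qed.

Lemma star_map_pi p : star e0 w0 J K p -> star_map (pi p) = star_coord e0 w0 K p.
Proof. by move=> sp; apply: (star_coord_pi xo0 tw JK) sp; rewrite repK. Qed.

Lemma continuous_fibre_weight i w w' :
  continuous (fun x : set_type (cell xo w) => fund_weight i (weyl_fun w' (\val x)) : R).
Proof.
have H := continuous_compT (continuous_weyl xo0 (w := w')) (@continuous_fund_weight R g i).
exact (continuous_compT (continuous_val (w := w)) H).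
Qed.

Lemma continuous_fibre_alpha i w w' :
  continuous (fun x : set_type (cell xo w) => alpha i (weyl_fun w' (\val x))).
Proof.
have H := continuous_compT (continuous_weyl xo0 (w := w')) (@continuous_alpha R g i).
exact (continuous_compT (continuous_val (w := w)) H).
Qed.

Lemma continuous_star_coord e w :
  continuous (fun x : set_type (cell xo w) => star_coord e0 w0 K (mpoint e x)).
Proof.
apply: continuous_rV => k; under eq_fun do rewrite mxE.
case: (k \in K); last exact: continuous_fibre_weight.
apply: continuous_mulR.
  exact: (@continuous_cstR _ _ ((-1) ^+ (e k (+) @transport R g act w0 e0 w k))).
apply: (@continuous_compT _ _ _ (fun x : set_type (cell xo w) =>
  fund_weight k xo - fund_weight k (weyl_fun (weylV w0) (\val x)))); last exact: sqrt_continuous.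
apply: continuous_subR; first exact: continuous_cstR.
exact: continuous_fibre_weight.
Qed.

Lemma star_coord_open (O : set 'rV[R]_n) : open O ->
  open [set p | star e0 w0 J K p /\ O (star_coord e0 w0 K p)].
Proof.
move=> oO; apply: open_fibres => e w.
have [[u uJ ew]|nu] := pselect (exists2 u, parabolic J u &
    w = weylM w0 u /\ forall i, i \notin K -> e i = @transport R g act w0 e0 w i); last first.
  rewrite (_ : mkset _ = set0); first exact: open0.
  apply/seteqP; split => // x [[_ _ [u uJ cu] sK] _].
  by apply: nu; exists u.
have -> : [set x : set_type (cell xo w) | star e0 w0 J K (mpoint e x) /\
      O (star_coord e0 w0 K (mpoint e x))] =
    [set x | forall i, i \notin J -> 0 < alpha i (weyl_fun (weylV w) (\val x))] `&`
    [set x | forall i, i \notin K ->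
      fund_weight i (weyl_fun (weylV w) (\val x)) < fund_weight i xo :> R] `&`
    [set x | O (star_coord e0 w0 K (mpoint e x))].
  apply/seteqP; split=> [x [[aJ oK _ _] Ox]|x [[aJ oK] Ox]] //.
  by split => //; split => //; [exists u => //; exact: ew.1|exact: ew.2].
apply: openI; last first.
  by move/continuousP: (continuous_star_coord (e := e) (w := w)) => /(_ O oO).
apply: openI; apply: open_forall => i; apply: open_imply.
  by apply: open_gt_fun; exact: continuous_fibre_alpha.
by apply: open_lt_fun; exact: continuous_fibre_weight.
Qed.

Lemma star_map_open (O : set 'rV[R]_n) : open O -> open (star_dom `&` star_map @^-1` O).
Proof.
move=> oO; apply: open_pi.
have -> : pi @^-1` (star_dom `&` star_map @^-1` O) =
    [set p | star e0 w0 J K p /\ O (star_coord e0 w0 K p)].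
  apply/seteqP; split=> [p [/star_dom_pi sp]|p [sp Op]].
    by rewrite /= star_map_pi.
  by split; [exact/star_dom_pi|rewrite /= star_map_pi].
exact: star_coord_open.
Qed.

Lemma star_dom_open : open star_dom.
Proof. by have := star_map_open openT; rewrite preimage_setT setIT. Qed.

Lemma star_map_inj q q' : star_dom q -> star_dom q' -> star_map q = star_map q' -> q = q'.
Proof.
move=> sq sq' E; rewrite -(repK q) -(repK q').
exact: (star_coord_inj xo0 tw JK sq sq' E).
Qed.

Lemma star_map_image : star_map @` star_dom = open_region J K.
Proof.
apply/seteqP; split=> [_ [q sq <-]|t /(star_coord_image xo0 tw e0 w0 JK)[p sp <-]].
  by apply/(star_coord_image xo0 tw e0 w0 JK); exists (rep q).
by exists (pi p); [exact/star_dom_pi|exact: star_map_pi].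
Qed.

Lemma continuous_coord_point : continuous (coord_point K).
Proof.
apply: (continuous_cartan xo0) => i; under eq_fun do rewrite (fund_weight_coord_point xo0).
have cc : continuous (fun t : 'rV[R]_n => t 0 i : R) by exact: coord_continuous.
case: (i \in K) => //; apply: continuous_subR; first exact: continuous_cstR.
exact: continuous_mulR.
Qed.

Lemma star_image_open : open (star_map @` star_dom).
Proof.
rewrite star_map_image; have [r rP] := weyl_finite xo0.
have -> : open_region J K = [set t | forall l : 'I_(size r),
    parabolic J (tnth (in_tuple r) l) ->
    (forall i, i \notin J -> 0 < alpha i (weyl_fun (tnth (in_tuple r) l) (coord_point K t))) /\
    (forall i, i \notin K -> fund_weight i (weyl_fun (tnth (in_tuple r) l) (coord_point K t))
       < fund_weight i xo :> R)].
  apply/seteqP; split=> [t tV l|t tV u uJ]; first exact: tV.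
  have /tnthP[l ul] : u \in in_tuple r by exact: rP.
  by rewrite ul; apply: tV; rewrite -ul.
have cu u : continuous (fun t => weyl_fun u (coord_point K t)).
  exact: continuous_compT continuous_coord_point (continuous_weyl xo0 (w := u)).
apply: open_forall => l; apply: open_imply; apply: openI; apply: open_forall => i;
  apply: open_imply.
  apply: open_gt_fun; exact: continuous_compT (cu _) (@continuous_alpha R g i).
apply: open_lt_fun; exact: continuous_compT (cu _) (@continuous_fund_weight R g i).
Qed.

Lemma cell1_xo : cell1 xo xo.
Proof. by apply/(cell1P xo0); split => // i; apply: ltW; exact: xo0. Qed.

Definition star_inv t : M :=
  xget (pi (glued e0 w0 cell1_xo)) [set q | star_dom q /\ star_map q = t].

Lemma star_mapK q : star_dom q -> star_inv (star_map q) = q.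
Proof.
move=> sq; have [sq' E] := @xgetPex _ (pi (glued e0 w0 cell1_xo))
  [set q' | star_dom q' /\ star_map q' = star_map q] (ex_intro _ q (conj sq erefl)).
exact: star_map_inj.
Qed.

Lemma star_inv_coord p : star e0 w0 J K p -> star_inv (star_coord e0 w0 K p) = pi p.
Proof.
move=> sp; rewrite -(star_map_pi sp); apply: star_mapK; exact/star_dom_pi.
Qed.

Lemma star_map_continuous q : star_dom q -> {for q, continuous star_map}.
Proof.
move=> sq B /=; rewrite nbhs_simpl/= nbhsE => -[ O [oO Oq] OB].
apply: filterS (open_nbhs_nbhs (conj (star_map_open oO) (conj sq Oq))).
by move=> q' [_ /OB].
Qed.

Lemma closed_sign_region S : closed [set t | @sign_region R g K S t].
Proof.
apply: closed_forall => k.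
have [kK|kK] := boolP (k \in K); last first.
  rewrite (_ : mkset _ = setT); first exact: closedT.
  by apply/seteqP; split.
have cc : continuous (fun t : 'rV[R]_n => t 0 k : R) by exact: coord_continuous.
rewrite (_ : mkset _ = [set t : 'rV[R]_n | if k \in S then t 0 k <= 0 else 0 <= t 0 k]); last first.
  by apply/seteqP; split=> t /=; [move=> /(_ isT)|move=> ? _].
by case: (k \in S); [exact: closed_le_fun|exact: closed_ge_fun].
Qed.

(** The inverse is continuous because it is pasted from the lifts, which are
    continuous on finitely many closed pieces covering the image. *)
Lemma star_inv_continuous t0 : (star_map @` star_dom) t0 -> {for t0, continuous star_inv}.
Proof.
rewrite star_map_image => t0V B /=; rewrite nbhs_simpl/= nbhsE => -[ O [oO Ot0] OB].
have [r rP] := weyl_finite xo0.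
pose Q u t := weyl_fun (weylV u) (coord_point K t).
have cQ u : continuous (Q u).
  exact: continuous_compT continuous_coord_point (continuous_weyl xo0 (w := weylV u)).
have key u S : \forall t \near t0, S \subset K -> parabolic J u -> open_region J K t ->
    sign_region K S t -> cell1 xo (Q u t) -> O (star_inv t).
  have [[SK uJ]|nSu] := pselect (S \subset K /\ parabolic J u); last first.
    by apply: filterE => t SK uJ; exfalso; apply: nSu.
  have [[St0 c0]|nt0] := pselect (sign_region K S t0 /\ cell1 xo (Q u t0)).
    have invE t (hy : cell1 xo (Q u t)) : open_region J K t -> sign_region K S t ->
        star_inv t = pi (lift (act := act) e0 w0 S hy).
      move=> tV St; have sl : star e0 w0 J K (lift (act := act) e0 w0 S hy).
        exact: (star_lift xo0 tw).
      by rewrite -(star_inv_coord sl) (star_coord_lift xo0 tw).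
    pose w := weylM w0 u; pose e := lift_sign (act := act) e0 u S.
    have oA : open [set x : set_type (cell xo w) | O (pi (mpoint e x))].
      have oO' : open (pi @^-1` O) by move/continuousP: continuous_pi => /(_ O oO).
      by have /sigT_openP/(_ (e, w)) := oO'.
    have [B' oB' B'E] := oA.
    have memB t (hy : cell1 xo (Q u t)) :
        B' (weyl_fun w (Q u t)) <-> O (pi (lift (act := act) e0 w0 S hy)).
      pose x : set_type (cell xo w) :=
        SigSub (mem_set (ex_intro2 _ _ _ hy erefl : cell xo w (weyl_fun w (Q u t)))).
      have xE : B' (\val x) = O (pi (mpoint e x)) := congr1 (fun A => A x) B'E.
      by split=> H; [rewrite xE in H|rewrite /= -/x -xE in H].
    have B0 : B' (weyl_fun w (Q u t0)).
      by apply/(memB t0 c0); rewrite -invE.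
    have cw : continuous (fun t => weyl_fun w (Q u t)).
      exact: continuous_compT (cQ u) (continuous_weyl xo0 (w := w)).
    have Bn : \forall t \near t0, B' (weyl_fun w (Q u t)).
      by apply: (cw t0); exact: open_nbhs_nbhs.
    apply: filterS Bn => t Bt _ _ tV St hy.
    by rewrite (invE t hy)//; exact/memB.
  have c1 : closed [set t | cell1 xo (Q u t)].
    have -> : [set t | cell1 xo (Q u t)] = [set t | forall i, 0 <= alpha i (Q u t)] `&`
        [set t | forall i, fund_weight i (Q u t) <= fund_weight i xo :> R].
      by apply/seteqP; split=> t /(cell1P xo0).
    apply: closedI; apply: closed_forall => i.
      apply: closed_ge_fun; exact: continuous_compT (cQ u) (@continuous_alpha R g i).
    apply: closed_le_fun; exact: continuous_compT (cQ u) (@continuous_fund_weight R g i).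
  have cl : closed [set t | sign_region K S t /\ cell1 xo (Q u t)].
    by apply: closedI; [exact: closed_sign_region|exact: c1].
  have : nbhs t0 (~` [set t | sign_region K S t /\ cell1 xo (Q u t)]).
    by apply: open_nbhs_nbhs; split => //; exact: closed_openC.
  by apply: filterS => t nt _ _ _ St hy; exfalso; apply: nt.
have nV : nbhs t0 (open_region J K).
  by apply: open_nbhs_nbhs; split => //; rewrite -star_map_image; exact: star_image_open.
pose P (lS : 'I_(size r) * {set 'I_n}) t :=
  lS.2 \subset K -> parabolic J (tnth (in_tuple r) lS.1) -> open_region J K t ->
  sign_region K lS.2 t -> cell1 xo (Q (tnth (in_tuple r) lS.1) t) -> O (star_inv t).
have H : \forall t \near t0, forall lS, P lS t.
  by apply: (@filter_forall _ _ P (nbhs t0) (nbhs_filter t0)) => lS; exact: key.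
apply: filterS2 nV H => t tV Ht; apply: OB.
have /(star_coord_image xo0 tw e0 w0 JK)[p sp pt] := tV.
have [u [S [SK uJ]]] := star_lift_exists xo0 JK sp; rewrite pt => St hy.
have /tnthP[l ul] : u \in in_tuple r by exact: rP.
by apply: (Ht (l, S)); rewrite /= -?ul.
Qed.

Definition star_chart : chart R M n :=
  Chart star_dom_open star_image_open star_mapK star_map_continuous star_inv_continuous.

End Chart.
End Charts.

(** * Global topology *)

Section GlobalTopology.
Context {R : realType} {g : splitSemisimple R}.
Local Notation n := (rank g).
Implicit Types (x y z : cartanT g) (u v w : weyl g) (i j k : 'I_n) (J K S : {set 'I_n}).
Context {s : 'I_n -> 'I_n -> bool} {act : weyl g -> signs g -> signs g}.
Context {xo : cartanT g} (xo0 : open_dominant xo).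
Context (tw : twisted_sign_action s act).
Local Notation Mt := (Mtilde xo).
Local Notation M := (Mdelta xo act).
Local Notation pi := (@Mdelta_pi R g xo act).
Local Notation rep := (@rep R g act xo).
Local Notation star := (@star R g act xo).
Local Notation star_dom := (@star_dom R g act xo).
Local Notation star_coord := (@star_coord R g act xo).
Implicit Types (p : Mt) (q : M) (e : signs g) (t : 'rV[R]_n).

Lemma compact_set_type (T : topologicalType) (A : set T) :
  compact A -> compact [set: set_type A].
Proof.
move=> cA F FF _.
have FA : fmap (@set_val T A) F A.
  by apply: (@filterS _ F _ setT) => [x _|]; [exact: set_valP|exact: filterT].
have [y [Ay Fy]] := cA (fmap (@set_val T A) F) _ FA.
exists (SigSub (mem_set Ay)); split => // B U FB /=.
rewrite nbhsE => -[U' [[W oW WU] Uy] U'U].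
have Wy : W y by move: Uy; rewrite -WU.
have [_ [[x Bx <-] Wx]] : ((@set_val T A) @` B) `&` W !=set0.
  apply: Fy; last exact: open_nbhs_nbhs.
  have BS : B `<=` @set_val T A @^-1` (@set_val T A @` B) by move=> x Bx; exists x.
  exact: filterS BS FB.
by exists x; split => //; apply: U'U; rewrite -WU.
Qed.

Lemma Mdelta_compact : compact [set: M].
Proof.
have [r rP] := weyl_finite xo0.
have cMt : compact [set: Mt].
  apply: sigT_compact; last by move=> [e w]; apply: compact_set_type; exact: cell_compact.
  apply/finite_seqP; exists [seq ((e : signs g), w) | e <- enum {ffun 'I_n -> bool}, w <- r].
  apply/seteqP; split => // -[e w] _ /=; apply/allpairsP; exists (e, w) => /=.
  by rewrite rP; split => //; rewrite mem_enum.
have -> : [set: M] = pi @` [set: Mt].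
  by apply/seteqP; split => // q _; exists (rep q) => //; rewrite repK.
apply: continuous_compact => //; apply: continuous_subspaceT; exact: continuous_pi.
Qed.

(** On both walls at once, the diagonal term of [alpha i (xo - y)] would vanish and
    the others would be nonpositive like the Cartan integers off the diagonal,
    against the regularity of [xo]. *)
Lemma walls_disjoint y i : cell1 xo y -> alpha i y = 0 ->
  fund_weight i y != fund_weight i xo :> R.
Proof.
move=> /(cell1P xo0)[yd yx] ai; apply/eqP => wi.
suff : alpha i xo <= 0 by rewrite leNgt xo0.
have -> : alpha i xo = alpha i (xo - y) by rewrite alphaB ai subr0.
rewrite (fund_weightK xo0 (xo - y)) alpha_comb; apply: sumr_le0 => j _.
rewrite fund_weightB; have [->|ji] := eqVneq j i; first by rewrite wi subrr mul0r.
rewrite mulr_ge0_le0 ?subr_ge0//; apply: (alpha_coroot_le0 xo0); by rewrite eq_sym.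
Qed.

Definition in_walls p : {set 'I_n} := [set i | alpha i (base_of p) == 0].
Definition out_walls p : {set 'I_n} :=
  [set i | fund_weight i (base_of p) == fund_weight i xo :> R].

Lemma in_out_walls p j : j \in in_walls p -> j \notin out_walls p.
Proof. by rewrite !inE => /eqP /(walls_disjoint (base_cell1 xo0 p)). Qed.

Lemma star_center p e : (forall i, i \notin out_walls p -> sign_of p i = e i) ->
  star e (chamber_of p) (in_walls p) (out_walls p) p.
Proof.
move=> pe; split.
- by move=> i; rewrite inE => ai; rewrite lt_def ai; exact: (base_dominant xo0).
- by move=> i; rewrite inE => oi; rewrite lt_neqAle oi (base_weight_le xo0).
- by exists (weyl1 g); [exact: parabolic1|rewrite weylM1].
- by move=> i /pe ->; rewrite (transport_id xo0 tw).
Qed.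

(** Both sign vectors are transported to the common point by the same element of
    the parabolic subgroup, which acts in the same way on vectors agreeing on
    [J]. *)
Lemma star_meet_signs e e' w J K p : (forall j, j \in J -> j \notin K) ->
  star e w J K p -> star e' w J K p -> forall i, i \notin K -> e i = e' i.
Proof.
move=> JK [_ _ [u [r rJ ur] cu] sK] [_ _ _ sK'] i iK.
have E k : k \notin K -> act (weylV u) e k = act (weylV u) e' k.
  move=> kK; have := sK k kK; rewrite (sK' k kK) cu !(transport_mul xo0 tw).
  by rewrite !(transport_id xo0 tw).
have := act_diff tw rJ (fun j jJ => E j (JK j jJ)) i.
rewrite -ur -!(actM tw) (weylMV xo0) !(act1 tw) (E i iK) addbb.
by case: (e i); case: (e' i).
Qed.

Lemma separated_by_continuous (T : topologicalType) (f : T -> R) a b :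
  continuous f -> f a != f b ->
  exists2 AB, (a \in AB.1 /\ b \in AB.2) &
    [/\ open AB.1, open AB.2 & AB.1 `&` AB.2 == set0].
Proof.
move=> /continuousP fc fab.
have := @Rhausdorff R; rewrite open_hausdorff => /(_ _ _ fab)[[A B] /= []].
rewrite !inE => Aa Bb [oA oB AB0].
exists (f @^-1` A, f @^-1` B); first by rewrite !inE.
split; [exact: fc|exact: fc|].
by rewrite /= -preimage_setI AB0 preimage_set0.
Qed.

(** Points over different points of the Cartan subalgebra are separated there.
    Points over the same one may be put in the same chamber; unless they are
    glued, their signs differ off the external walls and their stars are
    disjoint. *)
Lemma Mdelta_hausdorff : hausdorff_space M.
Proof.
rewrite open_hausdorff => q q' qq'.
have [xE|xE] := pselect (point_of (rep q) = point_of (rep q')); last first.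
  pose f i (q : M) : R := fund_weight i (point_of (rep q)).
  have fpi i p : f i (pi p) = fund_weight i (point_of p).
    by rewrite /f (pi_point xo0 tw (p := rep (pi p)) (q := p))// repK.
  have fo i (A : set R) : open A -> open (f i @^-1` A).
    move=> oA; apply: open_pi; apply: open_fibres => e w.
    have -> : [set x : set_type (cell xo w) | (pi @^-1` (f i @^-1` A)) (mpoint e x)] =
        (fun x : set_type (cell xo w) => fund_weight i (\val x) : R) @^-1` A.
      by apply/seteqP; split=> x; rewrite /= fpi.
    have cf : continuous (fun x : set_type (cell xo w) => fund_weight i (\val x) : R).
      exact: continuous_compT (continuous_val (w := w)) (@continuous_fund_weight R g i).
    by move/continuousP: cf => /(_ A oA).
  have [i fi] : exists i, f i q != f i q'.
    apply: contrapT => /forallNP nf; apply: xE; apply: (fund_weight_inj xo0) => i.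
    by have /negP := nf i; rewrite negbK => /eqP.
  by apply: separated_by_continuous fi; apply/continuousP => A; exact: fo.
have [p' [p1 p2 p3 p4]] := glue_chamber xo0 tw xE; rewrite repK in p1.
set p := rep q in p2 p3 p4.
have wE : in_walls p' = in_walls p /\ out_walls p' = out_walls p.
  by split; apply/setP => i; rewrite !inE p4.
have sp : star (sign_of p) (chamber_of p) (in_walls p) (out_walls p) p.
  exact: star_center.
have sp' : star (sign_of p') (chamber_of p) (in_walls p) (out_walls p) p'.
  by have := @star_center p' (sign_of p'); rewrite p2 wE.1 wE.2; apply.
pose U e := star_dom e (chamber_of p) (in_walls p) (out_walls p).
have oU e : open (U e) by exact: (star_dom_open xo0 tw (@in_out_walls p)).
have UP e a : U e (pi a) <-> star e (chamber_of p) (in_walls p) (out_walls p) a.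
  exact: (star_dom_pi xo0 tw _ _ (@in_out_walls p)).
exists (U (sign_of p), U (sign_of p')) => /=.
  by rewrite !inE -p1 -(repK q); split; apply/UP.
split => //; apply/eqP/seteqP; split => // a [/= Ua Ua'].
move/eqP: qq' => qq'; apply: qq'.
have EK := star_meet_signs (@in_out_walls p) Ua Ua'.
rewrite -p1 -(repK q) -/p; apply: (glue_signs xo0) => // k.
by apply: contraNeq => ko; rewrite EK// inE.
Qed.

Lemma rational_box (t : 'rV[R]_n) (N : set 'rV[R]_n) : nbhs t N ->
  exists b : {ffun 'I_n -> rat * rat},
    (forall i, ratr (b i).1 < t 0 i < ratr (b i).2) /\
    forall t', (forall i, ratr (b i).1 < t' 0 i < ratr (b i).2) -> N t'.
Proof.
move=> [P tP PN].
have bi i : exists c : rat * rat, ratr c.1 < t 0 i < ratr c.2 /\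
    forall r : R, ratr c.1 < r < ratr c.2 -> P 0 i r.
  have /nbhs_ballP[d /= d0 dP] := tP 0 i.
  have lt1 : t 0 i - d < t 0 i by rewrite ltrBlDr ltrDl.
  have lt2 : t 0 i < t 0 i + d by rewrite ltrDl.
  have [a] := rat_in_itvoo lt1; rewrite in_itv/= => /andP[a1 a2].
  have [b] := rat_in_itvoo lt2; rewrite in_itv/= => /andP[b1 b2].
  exists (a, b); rewrite /= a2 b1; split => // r /andP[ar rb].
  by apply: dP; rewrite /ball/= ltr_norml; apply/andP; split; lra.
exists [ffun i => projT1 (cid (bi i))]; split=> [i|t' t'b].
  by rewrite ffunE; case: cid => c [].
apply: PN => i j; rewrite ord1; have := t'b j; rewrite ffunE.
by case: cid => c [_] /=; exact.
Qed.

Lemma diff_disjoint J K j : j \in J -> j \notin K :\: J.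
Proof. by move=> jJ; rewrite finset.in_setD jJ. Qed.

(** Rational boxes in the finitely many charts form a countable basis. *)
Lemma Mdelta_second_countable : @second_countable M.
Proof.
have [r rP] := weyl_finite xo0.
pose I : countType := ({ffun 'I_n -> bool} * 'I_(size r) * {set 'I_n} * {set 'I_n} *
  {ffun 'I_n -> rat * rat})%type.
pose box (a : I) : set M :=
  let: (e, l, J, K, b) := a in
  let w := tnth (in_tuple r) l in
  star_dom e w J (K :\: J) `&` (@star_map R g act xo e w (K :\: J)) @^-1`
    [set t | forall i, ratr (b i).1 < t 0 i < ratr (b i).2].
exists (range box); first exact: (card_le_trans (card_image_le box setT) (countableP _)).
split=> [_ [[[[[e l] J] K] b] _ <-]|q N Nq].
  have oO : open [set t : 'rV[R]_n | forall i, ratr (b i).1 < t 0 i < ratr (b i).2].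
    apply: open_forall => i.
    have -> : [set t : 'rV[R]_n | ratr (b i).1 < t 0 i < ratr (b i).2] =
        [set t | ratr (b i).1 < t 0 i] `&` [set t | t 0 i < ratr (b i).2].
      by apply/seteqP; split=> t /= /andP.
    by apply: openI; [apply: open_gt_fun|apply: open_lt_fun]; exact: coord_continuous.
  exact: (star_map_open xo0 tw (@diff_disjoint J K) oO).
pose p := rep q; have /tnthP[l wl] : chamber_of p \in in_tuple r by exact: rP.
pose J := in_walls p; pose K := out_walls p.
have KJ : K :\: J = K.
  apply/finset.setP => i; rewrite finset.in_setD andb_idl// => iK.
  by apply: contraL iK; exact: in_out_walls.
pose c := star_chart xo0 tw (sign_of p) (chamber_of p) (@in_out_walls p).
have cq : cdom c q by exact: star_center.
have cN : nbhs (cfwd c q) (cbwd c @^-1` N).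
  apply: (cbwd_continuous (c := c)); first by exists q.
  by rewrite (cfwdK cq).
have [b [bt bN]] := rational_box cN.
exists (box (sign_of p, l, J, K, b)) => /=; last first.
  rewrite /box -wl KJ => q' [dq' bq'].
  have : N (cbwd c (cfwd c q')) by exact: bN _ bq'.
  by rewrite (cfwdK (c := c)).
split; first by exists (sign_of p, l, J, K, b).
by rewrite /box -wl KJ; split.
Qed.

End GlobalTopology.

(** * Smoothness of the changes of charts *)

Section Transitions.
Context {R : realType} {g : splitSemisimple R}.
Local Notation n := (rank g).
Implicit Types (x y z : cartanT g) (u v w : weyl g) (i j k : 'I_n) (J K S : {set 'I_n}).
Context {s : 'I_n -> 'I_n -> bool} {act : weyl g -> signs g -> signs g}.
Context {xo : cartanT g} (xo0 : open_dominant xo).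
Context (tw : twisted_sign_action s act).
Local Notation Mt := (Mtilde xo).
Local Notation M := (Mdelta xo act).
Local Notation pi := (@Mdelta_pi R g xo act).
Local Notation rep := (@rep R g act xo).
Local Notation star := (@star R g act xo).
Local Notation star_coord := (@star_coord R g act xo).
Local Notation transport := (@transport R g act).
Local Notation coord_point := (@coord_point R g xo).
Implicit Types (p : Mt) (q : M) (e : signs g) (t : 'rV[R]_n).

Lemma chart_image_open (X : topologicalType) m (c : chart R X m) (O : set X) :
  open O -> open (cfwd c @` (cdom c `&` O)).
Proof.
move=> oO; rewrite openE => _ [x [cx Ox] <-].
have imx : (cfwd c @` cdom c) (cfwd c x) by exists x.
have n1 : nbhs (cfwd c x) (cfwd c @` cdom c).
  by apply: open_nbhs_nbhs; split => //; exact: cfwd_open.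
have n2 : nbhs (cfwd c x) (cbwd c @^-1` O).
  apply: (cbwd_continuous imx); rewrite (cfwdK cx).
  exact: open_nbhs_nbhs.
apply: filterS2 n1 n2 => _ [x' cx' <-]; rewrite /preimage/= (cfwdK cx') => Ox'.
by exists x'.
Qed.

Lemma Ck_weight_coord_point m (U : set 'rV[R]_n) (f : cartanT g -> R) K : open U ->
  (forall x y, f (x + y) = f x + f y) -> (forall (c : R) x, f (c *: x) = c * f x) ->
  Ck m U (fun t => f (coord_point K t)).
Proof.
move=> oU fD fZ; have f0 : f 0 = 0 by rewrite -(scale0r (0 : cartanT g)) fZ mul0r.
have fE t : f (coord_point K t) = \sum_i (if i \in K then (fund_weight i xo : R) +
    - 1 * (t 0 i * t 0 i) else t 0 i) * f (coroot i).
  rewrite (big_morph f fD f0); apply: eq_bigr => i _; rewrite fZ.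
  by case: ifP => // _; rewrite mulN1r expr2.
rewrite (funext fE); apply: Ck_sum => // i; apply: Ck_mul => //; last exact: Ck_cst.
case: (i \in K); last exact: Ck_coord.
apply: Ck_add => //; first exact: Ck_cst.
apply: Ck_mul => //; first exact: Ck_cst.
by apply: Ck_mul => //; exact: Ck_coord.
Qed.

(** Along an internal wall of both stars the signs of the two centres are
    transported in parallel. *)
Lemma transport_diff e e' w w' w0 J u k : parabolic J u ->
  (forall j, j \in J -> transport w e w0 j = transport w' e' w0 j) ->
  transport w e (weylM w0 u) k (+) transport w' e' (weylM w0 u) k =
  transport w e w0 k (+) transport w' e' w0 k.
Proof.
move=> uJ ee; rewrite !(transport_mul xo0 tw).
have [r rJ ->] := parabolicV xo0 uJ; exact (act_diff tw rJ ee k).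
Qed.

Section TwoCharts.
Context (e1 : signs g) (w1 : weyl g) (J1 K1 : {set 'I_n}) (h1 : forall j, j \in J1 -> j \notin K1).
Context (e2 : signs g) (w2 : weyl g) (J2 K2 : {set 'I_n}) (h2 : forall j, j \in J2 -> j \notin K2).

Lemma star_walls e w J K p : star e w J K p ->
  (forall i, i \in in_walls p -> i \in J) /\ (forall i, i \in out_walls p -> i \in K).
Proof.
move=> [aJ oK _ _]; split=> i; rewrite inE => /eqP E; apply: contraT => N.
  by have := aJ i N; rewrite E ltxx.
by have := oK i N; rewrite E ltxx.
Qed.

(** In the star of [p0] only the internal walls through [p0] are crossed; they
    transport the signs of both centres in parallel, so the sign in front of a
    square root is constant there. On an external wall through [p0] both charts
    take the square root of the same distance, so their coordinates agree up to
    sign; elsewhere the radicand is positive and polynomial in the first chart. *)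
Lemma star_coord_local p0 j : star e1 w1 J1 K1 p0 -> star e2 w2 J2 K2 p0 ->
  let near_p0 p := [/\ star e1 w1 J1 K1 p, star e2 w2 J2 K2 p &
    star (sign_of p0) (chamber_of p0) (in_walls p0) (out_walls p0) p] in
  let L t : R := fund_weight j (weyl_fun (weylM (weylV w2) w1) (coord_point K1 t)) in
  [\/ forall p, near_p0 p -> star_coord e2 w2 K2 p 0 j = L (star_coord e1 w1 K1 p),
      exists b : bool, forall p, near_p0 p ->
        0 < fund_weight j xo - L (star_coord e1 w1 K1 p) /\
        star_coord e2 w2 K2 p 0 j =
          (-1) ^+ b * Num.sqrt (fund_weight j xo - L (star_coord e1 w1 K1 p)) |
      exists b : bool, forall p, near_p0 p ->
        star_coord e2 w2 K2 p 0 j = (-1) ^+ b * star_coord e1 w1 K1 p 0 j].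
Proof.
move=> s1 s2 near_p0 L.
have LE p : star e1 w1 J1 K1 p -> L (star_coord e1 w1 K1 p) =
    fund_weight j (weyl_fun (weylV w2) (point_of p)).
  by move=> sp; rewrite /L (coord_pointK xo0 h1 sp) weylME (weylVK xo0).
have [W1 O1] := star_walls s1; have [W2 O2] := star_walls s2.
have [jK2|jK2] := boolP (j \in K2); last first.
  by apply: Or31 => p [p1 p2 p3]; rewrite LE// mxE (negbTE jK2).
have jJ2 := contraTN (@h2 j) jK2.
have sgn2 i : i \in in_walls p0 -> transport w2 e2 (chamber_of p0) i = sign_of p0 i.
  by move=> iw; have [_ _ _ ->//] := s2; apply: h2; exact: W2.
have sgn1 i : i \in in_walls p0 -> transport w1 e1 (chamber_of p0) i = sign_of p0 i.
  by move=> iw; have [_ _ _ ->//] := s1; apply: h1; exact: W1.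
have [jo|jo] := boolP (j \in out_walls p0); last first.
  apply: Or32; exists (sign_of p0 j (+) transport w2 e2 (chamber_of p0) j) => p [p1 p2 p3].
  have [_ oo [u uJ cu] ss] := p3.
  rewrite LE// (star_weight xo0 p2 jJ2) subr_gt0; split; first exact: oo.
  rewrite mxE jK2 (star_weight xo0 p2 jJ2) (ss j jo) cu; congr ((-1) ^+ _ * _).
  rewrite (transport_diff j uJ) ?(transport_id xo0 tw)// => i iw.
  by rewrite sgn2.
have jK1 := O1 j jo; have jJ1 := contraTN (@h1 j) jK1.
apply: Or33.
exists (transport w1 e1 (chamber_of p0) j (+) transport w2 e2 (chamber_of p0) j) => p [p1 p2 p3].
have [_ _ [u uJ cu] _] := p3.
have TE : transport w1 e1 (chamber_of p) j (+) transport w2 e2 (chamber_of p) j =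
    transport w1 e1 (chamber_of p0) j (+) transport w2 e2 (chamber_of p0) j.
  by rewrite cu; apply: transport_diff uJ _ => i iw; rewrite sgn1// sgn2.
rewrite !mxE jK1 jK2 (star_weight xo0 p1 jJ1) (star_weight xo0 p2 jJ2) mulrA -TE.
rewrite -signr_addb.
have B (a b c : bool) : a (+) b = (c (+) b) (+) (a (+) c) by move: a b c => [] [] [].
by rewrite [X in (-1) ^+ nat_of_bool X * _ = _](B _ _ (transport w1 e1 (chamber_of p) j)).
Qed.

Lemma transition_smooth :
  smooth_on (cfwd (star_chart xo0 tw e1 w1 h1) @`
      (cdom (star_chart xo0 tw e1 w1 h1) `&` cdom (star_chart xo0 tw e2 w2 h2)))
    (cfwd (star_chart xo0 tw e2 w2 h2) \o cbwd (star_chart xo0 tw e1 w1 h1)).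
Proof.
set c1 := star_chart xo0 tw e1 w1 h1; set c2 := star_chart xo0 tw e2 w2 h2.
move=> m j; apply: Ck_local => _ [q0 [d1 d2] <-].
pose p0 := rep q0; pose h0 := @in_out_walls R g xo xo0 p0.
pose c0 := star_chart xo0 tw (sign_of p0) (chamber_of p0) h0.
have d0 : cdom c0 q0 by exact: (star_center xo0 tw).
pose V := cfwd c1 @` (cdom c1 `&` (cdom c2 `&` cdom c0)).
have oV : open V by apply: chart_image_open; apply: openI; exact: cdom_open.
exists V; split => //; first by exists q0.
pose L t : R := fund_weight j (weyl_fun (weylM (weylV w2) w1) (coord_point K1 t)).
have CL : Ck m V L.
  apply: (@Ck_weight_coord_point m V
    (fun x => fund_weight j (weyl_fun (weylM (weylV w2) w1) x))) => // [x y|a x];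
    last by rewrite weyl_funZ fund_weightZ.
  by rewrite linearD fund_weightD.
have cE q : cdom c1 q -> (cfwd c2 \o cbwd c1) (cfwd c1 q) 0 j =
    star_coord e2 w2 K2 (rep q) 0 j.
  by move=> cq; rewrite -[LHS]/(cfwd c2 (cbwd c1 (cfwd c1 q)) 0 j) (cfwdK (c := c1) cq).
have CbL : Ck m V (fun t => fund_weight j xo + -1 * L t).
  by apply: Ck_add => //; [exact: Ck_cst|apply: Ck_mul => //; exact: Ck_cst].
case: (star_coord_local j d1 d2) => [H|[b H]|[b H]].
- apply: (Ck_ext oV _ CL) => _ [q [dq1 [dq2 dq0]] <-].
  by rewrite cE//; symmetry; exact: H (And3 dq1 dq2 dq0).
- have Lpos t : V t -> 0 < fund_weight j xo + -1 * L t.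
    by move=> [q [dq1 [dq2 dq0]] <-]; rewrite mulN1r; have [] := H (rep q) (And3 dq1 dq2 dq0).
  have Ch : Ck m V (fun t => (-1) ^+ b * Num.sqrt (fund_weight j xo + -1 * L t)).
    by apply: Ck_mul => //; [exact: Ck_cst|exact: Ck_sqrt].
  apply: (Ck_ext oV _ Ch).
  move=> _ [q [dq1 [dq2 dq0]] <-]; rewrite cE// mulN1r; symmetry.
  by have [] := H (rep q) (And3 dq1 dq2 dq0).
- have Ch : Ck m V (fun t => (-1) ^+ b * t 0 j).
    by apply: Ck_mul => //; [exact: Ck_cst|exact: Ck_coord].
  apply: (Ck_ext oV _ Ch).
  by move=> _ [q [dq1 [dq2 dq0]] <-]; rewrite cE//; symmetry; exact: H (And3 dq1 dq2 dq0).
Qed.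

End TwoCharts.
End Transitions.

(** * The Weyl group action *)

Section Action.
Context {R : realType} {g : splitSemisimple R}.
Local Notation n := (rank g).
Implicit Types (x y z : cartanT g) (u v w : weyl g) (i j k : 'I_n) (J K S : {set 'I_n}).
Context {s : 'I_n -> 'I_n -> bool} {act : weyl g -> signs g -> signs g}.
Context {xo : cartanT g} (xo0 : open_dominant xo).
Context (tw : twisted_sign_action s act).
Local Notation Mt := (Mtilde xo).
Local Notation M := (Mdelta xo act).
Local Notation pi := (@Mdelta_pi R g xo act).
Local Notation rep := (@rep R g act xo).
Local Notation star := (@star R g act xo).
Local Notation star_coord := (@star_coord R g act xo).
Local Notation step := (@step R g act xo).
Implicit Types (p : Mt) (q : M) (e : signs g) (t : 'rV[R]_n).

Definition Mdelta_act u q : M := pi (Mtilde_act u (rep q)).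

Lemma sign_act u p : sign_of (Mtilde_act u p) = sign_of p.
Proof. by case: p => -[e w] x. Qed.

Lemma chamber_act u p : chamber_of (Mtilde_act u p) = weylM u (chamber_of p).
Proof. by case: p => -[e w] x. Qed.

Lemma point_act u p : point_of (Mtilde_act u p) = weyl_fun u (point_of p).
Proof. by case: p => -[e w] x. Qed.

Lemma base_act u p : base_of (Mtilde_act u p) = base_of p.
Proof.
by rewrite /base_of chamber_act point_act (weylVMM xo0) weylME (weylK xo0).
Qed.

Lemma step_act u p p' : step p p' -> step (Mtilde_act u p) (Mtilde_act u p').
Proof.
case=> -[i [ai sE cE pE]]; [left|right]; exists i; rewrite base_act !sign_act !chamber_act
  !point_act sE cE pE; split => //.
exact: weylMA.
Qed.

Lemma Mdelta_act_pi u p : Mdelta_act u (pi p) = pi (Mtilde_act u p).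
Proof.
pose P p' := pi (Mtilde_act u p) = pi (Mtilde_act u p').
suff : P (rep (pi p)) by move=> /esym.
apply: (pi_ind xo0 tw (P := P) _ (p := p)) => //; last by rewrite repK.
by move=> a b ab Pa; rewrite /P Pa; apply: (pi_step xo0); exact: step_act.
Qed.

Lemma Mdelta_act_induced : induced_action Mdelta_act.
Proof.
split; last exact: Mdelta_act_pi.
split=> [q|u v q].
  rewrite -[RHS]repK; congr pi.
  by apply: Mtilde_ext; rewrite ?sign_act ?chamber_act ?point_act ?weyl1M ?weyl1E.
rewrite [Mdelta_act v q]/Mdelta_act Mdelta_act_pi; congr pi.
by apply: Mtilde_ext; rewrite ?sign_act ?chamber_act ?point_act ?weylMA ?weylME.
Qed.

Lemma Mdelta_act_continuous u : continuous (Mdelta_act u).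
Proof.
apply/continuousP => A oA; apply: open_pi; apply: open_fibres => e w.
have oA' : open [set x : set_type (cell xo (weylM u w)) | A (pi (mpoint e x))].
  have oP : open (pi @^-1` A) by move/continuousP: (@continuous_pi R g act xo) => /(_ A oA).
  by have /sigT_openP/(_ (e, weylM u w)) := oP.
have [B oB BE] := oA'.
have -> : [set x : set_type (cell xo w) | (pi @^-1` (Mdelta_act u @^-1` A)) (mpoint e x)] =
    (fun x : set_type (cell xo w) => weyl_fun u (\val x)) @^-1` B.
  apply/seteqP; split=> x; rewrite /= Mdelta_act_pi.
    pose x' : set_type (cell xo (weylM u w)) := SigSub (mem_set (cellM u (set_valP x))).
    have <- : B (\val x') = A (pi (mpoint e x')) := congr1 (fun A => A x') BE.
    exact.
  pose x' : set_type (cell xo (weylM u w)) := SigSub (mem_set (cellM u (set_valP x))).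
  have xE : B (\val x') = A (pi (mpoint e x')) := congr1 (fun A => A x') BE.
  by move=> Bx; have : B (\val x') by []; rewrite xE.
have cu : continuous (fun x : set_type (cell xo w) => weyl_fun u (\val x)).
  exact: continuous_compT (continuous_val (w := w)) (continuous_weyl xo0 (w := u)).
by move/continuousP: cu => /(_ B oB).
Qed.

(** The action moves the centres of the stars; read in charts it is a change of
    charts. *)
Lemma transport_act u w0 e0 w :
  @transport R g act w0 e0 (weylM u w) = @transport R g act (weylM (weylV u) w0) e0 w.
Proof. by rewrite /transport (weylVMM xo0) -weylMA. Qed.

Lemma star_act u e0 w0 J K p :
  star e0 w0 J K (Mtilde_act u p) <-> star e0 (weylM (weylV u) w0) J K p.
Proof.
have cE v : weylM u (chamber_of p) = weylM w0 v <->
    chamber_of p = weylM (weylM (weylV u) w0) v.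
  split=> [E|->].
    by rewrite -weylMA -E weylMA (weylVM xo0) weyl1M.
  by rewrite -[in RHS](weyl1M w0) -(weylMV xo0 u) !weylMA.
rewrite /star base_act sign_act chamber_act transport_act.
by split=> -[H1 H2 [v vJ vE] H4]; split => //; exists v => //; apply/cE.
Qed.

Lemma star_coord_act u e0 w0 K p :
  star_coord e0 w0 K (Mtilde_act u p) = star_coord e0 (weylM (weylV u) w0) K p.
Proof.
apply/rowP => i; rewrite !mxE sign_act chamber_act point_act transport_act.
by rewrite (weylVMM xo0) (weylVV xo0) weylME.
Qed.

Definition star_atlas : set (chart R M n) := [set c | exists e w J K
  (JK : forall j, j \in J -> j \notin K), c = star_chart xo0 tw e w JK].

Lemma star_atlas_smooth : smooth_atlas star_atlas.
Proof.
split=> [q|_ _ [e1 [w1 [J1 [K1 [h1 ->]]]]] [e2 [w2 [J2 [K2 [h2 ->]]]]]].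
  exists (star_chart xo0 tw (sign_of (rep q)) (chamber_of (rep q))
    (@in_out_walls R g xo xo0 (rep q))).
    by eexists _, _, _, _, _.
  exact: (star_center xo0 tw).
exact: transition_smooth.
Qed.

Lemma Mdelta_act_smooth u : smooth_map star_atlas star_atlas (Mdelta_act u).
Proof.
split; first exact: Mdelta_act_continuous.
move=> _ _ [e1 [w1 [J1 [K1 [h1 ->]]]]] [e2 [w2 [J2 [K2 [h2 ->]]]]].
set c1 := star_chart xo0 tw e1 w1 h1; set c2 := star_chart xo0 tw e2 w2 h2.
pose c3 := star_chart xo0 tw e2 (weylM (weylV u) w2) h2.
have dE q : cdom c2 (Mdelta_act u q) <-> cdom c3 q.
  apply: (iff_trans (star_dom_pi xo0 tw _ _ h2 _)); exact: star_act.
have fE q : cdom c3 q -> cfwd c2 (Mdelta_act u q) = cfwd c3 q.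
  move=> cq; rewrite -[RHS]star_coord_act.
  by apply: (star_map_pi xo0 tw h2); exact/star_act.
have -> : cdom c1 `&` Mdelta_act u @^-1` cdom c2 = cdom c1 `&` cdom c3.
  by apply/seteqP; split=> q [? /dE].
have oV : open (cfwd c1 @` (cdom c1 `&` cdom c3)).
  by apply: chart_image_open; exact: cdom_open.
have T : smooth_on (cfwd c1 @` (cdom c1 `&` cdom c3)) (cfwd c3 \o cbwd c1).
  exact: transition_smooth.
move=> m j; apply: (Ck_ext oV _ (T m j)) => _ [q [d1 d3] <-].
rewrite -[LHS]/(cfwd c3 (cbwd c1 (cfwd c1 q)) 0 j).
rewrite -[RHS]/(cfwd c2 (Mdelta_act u (cbwd c1 (cfwd c1 q))) 0 j).
by rewrite (cfwdK (c := c1) d1) fE.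
Qed.

End Action.

Theorem proposition4p1 (R : realType) (g : splitSemisimple R)
    (s : 'I_(rank g) -> 'I_(rank g) -> bool)
    (act : weyl g -> signs g -> signs g) (xo : cartanT g) :
  marking s -> twisted_sign_action s act -> open_dominant xo ->
  exists (atlas : set (chart R (Mdelta xo act) (rank g)))
         (A : weyl g -> Mdelta xo act -> Mdelta xo act),
    [/\ smooth_manifold atlas,
        compact [set: Mdelta xo act],
        induced_action A &
        forall u, smooth_map atlas atlas (A u)].
Proof.
move=> _ tw xo0; exists (star_atlas xo0 tw), (@Mdelta_act R g act xo); split.
- split; [exact: Mdelta_hausdorff xo0 tw|exact: Mdelta_second_countable xo0 tw|].
  exact: star_atlas_smooth.
- exact: Mdelta_compact.
- exact: Mdelta_act_induced xo0 tw.
- exact: Mdelta_act_smooth.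
Qed.
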